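(* Let $n$ be a nonnegative integer. Then there exists an integer $u\geq 0$ such that for every integer $v\geq 1$ and all distinct primes $p_1,\ldots,p_{u+v}$ coprime to $6$, $$ped\left( \frac{3p_1\cdots p_{u+v}\cdot n-1}{8} \right)\equiv 0\pmod{2^{v}}$$ whenever $n$ is coprime to $p_1,\ldots,p_{u+v}$.
   Context: For an integer $m\ge 0$, $ped(m)$ denotes the number of partitions of $m$ in which the even parts are distinct and the odd parts are unrestricted, with $ped(0)=1$. Equivalently, $$\sum_{m=0}^{\infty} ped(m)q^m = \prod_{j=1}^{\infty}\frac{1-q^{4j}}{1-q^{j}}.$$ Convention: $ped(x)=0$ if $x$ is not a nonnegative integer. *)

(* Defs.v *)
From HB Require Import structures.
From mathcomp Require Import all_boot all_order all_algebra.

Set Implicit Arguments.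
Unset Strict Implicit.
Unset Printing Implicit Defensive.

Import Order.TTheory GRing.Theory Num.Theory.
Local Open Scope nat_scope.

(* A partition of m is encoded by its multiplicities: f i is the number of   *)
(* occurrences of the part i.+1.  Bounding parts and multiplicities by m      *)
(* loses nothing, since a part occurring k times contributes at least k to m. *)
Definition ped_partition (m : nat) (f : {ffun 'I_m -> 'I_m.+1}) : bool :=
  (\sum_(i < m) f i * i.+1 == m) && [forall i : 'I_m, odd i.+1 || (f i <= 1)].

Definition ped (m : nat) : nat :=
  #|[set f : {ffun 'I_m -> 'I_m.+1} | ped_partition f]|.

(* The test is needed: Num.truncn rounds down (and sends negatives to 0). *)
Definition ped_rat (x : rat) : nat :=
  if x \is a Num.nat then ped (Num.truncn x) else 0.

(* Main.v *)
Require Import Defs.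
From HB Require Import structures.
From mathcomp Require Import all_boot all_order all_algebra all_field.
From mathcomp Require Import boolp zify ring.

(* Let X = q * prod_m (1 + q^(16m)) / (1 + q^(16m - 8)), the series whose
   coefficient at q^(8m+1) is (-1)^m ped(m).  For an odd prime p, let H be the
   operator p U_p + eps V_p, with eps = 1 or -1.  The key fact is that
   2^j H(X^(2j+1)) is 2 times an integral combination of the 2^i X^(2i+1); hence
   r such operators map X to 2^r times an integral combination of the
   2^i X^(2i+1).  When the primes are distinct and prime to N, the coefficient
   at q^N of the result is prod p_i times that of X at q^(N prod p_i), so u = 0
   works.

   For the key fact, put Y = sqrt(2) X and w a primitive 4p-th root of unity.
   Then sqrt(2)^j H(X^j) is the sum of the j-th powers of p + 1 series, sqrt(2)
   times the X(w^(4b) q^(1/p)) and eps X(q^p).  By the Jacobi triple product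
   each of them is Y times the product of W over a half-system of a line of
   p-torsion points, where W is a quotient O / E of theta series with W(0) = Y^2.
   The duplication formulas make W a rational function of a second theta
   quotient z, whose values at torsion points are the roots of a division
   polynomial over Z[Y, 1/Y]: the power sums are therefore rational functions of
   Y.  Modulo 2 the division polynomials are powers of 1 + z, which forces W to
   be congruent to 1 modulo a (p^2 - 1)-th root pi of 2.  So the power sums are
   integral over Aint[Y, 1/Y] and divisible by pi; that ring being integrally
   closed, they are pi times Laurent polynomials in Y over Aint.  Finally a
   rational number in pi * Aint is an even integer. *)

Set Implicit Arguments.
Unset Strict Implicit.
Unset Printing Implicit Defensive.

Import Order.TTheory GRing.Theory Num.Theory.
Local Open Scope ring_scope.

(** * Formal power series *)

(** In classical terms, up to replacing q by q^(p^2) so that torsion points have integral exponents,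
    [E] and [O] are theta_3 and theta_2 of nome q^8. Hence [kap = Y^4] is the elliptic modulus k,
    [z] is k sn^2 and [W] is sqrt(k) cd; translation by [K0] takes theta_2, theta_3 to theta_1,
    theta_4. The factor sqrt(2) in Y makes Y^2 = sqrt(k) exactly: the duplication formula of z
    involves k + 1/k, which lies in Aint[Y, 1/Y], while 1/k = 1/(4 X^4) over Aint[X, 1/X] would
    bring in a denominator 2 and ruin congruences modulo 2. This is the origin of the weights 2^j
    attached to X^(2j+1).

    The obstacle is that z is even, so that it sees torsion points only up to sign, and that it
    determines only W^2. Half-systems answer the first point; multiplication by 2 permutes them up
    to sign, and W(2x) is rational in W(x)^2, which answers the second. Gaining only one factor pi,
    whose exponent depends on p, is enough in the end: since X = q + ..., expansions in powers of X
    of integral series have integral coefficients, and rationality turns pi into 2. *)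

Record fps (K : fieldType) := Fps { fcoef : nat -> K }.

Section PowerSeries.
Variable K : fieldType.
Local Notation R := (fps K).
Implicit Types (f g h : R) (N : nat).

HB.instance Definition _ := gen_eqMixin R.
HB.instance Definition _ := gen_choiceMixin R.

Lemma fpsP f g : (forall i, fcoef f i = fcoef g i) -> f = g.
Proof. by case: f g => f [g] /= fg; congr Fps; apply/funext. Qed.

Definition fps_zero := Fps (fun=> 0 : K).
Definition fps_opp f := Fps (fun i => - fcoef f i).
Definition fps_add f g := Fps (fun i => fcoef f i + fcoef g i).

Fact fps_addA : associative fps_add.
Proof. by move=> f g h; apply: fpsP => i /=; rewrite addrA. Qed.
Fact fps_addC : commutative fps_add.
Proof. by move=> f g; apply: fpsP => i /=; rewrite addrC. Qed.
Fact fps_add0 : left_id fps_zero fps_add.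
Proof. by move=> f; apply: fpsP => i /=; rewrite add0r. Qed.
Fact fps_addN : left_inverse fps_zero fps_opp fps_add.
Proof. by move=> f; apply: fpsP => i /=; rewrite addNr. Qed.

HB.instance Definition _ :=
  GRing.isZmodule.Build R fps_addA fps_addC fps_add0 fps_addN.

Definition fps_trunc N f : {poly K} := \poly_(i < N) fcoef f i.
Definition fps_one := Fps (fun i => (i == 0%N)%:R : K).
Definition fps_mul f g :=
  Fps (fun n => \sum_(i < n.+1) fcoef f i * fcoef g (n - i)).

Lemma coef_trunc_mul N n f g : (n < N)%N ->
  (fps_trunc N f * fps_trunc N g)`_n = fcoef (fps_mul f g) n.
Proof.
move=> ltnN; rewrite coefM; apply: eq_bigr => i _; rewrite !coef_poly.
have lei : (i <= n)%N by rewrite -ltnS.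
by rewrite !ifT //; [apply: leq_ltn_trans ltnN; rewrite leq_subr | apply: leq_ltn_trans ltnN].
Qed.

Fact fps_mulC : commutative fps_mul.
Proof.
by move=> f g; apply: fpsP => n; rewrite -!(@coef_trunc_mul n.+1) // mulrC.
Qed.

Fact fps_mulA : associative fps_mul.
Proof.
move=> f g h; apply: fpsP => n.
have trE (u v : R) m : (m <= n)%N -> (fps_trunc n.+1 (fps_mul u v))`_m =
    (fps_trunc n.+1 u * fps_trunc n.+1 v)`_m.
  by move=> lemn; rewrite coef_poly coef_trunc_mul // ltnS lemn.
rewrite -!(@coef_trunc_mul n.+1) //.
transitivity ((fps_trunc n.+1 f * (fps_trunc n.+1 g * fps_trunc n.+1 h))`_n).
  by rewrite !coefM; apply: eq_bigr => i _; rewrite trE // leq_subr.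
rewrite mulrA !coefM; apply: eq_bigr => i _.
by rewrite trE // -ltnS.
Qed.

Fact fps_mul1 : left_id fps_one fps_mul.
Proof.
move=> f; apply: fpsP => n /=; rewrite big_ord_recl /= mul1r subn0 big1 ?addr0 //.
by move=> i _; rewrite mul0r.
Qed.

Fact fps_mulD : left_distributive fps_mul +%R.
Proof.
move=> f g h; apply: fpsP => n /=; rewrite -big_split /=.
by apply: eq_bigr => i _; rewrite mulrDl.
Qed.

Fact fps_one_neq0 : fps_one != 0.
Proof. by apply/eqP => /(congr1 (fun f => fcoef f 0)) /eqP /=; rewrite oner_eq0. Qed.

HB.instance Definition _ := GRing.Zmodule_isComNzRing.Build R
  fps_mulA fps_mulC fps_mul1 fps_mulD fps_one_neq0.

(** Inverses come from classical choice; this leads to the integral domain instance, over which the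
    fraction field of series is formed. *)
Definition fps_unit : {pred R} := fun f => `[< exists g, g * f = 1 >].
Definition fps_inv f :=
  if pselect (exists g, g * f = 1) is left ex then projT1 (cid ex) else f.

Fact fps_mulVr : {in fps_unit, left_inverse 1 fps_inv *%R}.
Proof.
move=> f; rewrite unfold_in => /asboolP fU; rewrite /fps_inv.
by case: pselect => // ex; case: cid.
Qed.

Fact fps_unitPl f g : g * f = 1 -> f \in fps_unit.
Proof. by move=> gf; rewrite unfold_in; apply/asboolP; exists g. Qed.

Fact fps_inv_out : {in [predC fps_unit], fps_inv =1 id}.
Proof.
move=> f; rewrite inE unfold_in => /asboolPn fU; rewrite /fps_inv.
by case: pselect.
Qed.

HB.instance Definition _ := GRing.ComNzRing_hasMulInverse.Build R
  fps_mulVr fps_unitPl fps_inv_out.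

Lemma fcoef0 i : fcoef (0 : R) i = 0. Proof. by []. Qed.
Lemma fcoef1 i : fcoef (1 : R) i = (i == 0%N)%:R. Proof. by []. Qed.
Lemma fcoefD f g i : fcoef (f + g) i = fcoef f i + fcoef g i. Proof. by []. Qed.
Lemma fcoefB f g i : fcoef (f - g) i = fcoef f i - fcoef g i. Proof. by []. Qed.
Lemma fcoefM f g n :
  fcoef (f * g) n = \sum_(i < n.+1) fcoef f i * fcoef g (n - i).
Proof. by []. Qed.

Lemma fcoef_sum (I : Type) (r : seq I) (P : pred I) (F : I -> R) n :
  fcoef (\sum_(i <- r | P i) F i) n = \sum_(i <- r | P i) fcoef (F i) n.
Proof. by elim/big_rec2: _ => //= i x f _ <-. Qed.

Lemma fcoefM_low f g m n : (forall i, (i < m)%N -> fcoef f i = 0) ->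
  (forall i, (i < n)%N -> fcoef g i = 0) ->
  fcoef (f * g) (m + n) = fcoef f m * fcoef g n.
Proof.
move=> f0 g0; rewrite fcoefM.
have ltm : (m < (m + n).+1)%N by rewrite ltnS leq_addr.
rewrite (bigD1 (Ordinal ltm)) //= addKn big1 ?addr0 // => i.
rewrite -val_eqE /= => neqim.
case: (ltngtP i m) neqim => // [ltim|ltmi] _; first by rewrite f0 ?mul0r.
by rewrite g0 ?mulr0 //; have := ltn_ord i; lia.
Qed.

Lemma fps_low f : f != 0 ->
  exists2 m, fcoef f m != 0 & forall i, (i < m)%N -> fcoef f i = 0.
Proof.
move=> fN0; have ex : exists m, fcoef f m != 0.
  apply: contrapT => /forallNP f0; case/eqP: fN0; apply: fpsP => i.
  by apply/eqP; have /negP := f0 i; rewrite negbK.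
case: (ex_minnP ex) => m fm min_m; exists m => // i ltim.
by apply/eqP; apply: contraTT ltim => /min_m; rewrite -leqNgt.
Qed.

Fact fps_idomain : GRing.integral_domain_axiom R.
Proof.
move=> f g fg0; apply/norP => -[/fps_low[m fm f0] /fps_low[n gn g0]].
have := fcoefM_low f0 g0; rewrite fg0 fcoef0 => /esym/eqP.
by rewrite mulf_eq0 (negPf fm) (negPf gn).
Qed.

HB.instance Definition _ :=
  GRing.ComUnitRing_isIntegral.Build R fps_idomain.

Definition fpsC (c : K) := Fps (fun i => if i == 0%N then c else 0).

Fact fpsC_zmod : zmod_morphism fpsC.
Proof. by move=> a b; apply: fpsP => -[|i] /=; rewrite ?subr0. Qed.
Fact fpsC_monoid : monoid_morphism fpsC.
Proof.
split=> [|a b]; apply: fpsP => -[|i] //=; rewrite ?big_ord1 //=.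
by rewrite big_ord_recl /= mulr0 big1 ?addr0 // => j _; rewrite mul0r.
Qed.
HB.instance Definition _ := GRing.isZmodMorphism.Build K R fpsC fpsC_zmod.
HB.instance Definition _ := GRing.isMonoidMorphism.Build K R fpsC fpsC_monoid.

Definition mono (c : K) (k : nat) := Fps (fun i => if i == k then c else 0).

Lemma fcoef_monoM c k f n :
  fcoef (mono c k * f) n = if (k <= n)%N then c * fcoef f (n - k) else 0.
Proof.
rewrite fcoefM; case: leqP => [lekn|ltnk].
  have ltk : (k < n.+1)%N by rewrite ltnS.
  rewrite (bigD1 (Ordinal ltk)) //= eqxx big1 ?addr0 // => i.
  by rewrite -val_eqE /= => /negPf ->; rewrite mul0r.
by rewrite big1 // => i _ /=; rewrite ifN ?mul0r //; have := ltn_ord i; lia.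
Qed.

Lemma monoM c d k l : mono c k * mono d l = mono (c * d) (k + l).
Proof.
apply: fpsP => n; rewrite fcoef_monoM /=.
case: leqP => lekn; last by rewrite ifN //; lia.
have -> : (n - k == l)%N = (n == k + l)%N by lia.
by case: ifP; rewrite ?mulr0.
Qed.

Lemma mono1 : mono 1 0 = 1. Proof. by apply: fpsP => -[]. Qed.

Lemma monoX c k n : mono c k ^+ n = mono (c ^+ n) (k * n).
Proof.
elim: n => [|n IHn]; first by rewrite !expr0 muln0 mono1.
by rewrite exprS IHn monoM -exprS mulnS.
Qed.

Lemma monoC c : mono c 0 = fpsC c. Proof. by apply: fpsP => -[]. Qed.

Lemma mono_eq0 c k : (mono c k == 0) = (c == 0).
Proof.
apply/eqP/eqP => [/(congr1 (fun f => fcoef f k)) /=|->]; first by rewrite eqxx.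
by apply: fpsP => i /=; case: ifP.
Qed.

(** Congruence modulo q^N. Infinite products never occur: they are cut after about N factors, and
    [eqtruncP] turns congruences for all N into equalities. *)
Definition eqtrunc N f g := forall i, (i < N)%N -> fcoef f i = fcoef g i.

Lemma eqtrunc_refl N f : eqtrunc N f f. Proof. by []. Qed.
Lemma eqtrunc_sym N f g : eqtrunc N f g -> eqtrunc N g f.
Proof. by move=> fg i ltiN; rewrite fg. Qed.
Lemma eqtrunc_trans N g f h : eqtrunc N f g -> eqtrunc N g h -> eqtrunc N f h.
Proof. by move=> fg gh i ltiN; rewrite fg ?gh. Qed.
Lemma eqtruncW N N' f g : (N' <= N)%N -> eqtrunc N f g -> eqtrunc N' f g.
Proof. by move=> leN fg i ltiN; apply: fg; apply: leq_trans leN. Qed.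
Lemma eqtruncD N f f' g g' :
  eqtrunc N f f' -> eqtrunc N g g' -> eqtrunc N (f + g) (f' + g').
Proof. by move=> ff gg i ltiN; rewrite !fcoefD ff ?gg. Qed.
Lemma eqtruncM N f f' g g' :
  eqtrunc N f f' -> eqtrunc N g g' -> eqtrunc N (f * g) (f' * g').
Proof.
move=> ff gg n ltnN; rewrite !fcoefM; apply: eq_bigr => i _.
by rewrite ff ?gg //; have := ltn_ord i; lia.
Qed.
Lemma eqtrunc_prod N (I : Type) (r : seq I) (P : pred I) (F G : I -> R) :
  (forall i, P i -> eqtrunc N (F i) (G i)) ->
  eqtrunc N (\prod_(i <- r | P i) F i) (\prod_(i <- r | P i) G i).
Proof. by move=> FG; elim/big_rec2: _ => // i f g Pi; apply/eqtruncM/FG. Qed.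
Lemma eqtrunc_sum N (I : Type) (r : seq I) (P : pred I) (F G : I -> R) :
  (forall i, P i -> eqtrunc N (F i) (G i)) ->
  eqtrunc N (\sum_(i <- r | P i) F i) (\sum_(i <- r | P i) G i).
Proof. by move=> FG; elim/big_rec2: _ => // i f g Pi; apply/eqtruncD/FG. Qed.

Lemma eqtruncP f g : (forall N, eqtrunc N f g) -> f = g.
Proof. by move=> fg; apply: fpsP => i; apply: (fg i.+1). Qed.

Lemma eqtrunc_mono0 N c k f : (N <= k)%N -> eqtrunc N (mono c k * f) 0.
Proof. by move=> leNk i ltiN; rewrite fcoef_monoM ifN //; lia. Qed.

(** A nonzero constant term makes [d] invertible, so dividing by it loses no precision. *)
Lemma eqtrunc_cancel N f g d : fcoef d 0 != 0 ->
  eqtrunc N (f * d) (g * d) -> eqtrunc N f g.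
Proof.
move=> d0 fg; elim/ltn_ind => n IHn ltnN; apply/eqP; rewrite -subr_eq0.
have: fcoef ((f - g) * d) (n + 0) = 0.
  by rewrite addn0 mulrBl fcoefB fg // subrr.
rewrite fcoefM_low // => [/eqP|i ltin]; first by rewrite mulf_eq0 (negPf d0) orbF.
by rewrite fcoefB IHn ?subrr //; apply: ltn_trans ltnN.
Qed.

Lemma fcoef_prod0 (I : Type) (r : seq I) (P : pred I) (F : I -> R) :
  fcoef (\prod_(i <- r | P i) F i) 0 = \prod_(i <- r | P i) fcoef (F i) 0.
Proof.
elim/big_rec2: _ => // i x f _ <-.
by rewrite fcoefM big_ord1.
Qed.

(** The substitution q -> c q^k. *)
Definition fsubst c k f :=
  Fps (fun n => if (k %| n)%N then fcoef f (n %/ k) * c ^+ (n %/ k) else 0).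

Fact fsubst_zmod c k : zmod_morphism (fsubst c k).
Proof.
by move=> f g; apply: fpsP => n /=; case: ifP => _; rewrite ?subrr ?mulrBl.
Qed.
HB.instance Definition _ c k :=
  GRing.isZmodMorphism.Build R R (fsubst c k) (fsubst_zmod c k).

Lemma fsubstM c k f g : (0 < k)%N -> fsubst c k (f * g) = fsubst c k f * fsubst c k g.
Proof.
move=> k0; apply: fpsP => n; rewrite fcoefM /=; case: ifPn => kn; last first.
  rewrite big1 // => i _; case: ifP => ki; last by rewrite mul0r.
  rewrite ifN ?mulr0 //; apply: contra kn => kni.
  by rewrite -(subnKC (_ : i <= n)%N) ?dvdn_add // -ltnS.
case/dvdnP: kn => m ->; rewrite mulnK // mulr_suml.
pose F i := fcoef (fsubst c k f) i * fcoef (fsubst c k g) (m * k - i).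
rewrite -[RHS]/(\sum_(i < (m * k).+1) F i) -(big_mkord xpredT F).
rewrite (bigID (fun i => k %| i)%N) /= [X in _ + X]big1 ?addr0; last first.
  by move=> i /negPf ki; rewrite /F /= ki mul0r.
rewrite -(big_mkord xpredT (fun i => fcoef f i * fcoef g (m - i) * c ^+ m)).
rewrite -big_filter -[RHS]big_filter filter_predT.
have -> : [seq i <- index_iota 0 (m * k).+1 | k %| i]%N =
    [seq (i * k)%N | i <- index_iota 0 m.+1].
  apply: (@sorted_eq _ ltn); [exact: ltn_trans | by move=> x y; lia | | |].
  - by apply: sorted_filter; [exact: ltn_trans | exact: iota_ltn_sorted].
  - by rewrite sorted_map; apply: sub_sorted (iota_ltn_sorted _ _) => x y /=; rewrite ltn_pmul2r.
  apply: uniq_perm; first by rewrite filter_uniq ?iota_uniq.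
    by rewrite map_inj_uniq ?iota_uniq // => x y /eqP; rewrite eqn_pmul2r // => /eqP.
  move=> i; rewrite mem_filter mem_index_iota; apply/andP/mapP => /=.
    case=> /dvdnP[j ->] lt; exists j => //; rewrite mem_index_iota /=.
    by move: lt; rewrite !ltnS leq_pmul2r.
  by case=> j; rewrite mem_index_iota /= => lt ->; rewrite dvdn_mull // ltnS leq_pmul2r.
rewrite big_map big_seq [RHS]big_seq; apply: eq_bigr => i.
rewrite mem_index_iota /= ltnS => leim.
rewrite /F /= dvdn_mull // -mulnBl dvdn_mull // !mulnK //.
by rewrite mulrACA -exprD subnKC.
Qed.

Lemma fsubst1 c k : (0 < k)%N -> fsubst c k 1 = 1.
Proof.
move=> k0; apply: fpsP => -[|n] /=; first by rewrite dvdn0 div0n expr0 mulr1.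
case: ifP => // kn; rewrite -[_ == 0%N]negbK -lt0n divn_gt0 // dvdn_leq //=.
by rewrite mul0r.
Qed.

Lemma fsubst_mono c k d l : (0 < k)%N -> fsubst c k (mono d l) = mono (d * c ^+ l) (k * l).
Proof.
move=> k0; apply: fpsP => n /=; case: ifPn => [/dvdnP[m ->]|kn].
  by rewrite mulnK // mulnC eqn_pmul2l //; case: eqP => [->|]; rewrite ?mul0r.
by rewrite ifN //; apply: contra kn => /eqP ->; rewrite dvdn_mulr.
Qed.

Lemma fsubstX c k f n : (0 < k)%N -> fsubst c k (f ^+ n) = fsubst c k f ^+ n.
Proof.
move=> k0; elim: n => [|n IHn]; first by rewrite !expr0 fsubst1.
by rewrite !exprS fsubstM // IHn.
Qed.

Lemma fsubst_prod c k (I : Type) (r : seq I) (P : pred I) (F : I -> R) : (0 < k)%N ->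
  fsubst c k (\prod_(i <- r | P i) F i) = \prod_(i <- r | P i) fsubst c k (F i).
Proof.
move=> k0; elim/big_rec2: _ => [|i f g _ <-]; first exact: fsubst1.
by rewrite fsubstM.
Qed.

Lemma eqtrunc_fsubst N c k f g : (0 < k)%N -> eqtrunc N f g ->
  eqtrunc N (fsubst c k f) (fsubst c k g).
Proof.
move=> k0 fg n ltnN /=; case: ifP => // kn; rewrite fg //.
by apply: leq_ltn_trans ltnN; apply: leq_div.
Qed.

End PowerSeries.

(** * Division polynomials modulo 2 *)

Section ModTwo.
Variable R : comNzRingType.
Implicit Types A B C D : R.

(** Congruence modulo 2, used in [{poly S}]. *)
Definition eq2 A B := exists D, A = B + D *+ 2.

Lemma eq2_refl A : eq2 A A. Proof. by exists 0; rewrite mul0rn addr0. Qed.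
Lemma eq2_eq A B : A = B -> eq2 A B. Proof. by move=> ->; apply: eq2_refl. Qed.
Lemma eq2_trans B A C : eq2 A B -> eq2 B C -> eq2 A C.
Proof. by move=> [D ->] [E ->]; exists (E + D); ring. Qed.
Lemma eq2D A A' B B' : eq2 A A' -> eq2 B B' -> eq2 (A + B) (A' + B').
Proof. by move=> [D ->] [E ->]; exists (D + E); ring. Qed.
Lemma eq2B A A' B B' : eq2 A A' -> eq2 B B' -> eq2 (A - B) (A' - B').
Proof. by move=> [D ->] [E ->]; exists (D - E); ring. Qed.
Lemma eq2M A A' B B' : eq2 A A' -> eq2 B B' -> eq2 (A * B) (A' * B').
Proof. by move=> [D ->] [E ->]; exists (D * B' + A' * E + (D * E) *+ 2); ring. Qed.
Lemma eq2X A A' n : eq2 A A' -> eq2 (A ^+ n) (A' ^+ n).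
Proof.
by move=> AA; elim: n => [|n IHn]; rewrite ?exprS; [apply: eq2_refl | apply: eq2M].
Qed.
Lemma eq2_dbl A : eq2 (A *+ 2) 0. Proof. by exists A; rewrite add0r. Qed.
Lemma eq2N A : eq2 (- A) A. Proof. by exists (- A); ring. Qed.
Lemma eq2_sqrD A B : eq2 (A ^+ 2 - B ^+ 2) ((A + B) ^+ 2).
Proof. by exists (- A * B - B ^+ 2); ring. Qed.
End ModTwo.

(** * Division polynomials of an abstract pair of theta functions *)

Section MultiplicationPolynomials.
Variables (S : comNzRingType) (KK : fieldType) (f : {rmorphism S -> KK}).
Variables (V : zmodType) (a b : V -> KK) (al : S).
Hypothesis b_neq0 : forall x, b x != 0.
Hypothesis a_add : forall x y,
  a (x + y) * a (x - y) = a x ^+ 2 * b y ^+ 2 - b x ^+ 2 * a y ^+ 2.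
Hypothesis b_add : forall x y,
  b (x + y) * b (x - y) = b x ^+ 2 * b y ^+ 2 - a x ^+ 2 * a y ^+ 2.
Hypothesis b0 : b 0 = 1.
Hypothesis a_dbl : forall x, a (x *+ 2) ^+ 2 =
  4%:R * a x ^+ 2 * b x ^+ 2 *
  (b x ^+ 4 - f al * a x ^+ 2 * b x ^+ 2 + a x ^+ 4).

Definition ev (P : {poly S}) (z : KK) := (map_poly f P).[z].
(** In the application [a] and [b] are theta_1 and theta_4 suitably normalised, [zz] is k sn^2, and
    [a_dbl] is the duplication formula of sn, with [f al] = k + 1/k. *)
Definition zz x := a x ^+ 2 / b x ^+ 2.

Lemma evD P Q z : ev (P + Q) z = ev P z + ev Q z.
Proof. by rewrite /ev rmorphD hornerD. Qed.
Lemma evN P z : ev (- P) z = - ev P z.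
Proof. by rewrite /ev rmorphN hornerN. Qed.
Lemma evM P Q z : ev (P * Q) z = ev P z * ev Q z.
Proof. by rewrite /ev rmorphM hornerM. Qed.
Lemma ev_exp P n z : ev (P ^+ n) z = ev P z ^+ n.
Proof. by rewrite /ev rmorphXn horner_exp. Qed.
Lemma evX z : ev 'X z = z. Proof. by rewrite /ev map_polyX hornerX. Qed.
Lemma evC c z : ev c%:P z = f c. Proof. by rewrite /ev map_polyC hornerC. Qed.
Lemma evMn P n z : ev (P *+ n) z = ev P z *+ n.
Proof. by rewrite /ev rmorphMn /= hornerMn. Qed.
Definition evE := (evD, evN, evM, ev_exp, evX, evC, evMn).

(* [a] and [b] behave like two theta functions: multiplication by [m] acts on
   [z = a^2 / b^2] through the division polynomials [U / T], and modulo 2 these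
   are powers of [1 + z]. *)
Record mulpoly m (U T : {poly S}) := Mulpoly {
  mp_U2 : exists2 U', U = 'X * U' &
    eq2 U' (if odd m then (1 + 'X) ^+ (m ^ 2).-1 else 0);
  mp_monic : (if odd m then U else T) \is monic;
  mp_size : size (if odd m then U else T) = (m ^ 2).+1;
  mp_small : (size (if odd m then T else U) <= m ^ 2)%N;
  mp_T2 : eq2 T ((1 + 'X) ^+ (if odd m then (m ^ 2).-1 else m ^ 2)%N);
  mp_a : forall u, a u != 0 -> a (u *+ m) ^+ 2 = b u ^+ (2 * m ^ 2) * ev U (zz u);
  mp_b : forall u, a u != 0 -> b (u *+ m) ^+ 2 = b u ^+ (2 * m ^ 2) * ev T (zz u) }.

(** For odd m the addition formulas give a(mu) and b(mu) themselves, not only their squares; these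
    unsquared forms are what the values of W at torsion points require. The sign [s] is there to
    make [P] monic. *)
Record oddpoly m (P C : {poly S}) (s : bool) := Oddpoly {
  op_monic : P \is monic;
  op_size : size P = ((m ^ 2)./2).+1;
  op_small : (size C <= ((m ^ 2)./2).+1)%N;
  op_P2 : eq2 P ((1 + 'X) ^+ (m ^ 2)./2);
  op_C2 : eq2 C ((1 + 'X) ^+ (m ^ 2)./2);
  op_a : forall u, a u != 0 -> a (u *+ m) =
    (-1) ^+ s * b u ^+ (m ^ 2).-1 * a u * ev P (zz u);
  op_b : forall u, a u != 0 -> b (u *+ m) = b u ^+ (m ^ 2) * ev C (zz u) }.

Let szM (P Q : {poly S}) : (size (P * Q)%R <= (size P + size Q).-1)%N.
Proof. exact: size_polyMleq. Qed.
Let szMm (P Q : {poly S}) : P \is monic -> Q \is monic ->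
  size (P * Q) = (size P + size Q).-1.
Proof. by move=> Pm Qm; apply: size_Mmonic => //; apply: monic_neq0. Qed.

Lemma mulpoly_odd m P C s : odd m -> oddpoly m P C s ->
  mulpoly m ('X * P ^+ 2) (C ^+ 2).
Proof.
move=> m_odd [Pm Ps Cs P2 C2 Pa Cb].
have m2E : (m ^ 2 = ((m ^ 2)./2).*2.+1)%N.
  by rewrite -[LHS]odd_double_half oddX m_odd orbT.
split; rewrite ?m_odd.
- exists (P ^+ 2) => //.
  by move/(eq2X 2): P2; rewrite -exprM; congr eq2; congr (_ ^+ _); lia.
- by rewrite monicMr ?monicX // monic_exp.
- rewrite size_Mmonic ?polyX_eq0 ?monic_exp // size_polyX expr2 size_Mmonic ?monic_neq0 // Ps.
  by move: m2E; lia.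
- by apply: leq_trans (szM _ _) _; move: Cs m2E; lia.
- by move/(eq2X 2): C2; rewrite -exprM; congr eq2; congr (_ ^+ _); lia.
- move=> u u0; rewrite Pa // !evE !exprMn sqrr_sign mul1r {2}/zz -exprM.
  rewrite {2}m2E [(2 * _)%N](_ : _ = (m ^ 2).-1 * 2 + 2)%N; last by lia.
  by rewrite exprD; field; apply: b_neq0.
- by move=> u u0; rewrite Cb // exprMn -exprM evE mulnC.
Qed.

Let expr4 (x : KK) : x ^+ 4 = (x ^+ 2) ^+ 2. Proof. by ring. Qed.

Lemma b_dbl x : b (x *+ 2) = b x ^+ 4 - a x ^+ 4.
Proof.
by have := b_add x x; rewrite subrr b0 mulr1 mulr2n => ->; ring.
Qed.

Lemma size_monic_lt (P Q : {poly S}) m n : P \is monic -> size P = m.+1 ->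
  (size Q <= n)%N -> (size (P * Q)%R <= m + n)%N.
Proof.
move=> mP sP sQ; apply: leq_trans (szM _ _) _; rewrite sP; lia.
Qed.

(** The factor 4 of the duplication formula kills the numerator modulo 2. The denominator is
    congruent to (T + U)^4, and T + U is congruent to (1 + X)^(n^2) for both parities of n. *)
Lemma mulpoly_double n U T : (0 < n)%N -> mulpoly n U T ->
  mulpoly n.*2 ((U * T * (T ^+ 2 - al%:P * (U * T) + U ^+ 2)) *+ 4)
    ((T ^+ 2 - U ^+ 2) ^+ 2).
Proof.
move=> n0 [[U' UE U2] Mm Ms Sm T2 Ha Hb].
have n2 (_ : unit) : ((n.*2) ^ 2 = (2 * n ^ 2) + (2 * n ^ 2))%N by lia.
have N0 : (0 < n ^ 2)%N by rewrite expn_gt0 n0.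
move: (n ^ 2)%N n2 N0 Ms Sm U2 T2 Ha Hb => N n2 N0 Ms Sm U2 T2 Ha Hb.
(* The parity of n decides which of U, T dominates; the square is the same for both orders of the
   difference. *)
have [D [Dmon Ds DE]] : exists D : {poly S}, [/\ D \is monic,
    size D = (2 * N).+1 & (T ^+ 2 - U ^+ 2) ^+ 2 = D ^+ 2].
  have gen (P Q : {poly S}) : P \is monic -> size P = (N).+1 ->
      (size Q <= N)%N ->
      P ^+ 2 - Q ^+ 2 \is monic /\ size (P ^+ 2 - Q ^+ 2) = (2 * N).+1.
    move=> mP sP sQ; have sP2 : size (P ^+ 2) = (2 * N).+1.
      by rewrite expr2 szMm // sP; lia.
    have sQ2 : (size (- Q ^+ 2)%R < size (P ^+ 2)%R)%N.
      by rewrite size_polyN sP2 expr2; apply: leq_ltn_trans (szM _ _) _; lia.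
    by rewrite size_polyDl // monicE lead_coefDl // -monicE monic_exp.
  case: ifP Mm Ms Sm => _ Mm Ms Sm.
    have [Dm Dsz] := gen _ _ Mm Ms Sm.
    by exists (U ^+ 2 - T ^+ 2); split=> //; ring.
  by have [Dm Dsz] := gen _ _ Mm Ms Sm; exists (T ^+ 2 - U ^+ 2).
have szUT : (size (U * T)%R <= 2 * N)%N.
  case: ifP Mm Ms Sm => _ Mm Ms Sm; last rewrite mulrC;
    by apply: leq_trans (size_monic_lt Mm Ms Sm) _; lia.
have szUT2 : (size (T ^+ 2 - al%:P * (U * T) + U ^+ 2)%R <= (2 * N).+1)%N.
  have [szU szT] : (size U <= N.+1)%N /\ (size T <= N.+1)%N.
    by case: ifP Ms Sm => _ -> Sm; rewrite leqnn ltnW.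
  apply: leq_trans (size_polyD _ _) _; rewrite geq_max; apply/andP; split; last first.
    by rewrite expr2; apply: leq_trans (szM _ _) _; lia.
  apply: leq_trans (size_polyD _ _) _; rewrite geq_max; apply/andP; split.
    by rewrite expr2; apply: leq_trans (szM _ _) _; lia.
  rewrite size_polyN mul_polyC; apply: leq_trans (size_scale_leq _ _) _; exact: leqW.
split; rewrite ?odd_double ?(n2 tt).
- exists ((U' * T * (T ^+ 2 - al%:P * (U * T) + U ^+ 2)) *+ 4); first by rewrite UE; ring.
  by rewrite (_ : 4 = 2 * 2)%N // mulrnA; apply: eq2_dbl.
- by rewrite DE monic_exp.
- by rewrite DE expr2 size_Mmonic ?monic_neq0 // Ds; lia.
- rewrite -mulr_natl -polyC_natr mul_polyC; apply: leq_trans (size_scale_leq _ _) _.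
  by apply: leq_trans (szM _ _) _; lia.
- apply: eq2_trans (_ : eq2 _ (((T + U) ^+ 2) ^+ 2)) _.
    by apply: eq2X; apply: eq2_sqrD.
  have TU : eq2 (T + U) ((1 + 'X) ^+ (N)).
    rewrite UE; apply: eq2_trans (eq2D T2 (eq2M (eq2_refl 'X) U2)) _.
    case: ifP => _; last by rewrite mulr0 addr0; apply: eq2_refl.
    have -> : (N = (N).-1.+1)%N by lia.
    by rewrite exprS mulrDl mul1r; apply: eq2_refl.
  move/(eq2X 2)/(eq2X 2): TU; rewrite -!exprM; congr eq2; congr (_ ^+ _); lia.
- move=> u u0; rewrite -muln2 mulrnA a_dbl !expr4 Ha // Hb //.
  rewrite (_ : 2 * (2 * N + 2 * N) = 2 * N * 4)%N; last by lia.
  by rewrite !evE (exprM _ (2 * N)); ring.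
- move=> u u0; rewrite -muln2 mulrnA b_dbl !expr4 Ha // Hb //.
  rewrite (_ : 2 * (2 * N + 2 * N) = 2 * N * 4)%N; last by lia.
  by rewrite !evE (exprM _ (2 * N)); ring.
Qed.

(** The addition formulas are taken at (n+1)u and nu, whose sum is (2n+1)u and whose difference is
    u; the factor a(u) or b(u) is then cancelled. One of n, n+1 is even, so one of the two products
    in each difference vanishes modulo 2 and a single power of 1 + X remains. *)
Lemma oddpoly_step n U T U1 T1 : (0 < n)%N -> mulpoly n U T -> mulpoly n.+1 U1 T1 ->
  exists P C s, oddpoly n.*2.+1 P C s.
Proof.
move=> n0 [[U' UE U2] Mm Ms Sm T2 Ha Hb] [[U1' U1E U12] Mm1 Ms1 Sm1 T12 Ha1 Hb1].
pose m := (n ^ 2 + n.+1 ^ 2)%N.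
have mE : ((n.*2.+1 ^ 2)./2 = m.-1)%N by rewrite /m; lia.
have mE2 : (n.*2.+1 ^ 2 = m + m.-1)%N by rewrite /m; lia.
have m0 : (1 < m)%N by rewrite /m; lia.
have szC : (size (T1 * T - U1 * U)%R <= m)%N.
  apply: leq_trans (size_polyD _ _) _; rewrite geq_max size_polyN.
  move: Mm Ms Sm Mm1 Ms1 Sm1; rewrite oddS; case: (odd n) => /= Mm Ms Sm Mm1 Ms1 Sm1.
    by rewrite {1}/m addnC (size_monic_lt Mm1 Ms1 Sm) mulrC (size_monic_lt Mm Ms Sm1).
  by rewrite mulrC (size_monic_lt Mm Ms Sm1) /m addnC (size_monic_lt Mm1 Ms1 Sm).
have C2 : eq2 (T1 * T - U1 * U) ((1 + 'X) ^+ m.-1).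
  rewrite UE U1E.
  apply: eq2_trans (eq2B (eq2M T12 T2) (eq2M (eq2M (eq2_refl 'X) U12) (eq2M (eq2_refl 'X) U2))) _.
  rewrite oddS; case: (odd n) => /=; rewrite -exprD ?(mul0r, mulr0) subr0;
    apply: eq2_eq; congr (_ ^+ _); rewrite /m; lia.
pose P0 := U1' * T - U' * T1.
have XP0 : 'X * P0 = U1 * T - U * T1 by rewrite UE U1E /P0; ring.
have P02 : eq2 P0 ((1 + 'X) ^+ m.-1).
  apply: eq2_trans (eq2B (eq2M U12 T2) (eq2M U2 T12)) _.
  rewrite oddS; case: (odd n) => /=; rewrite -exprD ?(mul0r, mulr0) ?subr0 ?sub0r;
    try apply: eq2_trans (eq2N _) _;
    apply: eq2_eq; congr (_ ^+ _); rewrite /m; lia.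
(* The dominant term of U1 T - U T1 is the first one when n is even and the second one when n is
   odd, whence the sign. *)
have [s [P [PE Pm Psz]]] : exists (s : bool) (P : {poly S}),
   [/\ P0 = (-1) ^+ s * P, P \is monic & size P = m].
  have gen (A A1 B B1 : {poly S}) : A \is monic -> size A = (n ^ 2).+1 ->
      A1 \is monic -> size A1 = (n.+1 ^ 2).+1 -> (size B <= n ^ 2)%N ->
      (size B1 <= n.+1 ^ 2)%N ->
      A1 * A - B * B1 \is monic /\ size (A1 * A - B * B1) = m.+1.
    move=> mA sA mA1 sA1 sB sB1.
    have sAA : size (A1 * A) = m.+1 by rewrite szMm // sA sA1 /m addSn /= addnC addSn.
    have sBB : (size (- (B * B1))%R < size (A1 * A)%R)%N.
      rewrite size_polyN sAA ltnS; apply: leq_trans (szM _ _) _.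
      by rewrite (leq_trans (leq_pred _)) // leq_add.
    by rewrite size_polyDl // monicE lead_coefDl // -monicE monicMl.
  have XP (P : {poly S}) : 'X * P \is monic -> size ('X * P) = m.+1 ->
      P \is monic /\ size P = m.
    rewrite monicMl ?monicX // => Pm; rewrite szMm ?monicX // size_polyX.
    by rewrite add2n /= => /succn_inj.
  move: Mm Ms Sm Mm1 Ms1 Sm1; rewrite oddS; case: (odd n) => /= Mm Ms Sm Mm1 Ms1 Sm1.
    exists true, (- P0); rewrite expr1 mulN1r opprK.
    have [] := gen _ _ _ _ Mm Ms Mm1 Ms1 Sm Sm1.
    rewrite (_ : T1 * U - T * U1 = 'X * (- P0)); first by move=> /XP H /H[].
    by rewrite mulrN XP0; ring.
  exists false, P0; rewrite expr0 mul1r.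
  have [] := gen _ _ _ _ Mm Ms Mm1 Ms1 Sm Sm1.
  by rewrite -XP0 => /XP H /H[].
exists P, (T1 * T - U1 * U), s; split; rewrite ?mE ?prednK ?(ltnW m0) //.
- apply: eq2_trans P02; rewrite PE; case: s {PE}; rewrite ?expr0 ?mul1r; last exact: eq2_refl.
  by rewrite expr1 mulN1r; exists P; ring.
- move=> u u0; rewrite mE2.
  have := a_add (u *+ n.+1) (u *+ n).
  rewrite -mulrnDr -mulrnBr // subSnn mulr1n (_ : n.+1 + n = n.*2.+1)%N; last by lia.
  rewrite Ha // Hb // Ha1 // Hb1 // => E; apply: (mulIf u0); rewrite E.
  transitivity (b u ^+ (2 * n.+1 ^ 2) * b u ^+ (2 * n ^ 2) * ev ('X * P0) (zz u)).
    by rewrite XP0 !evE; ring.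
  rewrite -exprD (_ : 2 * n.+1 ^ 2 + 2 * n ^ 2 = (m + m.-1).-1 + 2)%N; last by rewrite /m; lia.
  rewrite exprD PE evM evX evM ev_exp evN /ev rmorph1 hornerC /zz; field; exact: b_neq0.
- move=> u u0; rewrite mE2.
  have := b_add (u *+ n.+1) (u *+ n).
  rewrite -mulrnDr -mulrnBr // subSnn mulr1n (_ : n.+1 + n = n.*2.+1)%N; last by lia.
  rewrite Ha // Hb // Ha1 // Hb1 // => E; apply: (mulIf (b_neq0 u)); rewrite E.
  transitivity (b u ^+ (2 * n.+1 ^ 2) * b u ^+ (2 * n ^ 2) * ev (T1 * T - U1 * U) (zz u)).
    by rewrite !evE; ring.
  rewrite -exprD (_ : 2 * n.+1 ^ 2 + 2 * n ^ 2 = (m + m.-1) + 1)%N; last by rewrite /m; lia.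
  by rewrite exprD expr1; ring.
Qed.

(** Binary descent: even m comes from m/2 by doubling, odd m > 1 from (m-1)/2 and (m+1)/2 by
    addition. *)
Lemma mulpoly_exists m : (0 < m)%N ->
  (exists U T, mulpoly m U T) /\ (odd m -> exists P C s, oddpoly m P C s).
Proof.
elim/ltn_ind: m => m IHm m0.
suff IH : odd m -> exists P C s, oddpoly m P C s.
  split=> //; case: (boolP (odd m)) => [modd|meven].
    by have [P [C [s H]]] := IH modd; exists ('X * P ^+ 2), (C ^+ 2); apply: mulpoly_odd H.
  have mE : m = (m./2).*2 by rewrite -[LHS]odd_double_half (negPf meven).
  have h0 : (0 < m./2)%N by lia.
  have [|//|[U [T UT]] _] := IHm m./2; first by lia.
  by eexists; eexists; rewrite mE; apply: mulpoly_double h0 UT.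
move=> modd; have [->|m1] := eqVneq m 1%N.
  exists 1, 1, false; split; rewrite ?monic1 ?size_poly1 ?expr0 //; try exact: eq2_refl.
  - by move=> u _; rewrite mulr1n expr0 !mul1r /ev rmorph1 hornerC mulr1.
  - by move=> u _; rewrite mulr1n expr1 /ev rmorph1 hornerC mulr1.
have mE : m = (m./2).*2.+1 by rewrite -[LHS]odd_double_half modd.
have h0 : (0 < m./2)%N by lia.
have [|//|[U [T UT]] _] := IHm m./2; first by lia.
have [|//|[U1 [T1 UT1]] _] := IHm m./2.+1; first by lia.
by rewrite mE; apply: oddpoly_step h0 UT UT1.
Qed.
End MultiplicationPolynomials.

(** * Rational functions of the torsion parameters *)

Section RationalFunctionsOfRoots.
Variables (KK : fieldType) (F : divringClosed KK) (T : finType) (z : T -> KK).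
Hypothesis z_inj : injective z.
Variable c : 'I_#|T| -> KK.
Hypothesis Fc : forall k, c k \in F.
Hypothesis zc : forall t, z t ^+ #|T| = \sum_k c k * z t ^+ k.

Let d := #|T|.
Let row_of (h : T -> KK) : 'rV[KK]_d := \row_i h (enum_val i).
Let Vd : 'M[KK]_d := Vandermonde d (row_of z).

Let Vd_unit : Vd \in unitmx.
Proof.
rewrite unitmxE det_Vandermonde unitfE; apply/prodf_neq0 => i _.
apply/prodf_neq0 => j ltij; rewrite !mxE subr_eq0; apply/eqP => /z_inj/enum_val_inj ji.
by move: ltij; rewrite ji ltnn.
Qed.

(* [mx_of h] is the matrix, in the basis of powers of [z], of multiplication by
   [h] in the algebra of functions on the roots. *)
Let mx_of h := Vd *m diag_mx (row_of h) *m invmx Vd.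

Definition rat_fun h := `[< mx_of h \is a mxOver F >].

Lemma rat_fun_ext g h : g =1 h -> rat_fun g -> rat_fun h.
Proof.
move=> gh /asboolP Fg; apply/asboolP.
by rewrite (_ : h = g) //; apply/funext => t.
Qed.

(** In the basis of powers, multiplication by [z] is the companion matrix of the monic equation
    [zc]. *)
Lemma rat_fun_id : rat_fun z.
Proof.
apply/asboolP.
pose C : 'M[KK]_d := \matrix_(i, k) if (i.+1 < d)%N then ((k == i.+1 :> nat)%:R) else c k.
have -> : mx_of z = C.
  rewrite /mx_of (_ : Vd *m diag_mx (row_of z) = C *m Vd) ?mulmxK //.
  apply/matrixP => i j; rewrite mul_mx_diag !mxE -exprSr.
  under eq_bigr => k _ do rewrite !mxE.
  case: ltnP => [ltid|leid].
    rewrite (bigD1 (Ordinal ltid)) //= eqxx mul1r big1 ?addr0 // => k.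
    by rewrite -val_eqE /= => /negPf ->; rewrite mul0r.
  have -> : i.+1 = d by apply/eqP; rewrite eqn_leq leid ltn_ord.
  exact: zc.
by apply/mxOverP => i k; rewrite mxE; case: ifP => _ //; apply: rpred_nat.
Qed.

Lemma rat_funC x : x \in F -> rat_fun (fun=> x).
Proof.
move=> Fx; apply/asboolP; rewrite /mx_of (_ : diag_mx _ = x%:M).
  by rewrite mul_mx_scalar -scalemxAl mulmxV // scalemx1 mxOver_scalar ?rpred0.
by apply/matrixP => i j; rewrite !mxE.
Qed.

Lemma rat_funD g h : rat_fun g -> rat_fun h -> rat_fun (fun t => g t + h t).
Proof.
move=> /asboolP Fg /asboolP Fh; apply/asboolP; rewrite (_ : mx_of _ = mx_of g + mx_of h) ?rpredD //.
rewrite /mx_of -mulmxDl -mulmxDr -linearD; congr (_ *m diag_mx _ *m _).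
by apply/rowP => i; rewrite !mxE.
Qed.

Lemma rat_funM g h : rat_fun g -> rat_fun h -> rat_fun (fun t => g t * h t).
Proof.
move=> /asboolP Fg /asboolP Fh; apply/asboolP.
rewrite (_ : mx_of _ = mx_of g *m mx_of h); first exact: mxOverM.
rewrite /mx_of !mulmxA mulmxKV // -[Vd *m _ *m diag_mx _]mulmxA mulmx_diag.
by congr (_ *m diag_mx _ *m _); apply/rowP => i; rewrite !mxE.
Qed.

Lemma rat_funN g : rat_fun g -> rat_fun (fun t => - g t).
Proof.
move=> /rat_funM/(_ (rat_funC (rpredN1 F))); apply: rat_fun_ext => t; exact: mulrN1.
Qed.

(** [mx_of] is multiplicative, so inverting a function inverts its matrix, and the cofactor formula
    stays in [F]. *)
Lemma rat_funV g : (forall t, g t != 0) -> rat_fun g -> rat_fun (fun t => (g t)^-1).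
Proof.
move=> g0 /asboolP Fg; apply/asboolP; set h := fun t => _.
have gh : mx_of g *m mx_of h = 1%:M.
  rewrite /mx_of !mulmxA mulmxKV // -[Vd *m _ *m diag_mx _]mulmxA mulmx_diag.
  rewrite (_ : diag_mx _ = 1%:M) ?mulmx1 ?mulmxV //.
  apply/matrixP => i j; rewrite !mxE; congr (_ *+ _).
  by rewrite /h divff.
have Fdet n (A : 'M[KK]_n) : A \is a mxOver F -> \det A \in F.
  move/mxOverP => FA; rewrite /determinant rpred_sum // => s _.
  by rewrite rpredM ?rpred_prod // ?rpredX ?rpredN1.
rewrite (_ : mx_of h = invmx (mx_of g)); last first.
  by rewrite -[RHS]mulmx1 -gh mulKmx // (mulmx1_unit gh).1.
move: (mx_of g) Fg => G FG.
rewrite /invmx; case: ifP => // _; apply: mxOverZ; first by rewrite rpredV Fdet.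
apply/mxOverP => i j; rewrite mxE /cofactor rpredM ?rpredX ?rpredN1 //.
by apply: Fdet; apply/mxOverP => k l; rewrite !mxE; apply: (mxOverP FG).
Qed.

Lemma rat_funX g n : rat_fun g -> rat_fun (fun t => g t ^+ n).
Proof.
move=> Fg; elim: n => [|n IHn]; first exact: rat_funC (rpred1 F).
by apply: rat_fun_ext (rat_funM Fg IHn) => t; rewrite exprS.
Qed.

Lemma rat_fun_prod (I : Type) (r : seq I) (P : pred I) (h : I -> T -> KK) :
  (forall i, P i -> rat_fun (h i)) -> rat_fun (fun t => \prod_(i <- r | P i) h i t).
Proof.
move=> Fh; elim: r => [|i r IHr].
  by apply: rat_fun_ext (rat_funC (rpred1 F)) => t; rewrite big_nil.
case: (boolP (P i)) => Pi; last first.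
  by apply: rat_fun_ext IHr => t; rewrite big_cons (negPf Pi).
by apply: rat_fun_ext (rat_funM (Fh _ Pi) IHr) => t; rewrite big_cons Pi.
Qed.

Lemma rat_fun_horner (P : {poly KK}) g : P \is a polyOver F ->
  rat_fun g -> rat_fun (fun t => P.[g t]).
Proof.
move=> FP Fg.
suff gen n : rat_fun (fun t => \sum_(i < n) P`_i * g t ^+ i).
  by apply: rat_fun_ext (gen (size P)) => t; rewrite horner_coef.
elim: n => [|n IHn].
  by apply: rat_fun_ext (rat_funC (rpred0 F)) => t; rewrite big_ord0.
apply: rat_fun_ext (rat_funD IHn (rat_funM (rat_funC (polyOverP FP n)) (rat_funX n Fg))) => t.
by rewrite big_ord_recr.
Qed.

(** The values of [g] are the eigenvalues of [mx_of g], so their sum is a trace. This takes the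
    place of a Galois or symmetric function argument. *)
Lemma rat_fun_sum g : rat_fun g -> \sum_t g t \in F.
Proof.
move=> /asboolP /mxOverP Fg.
suff -> : \sum_t g t = \tr (mx_of g) by apply: rpred_sum => i _.
rewrite /mx_of mxtrace_mulC mulmxA mulVmx // mul1mx mxtrace_diag.
under [RHS]eq_bigr do rewrite mxE.
by rewrite -(@big_enum_val _ _ _ T predT g).
Qed.
End RationalFunctionsOfRoots.

(** * Integrality over Aint[Y, 1/Y] *)

(** Gives algebraic integers the general closure properties of [integralOver]. *)
Lemma Aint_integralOver (x : algC) :
  (x \in Aint) <-> integralOver (intr : int -> algC) x.
Proof.
split=> [|[p pm px]]; last first.
  apply: root_monic_Aint px _ _; first exact: monic_map.
  by apply/polyOverP => i; rewrite coef_map rpred_int.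
rewrite unfold_in => /floorpP[p pE]; exists p; last by rewrite -pE root_minCpoly.
have : minCpoly x \is monic by exact: minCpoly_monic.
rewrite pE !monicE lead_coef_map_inj ?rmorph0 //; last exact: intr_inj.
by rewrite -[1]/(1%:~R) eqr_int.
Qed.

Lemma root_monic_Aint_Aint (p : {poly algC}) x : p \is monic -> root p x ->
  p \is a polyOver Aint -> x \in Aint.
Proof.
move=> pm px /polyOverP pA; apply/Aint_integralOver.
apply: integral_root_monic pm px _.
by apply/integral_poly => i; apply/Aint_integralOver.
Qed.

Lemma Aint_expr_inv n (x : algC) : (0 < n)%N -> x ^+ n \in Aint -> x \in Aint.
Proof.
move=> n0 xA; apply: (@root_monic_Aint_Aint ('X^n - (x ^+ n)%:P)).
- exact: monicXnsubC.
- by rewrite /root hornerD hornerN hornerXn hornerC subrr.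
by rewrite rpredB ?rpredX ?polyOverX ?polyOverC.
Qed.

(* Averaging over the n-th roots of unity recovers n times each coefficient;
   using this for n and n + 1 removes the factor. *)
Lemma polyOver_Aint_unity_root (p : {poly algC}) :
  (forall n x, (0 < n)%N -> x ^+ n = 1 -> p.[x] \in Aint) -> p \is a polyOver Aint.
Proof.
move=> pA; apply/polyOverP => i.
have gen n : (size p + i < n)%N -> p`_i *+ n \in Aint.
  move=> ltn; have n0 : (0 < n)%N by apply: leq_ltn_trans ltn.
  have [w wP] := C_prim_root_exists n0.
  have w0 : w != 0 by rewrite (prim_root_eq0 wP) -lt0n.
  have -> : p`_i *+ n = \sum_(k < n) p.[w ^+ k] * w ^- (i * k).
    under eq_bigr => k _ do rewrite horner_coef mulr_suml.
    rewrite exchange_big /=.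
    transitivity (\sum_(j < size p) (if j == i :> nat then p`_i *+ n else 0)).
      case: (ltnP i (size p)) => [lti|lei].
        rewrite (bigD1 (Ordinal lti)) //= eqxx big1 ?addr0 // => j.
        by rewrite -val_eqE /= => /negPf ->.
      rewrite big1 => [|j _]; first by rewrite nth_default // mul0rn.
      by rewrite ifN // neq_ltn (leq_trans (ltn_ord j) lei).
    apply: eq_bigr => j _; case: eqP => [->|/eqP neq].
      rewrite (eq_bigr (fun=> p`_i)) ?sumr_const ?card_ord // => k _.
      by rewrite -exprM mulnC mulfK // expf_neq0.
    pose x := w ^+ j / w ^+ i.
    have xn : x ^+ n = 1.
      by rewrite expr_div_n -!exprM ![(_ * n)%N]mulnC !exprM (prim_expr_order wP) !expr1n divr1.
    have x1 : x - 1 != 0.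
      rewrite subr_eq0; apply: contra neq => /eqP/(canRL (divfK _)).
      rewrite mul1r expf_neq0 // => /(_ isT)/eqP.
      rewrite (eq_prim_root_expr wP) !modn_small //; apply: leq_ltn_trans ltn;
        rewrite ?leq_addl // (leq_trans (ltnW (ltn_ord j))) ?leq_addr //.
    symmetry; apply: (mulfI x1); rewrite mulr0.
    transitivity (p`_j * ((x - 1) * \sum_(k < n) x ^+ k)).
      rewrite mulrCA; congr (_ * _); rewrite mulr_sumr; apply: eq_bigr => k _.
      by rewrite /x expr_div_n -!exprM mulrA mulnC.
    by rewrite -subrX1 xn subrr mulr0.
  apply: rpred_sum => k _; apply: rpredM.
    apply: (pA n) => //.
    by rewrite -exprM mulnC exprM (prim_expr_order wP) expr1n.
  rewrite -exprVn; apply: rpredX; apply: (Aint_unity_root n0).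
  by rewrite unity_rootE exprVn (prim_expr_order wP) invr1.
have := rpredB (gen (size p + i).+2 (leqnSn _)) (gen (size p + i).+1 (leqnn _)).
by rewrite -mulrnBr ?leqnSn // subSnn.
Qed.

Section IntegralClosure.
Variables (KK : fieldType) (iota : {rmorphism algC -> KK}) (Y : KK).
Hypothesis Y_tr : forall P : {poly algC}, (map_poly iota P).[Y] = 0 -> P = 0.

Definition evY (P : {poly algC}) := (map_poly iota P).[Y].

Lemma evYB P Q : evY (P - Q) = evY P - evY Q.
Proof. by rewrite /evY rmorphB hornerD hornerN. Qed.
Lemma evYD P Q : evY (P + Q) = evY P + evY Q.
Proof. by rewrite /evY rmorphD hornerD. Qed.
Lemma evYM P Q : evY (P * Q) = evY P * evY Q.
Proof. by rewrite /evY rmorphM hornerM. Qed.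
Lemma evY_exp P n : evY (P ^+ n) = evY P ^+ n.
Proof. by rewrite /evY rmorphXn horner_exp. Qed.
Lemma evYX : evY 'X = Y. Proof. by rewrite /evY map_polyX hornerX. Qed.
Lemma evYC c : evY c%:P = iota c. Proof. by rewrite /evY map_polyC hornerC. Qed.
Lemma evY1 : evY 1 = 1. Proof. by rewrite /evY rmorph1 hornerC. Qed.
Lemma evY_sum (I : Type) (r : seq I) (Q : pred I) (G : I -> {poly algC}) :
  evY (\sum_(i <- r | Q i) G i) = \sum_(i <- r | Q i) evY (G i).
Proof. by rewrite /evY rmorph_sum horner_sum. Qed.
Lemma evY_eq0 P : (evY P == 0) = (P == 0).
Proof. by apply/eqP/eqP => [/Y_tr//|->]; rewrite /evY rmorph0 horner0. Qed.

Lemma Y_neq0 : Y != 0. Proof. by rewrite -evYX evY_eq0 polyX_eq0. Qed.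

Definition FY : {pred KK} := fun x => `[< exists P Q, Q != 0 /\ x = evY P / evY Q >].

Fact FY_divring : divring_closed FY.
Proof.
split=> [|x y|x y].
- by apply/asboolP; exists 1, 1; rewrite oner_neq0 divff // evY1 oner_neq0.
- move=> /asboolP[P [Q [Q0 ->]]] /asboolP[P' [Q' [Q0' ->]]]; apply/asboolP.
  exists (P * Q' - P' * Q), (Q * Q'); rewrite mulf_neq0 // evYB !evYM; split=> //.
  by field; rewrite !evY_eq0 Q0 Q0'.
- move=> /asboolP[P [Q [Q0 ->]]] /asboolP[P' [Q' [Q0' ->]]]; apply/asboolP.
  have [->|P0'] := eqVneq P' 0.
    by exists 0, 1; rewrite oner_neq0 /evY !rmorph0 horner0 !mul0r invr0 mulr0.
  exists (P * Q'), (Q * P'); rewrite mulf_neq0 // !evYM; split=> //.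
  by field; rewrite !evY_eq0 ?Q0 ?P0' ?Q0'.
Qed.
HB.instance Definition _ := GRing.isDivringClosed.Build KK FY FY_divring.

Definition SY : {pred KK} := fun x =>
  `[< exists P k, P \is a polyOver Aint /\ x = evY P / Y ^+ k >].

Fact SY_subring : subring_closed SY.
Proof.
split=> [|x y|x y].
- by apply/asboolP; exists 1, 0; rewrite rpred1 expr0 divr1 evY1.
- move=> /asboolP[P [k [PA ->]]] /asboolP[P' [k' [PA' ->]]]; apply/asboolP.
  exists (P * 'X^k' - P' * 'X^k), (k + k')%N; split.
    by rewrite rpredB // rpredM // rpredX // polyOverX.
  by rewrite evYB !evYM !evY_exp evYX exprD; field; rewrite !expf_neq0 ?Y_neq0.
- move=> /asboolP[P [k [PA ->]]] /asboolP[P' [k' [PA' ->]]]; apply/asboolP.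
  exists (P * P'), (k + k')%N; split; first exact: rpredM.
  by rewrite evYM exprD; field; rewrite !expf_neq0 ?Y_neq0.
Qed.
HB.instance Definition _ := GRing.isSubringClosed.Build KK SY SY_subring.

(** [integralOver] is relative to a ring morphism, so the subring Aint[Y, 1/Y] is packaged as a ring
    with its embedding. *)
Record SYring := SYRing { SYval : KK; _ : SYval \in SY }.
HB.instance Definition _ := [isSub for SYval].
HB.instance Definition _ := [Choice of SYring by <:].
HB.instance Definition _ := [SubChoice_isSubComNzRing of SYring by <:].
Definition FYfield : divringClosed KK := FY.
Definition SYsub : subringClosed KK := SY.
Definition SYcomring : comNzRingType := SYring.
Definition SYembed : {rmorphism SYcomring -> KK} := \val.

Lemma SYembed_in s : SYembed s \in SY. Proof. exact: valP. Qed.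
Lemma SYembedP x : x \in SY -> exists s, SYembed s = x.
Proof. by move=> xS; exists (SYRing xS). Qed.

Lemma dvdp_expX_unit (b : {poly algC}) m : b %| 'X^m ->
  exists2 c : algC, c != 0 & exists k, b = c *: 'X^k.
Proof.
rewrite -['X]subr0 -polyC0 => /dvdp_exp_XsubCP[k _]; rewrite polyC0 subr0 => /eqpP[[u v] /= /andP[u0 v0] uv].
exists (v / u); first by rewrite mulf_neq0 ?invr_eq0.
by exists k; rewrite mulrC -scalerA -uv scalerA mulVf // scale1r.
Qed.

(** Write x = a(Y)/b(Y) in lowest terms. Clearing denominators in the integral equation shows that b
    divides a power of Y. Integrality of the coefficients of the numerator is then tested at roots
    of unity, where Y specialises to a unit of Aint and the equation stays monic over Aint. *)
Theorem SY_integrally_closed (S : comNzRingType) (f : {rmorphism S -> KK}) x :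
  (forall s, f s \in SY) -> x \in FY -> integralOver f x -> x \in SY.
Proof.
move=> fS /asboolP[a0 [b0 [b00 xE]]] [p pm px].
pose g := gcdp a0 b0; pose a := a0 %/ g; pose b := b0 %/ g.
have cab : coprimep a b by apply: coprimep_div_gcd; rewrite b00 orbT.
have g0 : g != 0 by rewrite gcdp_eq0 negb_and b00 orbT.
have aE : a0 = a * g by rewrite divpK // dvdp_gcdl.
have bE : b0 = b * g by rewrite divpK // dvdp_gcdr.
have b_neq0 : b != 0 by apply: contraNneq b00 => b0'; rewrite bE b0' mul0r.
have {}xE : x = evY a / evY b.
  by rewrite xE aE bE !evYM; field; rewrite !evY_eq0 ?g0 ?b_neq0.
pose n := (size p).-1.
have [m [c [cA cE]]] : exists m (c : nat -> {poly algC}),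
    (forall i, c i \is a polyOver Aint) /\
    (forall i, (i < n)%N -> f p`_i = evY (c i) / Y ^+ m).
  have /choice[ck ckP] i : exists ck : {poly algC} * nat,
      ck.1 \is a polyOver Aint /\ f p`_i = evY ck.1 / Y ^+ ck.2.
    by have /asboolP[P [k Pk]] := fS p`_i; exists (P, k).
  pose m := (\sum_(i < n) (ck i).2)%N; exists m.
  exists (fun i => (ck i).1 * 'X^(m - (ck i).2)); split=> i.
    by rewrite rpredM ?rpredX ?polyOverX //; case: (ckP i).
  move=> ltin; have [_ ->] := ckP i.
  have lem : ((ck i).2 <= m)%N by rewrite /m (bigD1 (Ordinal ltin)) //= leq_addr.
  rewrite evYM evY_exp evYX -{2}(subnK lem) exprD; field.
  by rewrite !expf_neq0 ?Y_neq0.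
have pn : (map_poly f p)`_n = 1.
  by rewrite coef_map -[p`_n]/(lead_coef p) (monicP pm); apply: rmorph1.
have pE : x ^+ n + \sum_(i < n) f p`_i * x ^+ i = 0.
  move: px; rewrite rootE horner_coef size_map_poly_id0; last first.
    by rewrite (monicP pm) rmorph1 oner_neq0.
  rewrite polySpred ?monic_neq0 // -/n big_ord_recr /= pn mul1r addrC => /eqP E; rewrite -[RHS]E.
  by congr (_ + _); apply: eq_bigr => i _; rewrite coef_map.
have E : 'X^m * a ^+ n + \sum_(i < n) c i * a ^+ i * b ^+ (n - i) = 0.
  apply: Y_tr; rewrite -/(evY _) evYD evYM !evY_exp evYX evY_sum.
  transitivity (Y ^+ m * evY b ^+ n * (x ^+ n + \sum_(i < n) f p`_i * x ^+ i)); last by rewrite pE mulr0.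
  have Yb i : (i <= n)%N -> x ^+ i * evY b ^+ n = evY a ^+ i * evY b ^+ (n - i).
    move=> lein; rewrite -{1}(subnKC lein) exprD mulrA -exprMn xE divfK //.
    by rewrite evY_eq0.
  rewrite mulrDr mulr_sumr -mulrA [evY b ^+ n * _]mulrC Yb // subnn mulr1.
  congr (_ + _); apply: eq_bigr => i _; rewrite cE // !evYM !evY_exp.
  by rewrite -mulrA -(Yb _ (ltnW (ltn_ord i))); field; rewrite expf_neq0 ?Y_neq0.
have /dvdp_expX_unit[u u0 [k bk]] : b %| 'X^m.
  have cn : coprimep b (a ^+ n) by rewrite coprimep_expr // coprimep_sym.
  have H : 'X^m * a ^+ n = - \sum_(i < n) c i * a ^+ i * b ^+ (n - i).
    by apply/eqP; rewrite -addr_eq0 E.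
  rewrite -(Gauss_dvdpl _ cn) H.
  rewrite dvdpNr; apply: (big_ind (fun q => b %| q)) => [|? ? |i _]; first exact: dvdp0.
    exact: dvdp_add.
  by apply/dvdp_mull/dvdp_exp; rewrite // subn_gt0.
apply/asboolP; exists (u^-1 *: a), k; split; last first.
  by rewrite xE bk -!mul_polyC !evYM !evYC evY_exp evYX fmorphV; field; rewrite expf_neq0 ?Y_neq0 // fmorph_eq0.
(* It remains to see that a(y)/b(y) is an algebraic integer at each root of unity y: it is a root of
   the specialised equation [P] below. *)
apply: polyOver_Aint_unity_root => N y N0 yN.
have yA : y \in Aint by apply: (Aint_unity_root N0); rewrite unity_rootE yN.
have y0 : y != 0 by apply: contra_eq_neq yN => ->; rewrite expr0n gtn_eqF // eq_sym oner_neq0.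
have yVA : y^-1 \in Aint.
  by apply: (Aint_unity_root N0); rewrite unity_rootE exprVn yN invr1.
suff rA : a.[y] / b.[y] \in Aint.
  have -> : (u^-1 *: a).[y] = a.[y] / b.[y] * y ^+ k; last by rewrite rpredM ?rpredX.
  by rewrite bk !hornerZ hornerXn; field; rewrite expf_neq0.
pose P := 'X^n + \poly_(i < n) ((c i).[y] / y ^+ m).
apply: (@root_monic_Aint_Aint P).
- by rewrite monicE lead_coefDl ?lead_coefXn // size_polyXn ltnS size_poly.
- have := congr1 (fun q => q.[y]) E.
  rewrite hornerD hornerM hornerXn horner_exp horner_sum horner0 => Ey.
  have by0 : b.[y] != 0 by rewrite bk hornerZ hornerXn mulf_neq0 ?expf_neq0.
  rewrite /root hornerD hornerXn horner_poly.
  apply/eqP; apply: (mulfI (_ : y ^+ m * b.[y] ^+ n != 0)).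
    by rewrite mulf_neq0 ?expf_neq0.
  rewrite mulr0 -[RHS]Ey mulrDr; congr (_ + _).
    by rewrite expr_div_n; field; rewrite expf_neq0.
  rewrite mulr_sumr; apply: eq_bigr => i _; rewrite !hornerM !horner_exp.
  rewrite -[in b.[y] ^+ n](subnK (ltnW (ltn_ord i))) exprD expr_div_n; field.
  by rewrite !expf_neq0.
- rewrite rpredD ?rpredX ?polyOverX //; apply/polyOverP => i; rewrite coef_poly.
  case: ifP => _; rewrite ?Aint0 // -exprVn rpredM ?rpredX //.
  exact: rpred_horner.
Qed.
End IntegralClosure.

(** * Products over lines of torsion points *)

(* Gauss's half-system: multiplication by [c] permutes [{1, ..., (p-1)/2}] up to
   sign modulo [p]. *)
Lemma prod_half_system (R : comNzRingType) (p c : nat) (phi : nat -> R) :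
  prime p -> odd p -> coprime c p ->
  (forall n, phi (n + p)%N = phi n) ->
  (forall n, (n <= p)%N -> phi (p - n)%N = phi n) ->
  \prod_(s < p./2) phi (c * s.+1)%N = \prod_(s < p./2) phi s.+1.
Proof.
move=> pp podd cp per ev.
have pE : p = (p./2).*2.+1 by rewrite -[LHS]odd_double_half podd.
have phi_mod n : phi n = phi (n %% p)%N.
  rewrite {1}(divn_eq n p); elim: (n %/ p)%N => [|k IHk]; first by rewrite mul0n add0n.
  by rewrite mulSn -addnA addnC per.
have ndvd (s : 'I_(p./2)) : (0 < (c * s.+1) %% p)%N.
  rewrite lt0n; apply/negP => H.
  have : (p %| c * s.+1)%N by exact: H.
  rewrite Gauss_dvdr 1?coprime_sym // => /dvdn_leq; have := ltn_ord s; lia.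
(* The absolutely least residue of c(s+1). If two of them agree, then p divides c times the sum or
   the difference of the two arguments, which are both too small. *)
pose y (s : 'I_(p./2)) := let x := ((c * s.+1) %% p)%N in if (x <= p./2)%N then x else (p - x)%N.
have y0 s : (0 < y s <= p./2)%N.
  have := ndvd s; have : ((c * s.+1) %% p < p)%N by rewrite ltn_mod prime_gt0.
  by rewrite /y; move: ((c * s.+1) %% p)%N => x; case: (leqP x p./2); lia.
have yphi (s : 'I_p./2) : phi (c * s.+1)%N = phi (y s).
  rewrite phi_mod /y; case: ifP => // _; rewrite ev //; apply: ltnW.
  by rewrite ltn_mod prime_gt0.
have ylt s : ((y s).-1 < p./2)%N by have := y0 s; lia.
have r_inj : injective (fun s => Ordinal (ylt s)).
  move=> s t [] /(congr1 succn); rewrite !prednK; [|by have := y0 t; lia|by have := y0 s; lia].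
  move=> yst; apply/val_inj => /=; apply/eqP.
  have lts := ltn_ord s; have ltt := ltn_ord t.
  suff: (p %| s.+1 + t.+1)%N || (p %| (s.+1 - t.+1) + (t.+1 - s.+1))%N.
    by case/orP => /dvdn_leq; lia.
  have dv m : (p %| c * m)%N = (p %| m)%N by rewrite Gauss_dvdr // coprime_sym.
  have ltp n : (n %% p < p)%N by rewrite ltn_mod prime_gt0.
  rewrite -(dv (_ + t.+1)%N) -(dv (_ - _ + _)%N) mulnDr [(c * (_ - _ + _))%N]mulnDr !mulnBr.
  move: yst; rewrite /y /=; move: (c * s.+1)%N (c * t.+1)%N => A B.
  have hA := ltp A; have hB := ltp B; have := divn_eq A p; have := divn_eq B p.
  move: (A %/ p)%N (B %/ p)%N (A %% p)%N (B %% p)%N hA hB => qA qB rA rB hA hB -> ->.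
  case: ifP; case: ifP => h1 h2 E.
  - apply/orP; right; rewrite E; case: (leqP qA qB) => le.
      by apply/dvdnP; exists (qB - qA)%N; nia.
    by apply/dvdnP; exists (qA - qB)%N; nia.
  - by apply/orP; left; apply/dvdnP; exists (qA + qB).+1; nia.
  - by apply/orP; left; apply/dvdnP; exists (qA + qB).+1; nia.
  - have {}E : rA = rB by lia.
    apply/orP; right; rewrite E; case: (leqP qA qB) => le.
      by apply/dvdnP; exists (qB - qA)%N; nia.
    by apply/dvdnP; exists (qA - qB)%N; nia.
rewrite [RHS](reindex_inj r_inj) /=; apply: eq_bigr => s _.
by rewrite prednK ?yphi //; have := y0 s; lia.
Qed.

Lemma polyOver_factor (R : comNzRingType) (S : subringClosed R) (q : {poly R}) x :
  q \is a polyOver S -> x \in S ->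
  exists2 r, r \is a polyOver S & q = q.[x]%:P + r * ('X - x%:P).
Proof.
move=> qS xS; elim/poly_ind: q qS => [|q c IHq] qS.
  by exists 0; rewrite ?rpred0 // horner0 mul0r addr0.
have {}qS : q \is a polyOver S.
  apply/polyOverP => i; have := polyOverP qS i.+1.
  by rewrite coefD coefMX coefC /= addr0.
have [r rS qE] := IHq qS; exists (q + x *: r).
  by rewrite rpredD // polyOverZ.
rewrite hornerMXaddC polyCD polyCM {1}qE -mul_polyC.
set a := q.[x]%:P in qE *; rewrite [in RHS]qE; ring.
Qed.

(** * An abstract family of theta functions with its p-torsion points *)

Section ThetaFamily.
Variables (KK : fieldType) (iota : {rmorphism algC -> KK}) (Y : KK).
Hypothesis Y_tr : forall P : {poly algC}, (map_poly iota P).[Y] = 0 -> P = 0.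
Variables (V : zmodType) (E O e o : V -> KK) (K0 : V).
Hypothesis EE : forall x y, E (x + y) * E (x - y) = e x * e y + o x * o y.
Hypothesis OO : forall x y, O (x + y) * O (x - y) = e x * o y + o x * e y.
Hypothesis eK : forall x, e (x - K0) = e x.
Hypothesis oK : forall x, o (x - K0) = - o x.
Hypothesis E_neq0 : forall x, E x != 0.
Hypothesis WY : O 0 / E 0 = Y ^+ 2.

(** [E], [O] play the parts of theta_3, theta_2, and [e], [o] those of the same series at the
    doubled nome. The shift by [K0] makes [b], [a] play theta_4, theta_1, whose addition formulas
    are those required of division polynomials. *)
Let W x := O x / E x.
Let kap := Y ^+ 4.
Let a x := O (x - K0) / E (- K0).
Let b x := E (x - K0) / E (- K0).

Let Y0 : Y != 0. Proof. exact: Y_neq0 Y_tr. Qed.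

Let E2 x : E x ^+ 2 = e x * e 0 + o x * o 0.
Proof. by have := EE x 0; rewrite addr0 subr0 expr2. Qed.
Let O2 x : O x ^+ 2 = e x * o 0 + o x * e 0.
Proof. by have := OO x 0; rewrite addr0 subr0 expr2. Qed.
Let EK2 : E (- K0) ^+ 2 = e 0 ^+ 2 - o 0 ^+ 2.
Proof. by rewrite E2 -(sub0r K0) eK oK; ring. Qed.
Let den0 : e 0 ^+ 2 - o 0 ^+ 2 != 0.
Proof. by rewrite -EK2 expf_neq0. Qed.
Let E02 : E 0 ^+ 2 = e 0 ^+ 2 + o 0 ^+ 2. Proof. by rewrite E2 -!expr2. Qed.
Let O02 : O 0 ^+ 2 = 2 * e 0 * o 0. Proof. by rewrite O2; ring. Qed.
Let ES x : E (x - K0) ^+ 2 = e x * e 0 - o x * o 0.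
Proof. by rewrite E2 eK oK; ring. Qed.
Let OS x : O (x - K0) ^+ 2 = e x * o 0 - o x * e 0.
Proof. by rewrite O2 eK oK; ring. Qed.
Let EES x y : E (x + y - K0) * E (x - y - K0) = e x * e y - o x * o y.
Proof. by rewrite [x + y - _]addrAC [x - y - _]addrAC EE eK oK; ring. Qed.
Let OOS x y : O (x + y - K0) * O (x - y - K0) = e x * o y - o x * e y.
Proof. by rewrite [x + y - _]addrAC [x - y - _]addrAC OO eK oK; ring. Qed.
Let O0 : O 0 != 0.
Proof.
apply: contra_neq (expf_neq0 2 Y0) => O00.
by rewrite -WY O00 mul0r.
Qed.
Let kapE : kap = 2 * e 0 * o 0 / (e 0 ^+ 2 + o 0 ^+ 2).
Proof. by rewrite -O02 -E02 -expr_div_n WY -exprM. Qed.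
Let E0N : e 0 ^+ 2 + o 0 ^+ 2 != 0. Proof. by rewrite -E02 expf_neq0. Qed.
Let O0N : 2 * e 0 * o 0 != 0. Proof. by rewrite -O02 expf_neq0. Qed.
Let kap0 : kap != 0. Proof. exact: expf_neq0. Qed.

Let b_neq0 x : b x != 0.
Proof. by rewrite mulf_neq0 // invr_neq0. Qed.
Let a_add x y :
  a (x + y) * a (x - y) = a x ^+ 2 * b y ^+ 2 - b x ^+ 2 * a y ^+ 2.
Proof.
rewrite /a /b mulrACA OOS !expr_div_n !OS !ES -invfM -expr2 EK2; field; exact: den0.
Qed.
Let b_add x y :
  b (x + y) * b (x - y) = b x ^+ 2 * b y ^+ 2 - a x ^+ 2 * a y ^+ 2.
Proof.
rewrite /a /b mulrACA EES !expr_div_n !OS !ES -invfM -expr2 EK2; field; exact: den0.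
Qed.
Let b0 : b 0 = 1. Proof. by rewrite /b sub0r divff. Qed.
Let a_dbl x : a (x *+ 2) ^+ 2 =
  4%:R * a x ^+ 2 * b x ^+ 2 *
  (b x ^+ 4 - (kap + kap^-1) * a x ^+ 2 * b x ^+ 2 + a x ^+ 4).
Proof.
have expr4 (u : KK) : u ^+ 4 = (u ^+ 2) ^+ 2 by ring.
have Ed : E (x *+ 2) ^+ 2 = (e x ^+ 2 + o x ^+ 2) ^+ 2 / (e 0 ^+ 2 + o 0 ^+ 2).
  have := EE x x; rewrite subrr -mulr2n -!expr2 => <-.
  by rewrite -E02 exprMn mulfK ?expf_neq0.
have Od : O (x *+ 2) ^+ 2 = (2 * e x * o x) ^+ 2 / (2 * e 0 * o 0).
  have -> : 2 * e x * o x = O (x *+ 2) * O 0.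
    by have := OO x x; rewrite subrr -mulr2n => ->; ring.
  by rewrite -O02 exprMn mulfK ?expf_neq0.
(* The squares of E and O at 2x are linear in e(2x) and o(2x), with determinant e(0)^2 - o(0)^2; the
   system is solved for the latter. *)
have edE : (e 0 ^+ 2 - o 0 ^+ 2) * e (x *+ 2) =
  e 0 * E (x *+ 2) ^+ 2 - o 0 * O (x *+ 2) ^+ 2 by rewrite E2 O2; ring.
have odE : (e 0 ^+ 2 - o 0 ^+ 2) * o (x *+ 2) =
  e 0 * O (x *+ 2) ^+ 2 - o 0 * E (x *+ 2) ^+ 2 by rewrite E2 O2; ring.
have aE : a (x *+ 2) ^+ 2 = (e (x *+ 2) * o 0 - o (x *+ 2) * e 0) / (e 0 ^+ 2 - o 0 ^+ 2).
  by rewrite /a expr_div_n OS EK2.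
rewrite aE (canRL (mulKf den0) edE) (canRL (mulKf den0) odE).
rewrite Ed Od !expr4 /a /b !expr_div_n !OS !ES EK2 kapE; field.
move: O0N; rewrite !mulf_eq0 !negb_or => /andP[/andP[-> ->] ->].
by rewrite den0 E0N.
Qed.

Let z x := zz a b x.

Let ES_neq0 x : e x * e 0 - o x * o 0 != 0. Proof. by rewrite -ES expf_neq0. Qed.
Let zE x : z x = (e x * o 0 - o x * e 0) / (e x * e 0 - o x * o 0).
Proof.
by rewrite /z /zz /a /b !expr_div_n OS ES; field; rewrite ES_neq0 E_neq0.
Qed.
Let UE x : W x ^+ 2 = (e x * o 0 + o x * e 0) / (e x * e 0 + o x * o 0).
Proof. by rewrite expr_div_n O2 E2. Qed.
Let E2_neq0 x : e x * e 0 + o x * o 0 != 0. Proof. by rewrite -E2 expf_neq0. Qed.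

Let kz_neq0 x : 1 - kap * z x != 0.
Proof.
have -> : 1 - kap * z x = (e x * e 0 + o x * o 0) * (e 0 ^+ 2 - o 0 ^+ 2) /
    ((e x * e 0 - o x * o 0) * (e 0 ^+ 2 + o 0 ^+ 2)).
  by rewrite kapE zE; field; rewrite E0N ES_neq0.
by rewrite !mulf_neq0 ?invr_neq0 ?mulf_neq0.
Qed.

(** The identity cd^2 = (1 - sn^2) / (1 - k^2 sn^2). Only the square of W is obtained from z
    here. *)
Let U_of_z x : W x ^+ 2 = (kap - z x) / (1 - kap * z x).
Proof.
apply: (mulIf (kz_neq0 x)); rewrite divfK // kapE zE UE; field.
by rewrite E0N ES_neq0 E2_neq0.
Qed.

Let Wden_neq0 x : 1 - 2 * kap * W x ^+ 2 + W x ^+ 4 != 0.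
Proof.
have -> : 1 - 2 * kap * W x ^+ 2 + W x ^+ 4 =
    (e x ^+ 2 + o x ^+ 2) * (e 0 ^+ 2 - o 0 ^+ 2) ^+ 2 /
    ((e x * e 0 + o x * o 0) ^+ 2 * (e 0 ^+ 2 + o 0 ^+ 2)).
  have -> : W x ^+ 4 = (W x ^+ 2) ^+ 2 by ring.
  by rewrite kapE UE; field; rewrite E0N E2_neq0.
have eo : e x ^+ 2 + o x ^+ 2 != 0.
  by have := EE x x; rewrite subrr -!expr2 => <-; rewrite mulf_neq0.
by rewrite !mulf_neq0 ?invr_neq0 ?mulf_neq0 ?expf_neq0.
Qed.

(** The right-hand side involves only W(x)^2, hence is rational in z(x): W is within reach at even
    multiples, without a square root. *)
Let W_dbl x : W (x *+ 2) =
  (2 * W x ^+ 2 - kap * W x ^+ 4 - kap) / (1 - 2 * kap * W x ^+ 2 + W x ^+ 4) / Y ^+ 2.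
Proof.
have eo : e x ^+ 2 + o x ^+ 2 != 0.
  by have := EE x x; rewrite subrr -!expr2 => <-; rewrite mulf_neq0.
have W2 : W (x *+ 2) * Y ^+ 2 = 2 * e x * o x / (e x ^+ 2 + o x ^+ 2).
  rewrite -WY /W mulrACA -invfM; have := EE x x; have := OO x x.
  by rewrite subrr -mulr2n => -> ->; rewrite -!expr2; congr (_ / _); ring.
apply: (mulIf (expf_neq0 2 Y0)); rewrite W2 divfK ?expf_neq0 //.
apply: (mulIf (Wden_neq0 x)); rewrite [RHS]divfK //.
have -> : W x ^+ 4 = (W x ^+ 2) ^+ 2 by ring.
by rewrite kapE UE; field; rewrite E0N E2_neq0 eo.
Qed.

Let E_even x : E (- x) = E x.
Proof.
apply: (mulfI (E_neq0 x)).
by have := EE 0 x; rewrite add0r sub0r => ->; rewrite -expr2 E2; ring.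
Qed.
Let O_even x : O (- x) = O x.
Proof.
have H y : O y * O (- y) = O y ^+ 2.
  by have := OO 0 y; rewrite add0r sub0r => ->; rewrite O2; ring.
have [O0'|Ox0] := eqVneq (O x) 0; last by apply: (mulfI Ox0); rewrite H expr2.
have := H (- x); rewrite opprK O0' mulr0 => /esym/eqP.
by rewrite expf_eq0 /= => /eqP.
Qed.
Let W_even x : W (- x) = W x. Proof. by rewrite /W E_even O_even. Qed.

(** * Rationality of the power sums over the lines *)

Variables (p : nat) (L : finType) (g : L -> V) (sg : bool).
Hypothesis p_prime : prime p.
Hypothesis p_odd : odd p.
Hypothesis cardL : #|L| = p.+1.
Let h := p./2.
(** In the application these are representatives, up to sign, of the nonzero p-torsion points: p + 1
    lines with (p-1)/2 points each. *)
Let tt (t : L * 'I_h) := g t.1 *+ t.2.+1.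
Hypothesis O_tt : forall t, O (tt t) != 0.
Hypothesis O_ttK : forall t, O (tt t - K0) != 0.
Hypothesis O_ttD : forall t u, t != u -> O (tt t + tt u - K0) != 0.
Hypothesis O_ttB : forall t u, t != u -> O (tt t - tt u - K0) != 0.
Hypothesis O_ttp : forall t, O (tt t *+ p - K0) = 0.
Hypothesis W_Ktp : forall t,
  O ((K0 + tt t) *+ p - K0) / E ((K0 + tt t) *+ p - K0) = (-1) ^+ sg * Y ^+ 2.
Hypothesis W_Kp : O (K0 *+ p - K0) / E (K0 *+ p - K0) = (-1) ^+ sg * Y ^+ 2.
Hypothesis W_per : forall x l, O (x + g l *+ p) / E (x + g l *+ p) = O x / E x.
Variable vpi : algC.
Hypothesis vpiE : vpi ^+ (p ^ 2).-1 = 2.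

Variables (S : comNzRingType) (f : {rmorphism S -> KK}).
Hypothesis f_in : forall s, f s \in SY iota Y.
Hypothesis f_onto : forall x, x \in SY iota Y -> exists s, f s = x.
Let F : divringClosed KK := FYfield Y_tr.
Let int x := integralOver f x.

Let SY_sub_F x : x \in SY iota Y -> x \in F.
Proof.
move=> /asboolP[P [k [_ ->]]]; apply/asboolP; exists P, 'X^k.
by rewrite (monic_neq0 (monicXn _ _)) evY_exp evYX.
Qed.
Let F_iota c : iota c \in F.
Proof.
by apply/asboolP; exists c%:P, 1; rewrite oner_neq0 evY1 evYC divr1.
Qed.
Let SY_iota c : c \in Aint -> iota c \in SY iota Y.
Proof.
by move=> cA; apply/asboolP; exists c%:P, 0; rewrite polyOverC evYC expr0 divr1.
Qed.
Let SY_Y : Y \in SY iota Y.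
Proof.
by apply/asboolP; exists 'X, 0; rewrite polyOverX evYX expr0 divr1.
Qed.
Let SY_YV : Y^-1 \in SY iota Y.
Proof.
by apply/asboolP; exists 1, 1; rewrite rpred1 evY1 expr1 mul1r.
Qed.

Let alS : exists al : S, f al = kap + kap^-1.
Proof.
apply: f_onto; rewrite rpredD ?rpredX ?SY_Y // /kap -exprVn.
by rewrite rpredX ?SY_YV.
Qed.

Let mulp : exists al : S,
  [/\ f al = kap + kap^-1, forall m, (0 < m)%N -> exists U T, mulpoly f a b m U T &
    exists P C s, oddpoly f a b p P C s].
Proof.
have [al alE] := alS.
have a_dbl' x : a (x *+ 2) ^+ 2 = 4%:R * a x ^+ 2 * b x ^+ 2 *
    (b x ^+ 4 - f al * a x ^+ 2 * b x ^+ 2 + a x ^+ 4) by rewrite alE a_dbl.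
have ME := mulpoly_exists b_neq0 a_add b_add b0 a_dbl'.
exists al; split=> // [m m0|]; first by have [] := ME m m0.
by have [_] := ME p (prime_gt0 p_prime); apply.
Qed.

Let a_tt t : a (tt t) != 0. Proof. by rewrite mulf_neq0 ?invr_neq0. Qed.

Let zt t := z (tt t).
(** By [a_add], z(t) = z(u) would force a(t+u) a(t-u) = 0. *)
Let zt_inj : injective zt.
Proof.
move=> t u; apply: contra_eq => tu; rewrite /zt /z /zz.
have H : a (tt t + tt u) * a (tt t - tt u) != 0.
  by rewrite !mulf_neq0 ?invr_neq0 ?O_ttD ?O_ttB.
rewrite a_add subr_eq0 in H; apply: contra H.
by rewrite eqr_div ?expf_neq0 // [X in _ == X]mulrC.
Qed.

Let card_tt : #|{: L * 'I_h}| = (p ^ 2)./2.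
Proof.
rewrite card_prod cardL card_ord.
have : p = h.*2.+1 by rewrite /h -[LHS]odd_double_half p_odd.
by move: (h) (p) => h' p' ->; clear; lia.
Qed.

(** a(pt) = 0 makes z(t) a root of the odd division polynomial, which is monic and whose degree
    (p^2-1)/2 is exactly the number of points. *)
Let ztP : exists c : 'I_#|{: L * 'I_h}| -> KK, (forall k, c k \in F) /\
  forall t, zt t ^+ #|{: L * 'I_h}| = \sum_k c k * zt t ^+ k.
Proof.
have [al [_ _ [P [C [s PC]]]]] := mulp.
exists (fun k => - f P`_k); split=> [k|t].
  by rewrite rpredN; apply/SY_sub_F/f_in.
have Pz : ev f P (zt t) = 0.
  have ap : a (tt t *+ p) = 0 by rewrite /a O_ttp mul0r.
  have := op_a PC (a_tt t); rewrite ap => H.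
  have c0 : (-1) ^+ s * b (tt t) ^+ (p ^ 2).-1 * a (tt t) != 0.
    apply: mulf_neq0 (a_tt t); apply: mulf_neq0; first by rewrite signr_eq0.
    by rewrite expf_neq0.
  by apply: (mulfI c0); rewrite mulr0 -H.
move: Pz; rewrite /ev horner_coef size_map_poly_id0; last first.
  by rewrite (monicP (op_monic PC)) rmorph1 oner_neq0.
rewrite (op_size PC) -card_tt big_ord_recr /= => /eqP; rewrite addrC addr_eq0.
have -> : (map_poly f P)`_#|{: L * 'I_h}| = 1.
  have szP : (p ^ 2)./2 = (size P).-1 by rewrite (op_size PC).
  rewrite coef_map card_tt szP.
  by rewrite -[P`__]/(lead_coef P) (monicP (op_monic PC)); apply: rmorph1.
rewrite mul1r => /eqP ->; rewrite -sumrN; apply: eq_bigr => k _.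
by rewrite coef_map mulNr.
Qed.

Let rat (u : L * 'I_h -> KK) := rat_fun F zt u.

Let rat_z s : (0 < s)%N -> rat (fun t => z (tt t *+ s)).
Proof.
move=> s0; have [c [cF cE]] := ztP; have [al [_ /(_ s s0)[U [T UT]] _]] := mulp.
have over (P : {poly S}) : map_poly f P \is a polyOver F.
  by apply/polyOverP => i; rewrite coef_map; apply/SY_sub_F/f_in.
have Rz := rat_fun_id zt_inj cF cE.
have T0 t : ev f T (zt t) != 0.
  apply: contra_neq (expf_neq0 2 (b_neq0 (tt t *+ s))).
  by rewrite (mp_b UT (a_tt t)) => ->; rewrite mulr0.
have := rat_funM zt_inj (rat_fun_horner zt_inj (over U) Rz)
  (rat_funV zt_inj T0 (rat_fun_horner zt_inj (over T) Rz)).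
apply: rat_fun_ext => t; rewrite /z /zz (mp_a UT (a_tt t)) (mp_b UT (a_tt t)).
rewrite -/(z (tt t)) -/(zt t); have := T0 t; rewrite /ev => T0t.
by field; rewrite T0t expf_neq0.
Qed.

Let rat_U s : (0 < s)%N -> rat (fun t => W (tt t *+ s) ^+ 2).
Proof.
move=> s0; have kF : kap \in F by rewrite rpredX ?SY_sub_F.
have Rk := rat_funC zt_inj kF; have Rz := rat_z s0.
have R1 := rat_funC zt_inj (rpred1 F).
have Rden := rat_funD R1 (rat_funN zt_inj (rat_funM zt_inj Rk Rz)).
have Rnum := rat_funD Rk (rat_funN zt_inj Rz).
have := rat_funM zt_inj Rnum (rat_funV zt_inj (fun t => kz_neq0 (tt t *+ s)) Rden).
by apply: rat_fun_ext => t; rewrite U_of_z.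
Qed.

Let rat_W s : (0 < s)%N -> rat (fun t => W (tt t *+ (2 * s))).
Proof.
move=> s0; have YF : Y \in F by apply: SY_sub_F.
have kF : kap \in F by rewrite rpredX.
pose RC x (xF : x \in F) := rat_funC zt_inj xF.
have RU := rat_U s0; have RU2 := rat_funX zt_inj 2 RU.
pose RD := @rat_funD KK F _ zt; pose RM := @rat_funM KK F _ zt zt_inj; pose RN := @rat_funN KK F _ zt zt_inj.
have R2 := RC _ (rpred_nat F 2); have Rk := RC _ kF.
have Rnum := RD _ _ (RD _ _ (RM _ _ R2 RU) (RN _ (RM _ _ Rk RU2))) (RN _ Rk).
have Rden := RD _ _ (RD _ _ (RC _ (rpred1 F)) (RN _ (RM _ _ (RM _ _ R2 Rk) RU))) RU2.
have YVF : (Y ^+ 2)^-1 \in F by rewrite rpredV rpredX.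
have den0' t : 1 + - (2 * kap * W (tt t *+ s) ^+ 2) + W (tt t *+ s) ^+ 2 ^+ 2 != 0.
  by rewrite -exprM; apply: Wden_neq0.
have := RM _ _ (RM _ _ Rnum (rat_funV zt_inj den0' Rden)) (RC _ YVF).
by apply: rat_fun_ext => t; rewrite mulnC mulrnA W_dbl -exprM.
Qed.

Definition theta_line l := Y * \prod_(s < p./2) (O (g l *+ s.+1) / E (g l *+ s.+1)).

(** The half-system is multiplied by 2(s+1), where t is the (s+1)-st multiple of the generator. The
    product is thereby expressed through even multiples of the point t itself, so that [rat_W] makes
    it a rational function of z(t). *)
Let theta_lineE (t : L * 'I_h) :
  theta_line t.1 = Y * \prod_(s < h) W (tt t *+ (2 * s.+1)).
Proof.
congr (_ * _); rewrite -(@prod_half_system KK p (2 * t.2.+1) (fun n => W (g t.1 *+ n))) //.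
- apply: eq_bigr => s _; rewrite /tt -mulrnA; congr (W (_ *+ _)); by rewrite mulnCA mulnA.
- rewrite coprime_sym prime_coprime // Euclid_dvdM // negb_or; apply/andP; split.
    by rewrite gtnNdvd // odd_prime_gt2.
  rewrite gtnNdvd //; have := ltn_ord t.2; move: (nat_of_ord t.2) => m.
  have := p_odd; rewrite /h; clear; lia.
- by move=> n; rewrite /= /W mulrnDr W_per.
- move=> n lenp; rewrite /= mulrnBr // addrC.
  by rewrite /W W_per -/(W _) W_even.
Qed.

Let natK_neq0 n : (0 < n)%N -> n%:R != 0 :> KK.
Proof. by move=> n0; rewrite -(rmorph_nat iota) fmorph_eq0 pnatr_eq0 -lt0n. Qed.

Lemma theta_line_rational j : \sum_l theta_line l ^+ j \in F.
Proof.
have h0 : (0 < h)%N by have := odd_prime_gt2 p_odd p_prime; rewrite /h; clear; lia.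
suff H : h%:R * \sum_l theta_line l ^+ j \in F.
  by rewrite -[\sum_l _](mulKf (natK_neq0 h0)) rpredM // rpredV rpred_nat.
(* [rat_fun_sum] runs over points, so each line is counted h times. *)
have -> : h%:R * \sum_l theta_line l ^+ j =
    \sum_(t : L * 'I_h) theta_line t.1 ^+ j.
  rewrite -(pair_bigA _ (fun l (m : 'I_h) => theta_line l ^+ j)) /= mulr_sumr.
  by apply: eq_bigr => l _; rewrite sumr_const card_ord mulr_natl.
have [c [cF cE]] := ztP; apply: (rat_fun_sum zt_inj).
apply: rat_fun_ext (rat_funX zt_inj j (rat_funM zt_inj (rat_funC zt_inj (SY_sub_F SY_Y))
  (@rat_fun_prod _ _ _ _ zt_inj _ (index_enum 'I_h) xpredT (fun (s : 'I_h) t => W (tt t *+ (2 * s.+1))) _))).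
  by move=> t; rewrite theta_lineE.
by move=> s _; apply: rat_W.
Qed.

(** * Integrality, and congruence modulo a root of 2 *)

Let int_SY x : x \in SY iota Y -> int x.
Proof. by move=> /f_onto[s <-]; apply: integral_id. Qed.

Let int_root (P : {poly KK}) x : P \is monic -> root P x ->
  (forall i, int P`_i) -> int x.
Proof. by move=> Pm Px /integral_poly; apply: integral_root_monic. Qed.

Let int_exp x n : int x -> int (x ^+ n).
Proof.
by move=> xI; elim: n => [|n IHn]; rewrite ?exprS; [exact: integral1 | exact: integral_mul].
Qed.

Let int_horner (P : {poly KK}) x : P \is a polyOver (SY iota Y) -> int x -> int P.[x].
Proof.
move=> /polyOverP PS; apply: integral_horner; apply/integral_poly => i.
exact/int_SY/PS.
Qed.

Let SYs : subringClosed KK := SYsub Y_tr.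

Let d := (p ^ 2)./2.
Let d2 : (d + d = (p ^ 2).-1)%N.
Proof.
have : odd (p ^ 2) by rewrite oddX p_odd orbT.
by rewrite /d; move: (p ^ 2)%N => n; clear; lia.
Qed.

(* The values of [W] at torsion points are roots of a monic polynomial which is
   congruent modulo 2 to [(X - Y^2)(X + 1)^(p^2-1)]. *)
Let W_poly : exists2 B : {poly KK}, B \is a polyOver SYs /\ (size B <= d + d)%N &
  forall t, (1 + W (tt t) ^+ 2) ^+ d = 2 * B.[W (tt t)].
Proof.
have [al [_ _ [P [C [s PC]]]]] := mulp.
have [[P' PE] [C' CE]] := (op_P2 PC, op_C2 PC).
have fS (Q : {poly S}) : map_poly f Q \is a polyOver SYs.
  by apply/polyOverP => i; rewrite coef_map; apply: f_in.
pose q : {poly KK} := (1 + 'X) ^+ d.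
pose p2 := map_poly f P'; pose c2 := map_poly f C'.
have pE : map_poly f P = q + p2 *+ 2.
  by rewrite PE !(rmorphD, rmorphXn, rmorphMn, rmorph1) /= map_polyX.
have cE : map_poly f C = q + c2 *+ 2.
  by rewrite CE !(rmorphD, rmorphXn, rmorphMn, rmorph1) /= map_polyX.
have qm : q \is monic by rewrite monic_exp // addrC -[1]opprK -polyC1 -polyCN monicXsubC.
have qsz : size q = d.+1.
  by rewrite /q addrC -[1]opprK -polyC1 -polyCN size_exp_XsubC.
have two0 : 2 != 0 :> KK by exact: natK_neq0.
have sz2 (r : {poly KK}) : size (r *+ 2) = size r.
  by rewrite -scaler_nat size_scale.
(* [P] and (1 + X)^d are both monic of degree d, so their difference has lower degree. This keeps
   the degree of [B] below 2d, and the final equation for W monic. *)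
have p2sz : (size p2 <= d)%N.
  rewrite -sz2 -[p2 *+ 2](addKr q) -pE addrC.
  have szP : size (map_poly f P) = d.+1.
    by rewrite size_map_poly_id0 ?(op_size PC) // (monicP (op_monic PC)) rmorph1 oner_neq0.
  have lcP : lead_coef (map_poly f P) = 1.
    exact: monicP (monic_map f (op_monic PC)).
  have sz : (size (map_poly f P - q)%R <= d.+1)%N.
    by apply: leq_trans (size_polyD _ _) _; rewrite size_polyN szP qsz maxnn.
  rewrite leqNgt; apply/negP => lt.
  have szE : size (map_poly f P - q) = d.+1 by apply/eqP; rewrite eqn_leq sz.
  have : lead_coef (map_poly f P - q) = 0.
    have Pd : (map_poly f P)`_d = 1 by rewrite -lcP /lead_coef szP.
    have qd : q`_d = 1 by rewrite -(monicP qm) /lead_coef qsz.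
    by rewrite /lead_coef szE coefB Pd qd subrr.
  by move/eqP; rewrite lead_coef_eq0 => /eqP H; rewrite H size_poly0 in szE.
have c2sz : (size c2 <= d.+1)%N.
  rewrite -sz2 -[c2 *+ 2](addKr q) -cE addrC.
  apply: leq_trans (size_polyD _ _) _; rewrite size_polyN geq_max qsz leqnn andbT.
  exact: leq_trans (size_poly _ _) (op_small PC).
(* The sign attached to Y^2 is immaterial modulo 2: c - Y^2 = 2 eta, with eta equal to 0 or -Y^2. *)
pose X2 : {poly KK} := 'X^2.
pose c := (-1) ^+ (s (+) sg) * Y ^+ 2; pose eta := (c - Y ^+ 2) / 2.
have etaS : eta \in SYs.
  rewrite /eta /c; case: (_ (+) _); last by rewrite expr0 mul1r subrr mul0r rpred0.
  rewrite expr1 mulN1r (_ : (- Y ^+ 2 - Y ^+ 2) / 2 = - Y ^+ 2); last by field.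
  by rewrite rpredN rpredX ?SY_Y.
have cS : c \in SYs by rewrite rpredM ?rpredX ?rpredN1 ?SY_Y.
pose B0 := c *: (c2 \Po X2) - 'X * (p2 \Po X2) + eta *: (q \Po X2).
have eqn v : v * (map_poly f P).[v ^+ 2] = c * (map_poly f C).[v ^+ 2] ->
    (v - Y ^+ 2) * (1 + v ^+ 2) ^+ d = 2 * B0.[v].
  rewrite pE cE !hornerD => E1.
  have qv : q.[v ^+ 2] = (1 + v ^+ 2) ^+ d by rewrite /q horner_exp !hornerE.
  have X2v : X2.[v] = v ^+ 2 by rewrite hornerXn.
  rewrite qv in E1.
  rewrite !hornerN !hornerZ !hornerM hornerX !horner_comp X2v qv.
  have -> : v - Y ^+ 2 = v - c + 2 * eta by rewrite /eta; field.
  move: E1; set Q := (1 + v ^+ 2) ^+ d; set u := p2.[_]; set w := c2.[_].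
  move/eqP; rewrite -subr_eq0 => /eqP E1.
  transitivity (2 * (c * w - v * u + eta * Q) + (v * (Q + u *+ 2) - c * (Q + w *+ 2))); first ring.
  by rewrite E1 addr0.
(* Since a(y) = W(y - K0) b(y), one has z(u) = W(u - K0)^2, and the division polynomials give W(pu -
   K0) in terms of v = W(u - K0): v P(v^2) = c C(v^2). *)
have W_eq u : a u != 0 ->
    O (u *+ p - K0) / E (u *+ p - K0) = (-1) ^+ sg * Y ^+ 2 ->
    W (u - K0) * (map_poly f P).[W (u - K0) ^+ 2] = c * (map_poly f C).[W (u - K0) ^+ 2].
  move=> u0 uE.
  have abW y : a y = W (y - K0) * b y.
    by rewrite /a /b /W; field; rewrite !E_neq0.
  have zW : zz a b u = W (u - K0) ^+ 2.
    by rewrite /zz abW exprMn mulfK // expf_neq0.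
  have := op_a PC u0; have := op_b PC u0.
  rewrite (abW (u *+ p)) [W (u *+ p - K0)]uE zW (abW u) /ev => -> H.
  have bn : (-1) ^+ s * b u ^+ (p ^ 2) != 0.
    by rewrite mulf_neq0 ?signr_eq0 ?expf_neq0.
  apply: (mulfI bn); rewrite /c signr_addb.
  transitivity ((-1) ^+ s * b u ^+ (p ^ 2).-1 * (W (u - K0) * b u) * (map_poly f P).[W (u - K0) ^+ 2]).
    by rewrite -[in LHS](prednK (_ : 0 < p ^ 2)%N) ?expn_gt0 ?prime_gt0 // exprS; ring.
  rewrite -H; case: (s); case: (sg); rewrite ?expr0 ?expr1; ring.
(* The point u = K0 shows that Y^2 = W(0) is always a root; it is the trivial one, to be divided
   out. *)
have B0Y : B0.[Y ^+ 2] = 0.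
  have aK : a K0 != 0 by rewrite /a subrr mulf_neq0 ?invr_neq0.
  have := W_eq K0 aK W_Kp; rewrite subrr [W 0]WY => /eqn/esym/eqP.
  by rewrite subrr mul0r mulf_eq0 (negPf two0) => /eqP.
have qS : q \is a polyOver SYs.
  by rewrite rpredX // rpredD ?polyOverX // rpred1.
have X2S : X2 \is a polyOver SYs by rewrite rpredX ?polyOverX.
have B0S : B0 \is a polyOver SYs.
  rewrite rpredD ?rpredB ?polyOverZ ?polyOver_comp ?fS //.
  by rewrite rpredM ?polyOverX // polyOver_comp // fS.
have Y2S : Y ^+ 2 \in SYs by rewrite rpredX ?SY_Y.
have [r rS B0E] := polyOver_factor B0S Y2S.
have d0 : (0 < d)%N.
  have := d2; have : (1 < p ^ 2)%N by rewrite -(exp1n 2) ltn_exp2r ?prime_gt1.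
  by move: (p ^ 2)%N (d) => a' b'; clear; lia.
have szX (u : {poly KK}) : (size (u \Po X2) <= ((size u).-1 * 2).+1)%N.
  by apply: leq_trans (size_comp_poly_leq _ _) _; rewrite size_polyXn.
have B0sz : (size B0 <= (d + d).+1)%N.
  apply: leq_trans (size_polyD _ _) _; rewrite geq_max; apply/andP; split; last first.
    apply: leq_trans (size_scale_leq _ _) _; apply: leq_trans (szX _) _.
    by rewrite qsz muln2 addnn.
  apply: leq_trans (size_polyD _ _) _; rewrite geq_max size_polyN; apply/andP; split.
    apply: leq_trans (size_scale_leq _ _) _; apply: leq_trans (szX _) _.
    by rewrite ltnS muln2 -addnn leq_add //; case: (size c2) c2sz.
  apply: leq_trans (size_polyMleq _ _) _; rewrite size_polyX add2n /=.
  apply: leq_trans (szX _) _.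
  by case: (size p2) p2sz => [|k] /=; move: (d) d0 => m; clear; lia.
exists r; first split=> //.
  have [->|r0] := eqVneq r 0; first by rewrite size_poly0.
  move: B0sz; rewrite B0E B0Y polyC0 add0r size_Mmonic ?monicXsubC //.
  by rewrite size_XsubC addn2.
move=> t; have at0 : a (K0 + tt t) != 0.
  by rewrite /a addrAC subrr add0r mulf_neq0 ?invr_neq0.
have := W_eq _ at0 (W_Ktp t); rewrite [K0 + _ - K0]addrAC subrr add0r => /eqn.
rewrite B0E B0Y polyC0 add0r hornerM hornerXsubC.
rewrite mulrA [X in _ = X -> _]mulrC => H.
(* If W(t) = Y^2, then W(t)^2 = kap, and [U_of_z] gives z(t) (1 - kap^2) = 0, where neither factor
   vanishes. *)
apply: mulfI H; rewrite subr_eq0; apply/negP => /eqP WYt.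
have k2 : 1 - kap ^+ 2 != 0.
  have -> : 1 - kap ^+ 2 = (e 0 ^+ 2 - o 0 ^+ 2) ^+ 2 / (e 0 ^+ 2 + o 0 ^+ 2) ^+ 2.
    by rewrite kapE; field.
  by rewrite mulf_neq0 ?invr_neq0 ?expf_neq0.
have z0 : z (tt t) != 0 by rewrite mulf_neq0 ?invr_neq0 ?expf_neq0.
have := U_of_z (tt t); rewrite WYt -exprM -/kap => /(congr1 (fun x => x * (1 - kap * z (tt t)))).
rewrite divfK // => H; case/eqP: (mulf_neq0 z0 k2).
transitivity (kap * (1 - kap * z (tt t)) - (kap - z (tt t))); first ring.
by rewrite H subrr.
Qed.

Let W_int t : int (W (tt t)).
Proof.
have [B [BS Bsz] BE] := W_poly.
pose P := (1 + 'X^2) ^+ d - B *+ 2.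
have X2m : (1 + 'X^2 : {poly KK}) \is monic.
  by rewrite addrC -[1]opprK -polyC1 -polyCN monicXnsubC.
have X2sz : size ((1 + 'X^2 : {poly KK}) ^+ d) = (d + d).+1.
  rewrite -[LHS]prednK ?size_poly_gt0 ?monic_neq0 ?monic_exp // size_exp.
  have -> : size (1 + 'X^2 : {poly KK}) = 3.
    by rewrite addrC -[1]opprK -polyC1 -polyCN size_XnsubC.
  by rewrite /= mul2n addnn.
have Bsz2 : (size (- (B *+ 2)) < size ((1 + 'X^2 : {poly KK}) ^+ d))%N.
  rewrite size_polyN X2sz ltnS -scaler_nat.
  exact: leq_trans (size_scale_leq _ _) Bsz.
apply: (@int_root P).
- by rewrite monicE lead_coefDl // (monicP (monic_exp _ X2m)).
- by rewrite /root /P hornerD hornerN hornerMn horner_exp !hornerE BE mulr_natl subrr.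
move=> i; apply: int_SY; apply: (polyOverP (_ : P \is a polyOver SYs)).
rewrite rpredB ?rpredMn // rpredX // rpredD ?rpred1 // rpredX // polyOverX.
exact.
Qed.

Let vp := iota vpi.
Let vp2 : vp ^+ (d + d) = 2. Proof. by rewrite d2 -rmorphXn vpiE rmorph_nat. Qed.
Let vp0 : vp != 0.
Proof.
have two0 : 2 != 0 :> KK by exact: natK_neq0.
apply: contra_neq two0 => v0; rewrite -vp2 v0 expr0n.
have : (1 < p ^ 2)%N by rewrite -(exp1n 2) ltn_exp2r ?prime_gt1.
by have := d2; case: (d + d)%N => //=; case: (p ^ 2)%N => [|[]].
Qed.

(** As v^2 + 1 = (v - 1)^2 + 2v, [W_poly] makes (v - 1)^(2d) twice an integral element. Since 2 =
    vp^(2d), the 2d-th power of (v - 1)/vp is integral, hence so is (v - 1)/vp. *)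
Let W_eta t : int ((W (tt t) - 1) / vp).
Proof.
have [B [BS _] BE] := W_poly.
set v := W (tt t); have vI : int v := W_int t.
have piI : int (v - 1) by apply: integral_sub => //; apply: integral1.
have [y yI yE] : exists2 y, int y & ((v - 1) ^+ 2 + 2 * v) ^+ d = (v - 1) ^+ (2 * d) + 2 * y.
  elim: (d) => [|n [y yI yE]]; first by exists 0; [exact: integral0 | rewrite muln0 !expr0 mulr0 addr0].
  exists (v * ((v - 1) ^+ 2 + 2 * v) ^+ n + (v - 1) ^+ 2 * y).
    apply: integral_add; apply: integral_mul => //; apply: int_exp => //.
    apply: integral_add; first exact: int_exp.
    by apply: integral_mul => //; apply: integral_nat.
  rewrite exprS yE mulnS exprD; move: ((v - 1) ^+ (2 * n)) => A; ring.
have pE : (v - 1) ^+ (2 * d) = 2 * (B.[v] - y).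
  rewrite mulrBr -BE -/v; apply: (canRL (addrK _)); rewrite -yE.
  by congr (_ ^+ _); ring.
apply: (@int_root ('X^(d + d) - (B.[v] - y)%:P)).
- apply: monicXnsubC; have : (1 < p ^ 2)%N by rewrite -(exp1n 2) ltn_exp2r ?prime_gt1.
  by have := d2; case: (d + d)%N => //=; case: (p ^ 2)%N => [|[]].
- rewrite /root hornerD hornerN hornerC hornerXn expr_div_n vp2 addnn -mul2n pE.
  by rewrite mulrC mulKf ?subrr //; exact: natK_neq0.
move=> i; rewrite coefB coefXn coefC; apply: integral_sub; first exact: integral_nat.
case: eqP => _; last exact: integral0.
by apply: integral_sub => //; apply: int_horner.
Qed.

Hypothesis vpi_Aint : vpi \in Aint.

Let vp_int : int vp. Proof. exact/int_SY/SY_iota. Qed.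

Let congv x y := exists2 w, int w & x = y + vp * w.

Let congvM x x' y y' : int y -> int x' -> congv x y -> congv x' y' -> congv (x * x') (y * y').
Proof.
move=> yI xI [w wI ->] [w' wI' xE]; exists (y * w' + w * x').
  by apply: integral_add; apply: integral_mul.
by rewrite xE; ring.
Qed.

(** Every line product is congruent to Y modulo [vp], so the sum is congruent to (p + 1) Y^j, where
    p + 1 is even. The quotient by [vp] is thus integral, and it is rational in Y, so integral
    closedness applies. *)
Lemma theta_line_integral j :
  exists2 w, w \in SY iota Y & \sum_l theta_line l ^+ j = vp * w.
Proof.
have Yint : int Y by apply: int_SY.
have W1 l s : int (W (g l *+ (s : 'I_h).+1)) /\ congv (W (g l *+ s.+1)) 1.
  split; first exact: (W_int (l, s)).
  exists ((W (g l *+ s.+1) - 1) / vp); first exact: (W_eta (l, s)).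
  by rewrite mulrC divfK // addrC subrK.
have lineY l : int (theta_line l) /\ congv (theta_line l) Y.
  suff [I1 C1] : int (\prod_(s < h) W (g l *+ s.+1)) /\ congv (\prod_(s < h) W (g l *+ s.+1)) 1.
    split; first exact: integral_mul.
    rewrite -[X in congv _ X]mulr1; apply: congvM => //.
    by exists 0; rewrite ?mulr0 ?addr0 //; apply: integral0.
  apply: (big_ind (fun x => int x /\ congv x 1)) => [|x y [xI xC] [yI yC]|s _].
  - by split; [exact: integral1 | exists 0; rewrite ?mulr0 ?addr0 //; apply: integral0].
  - split; first exact: integral_mul.
    by rewrite -[X in congv _ X]mulr1; apply: congvM => //; apply: integral1.
  exact: W1.
have lineX l n : int (theta_line l ^+ n) /\ congv (theta_line l ^+ n) (Y ^+ n).
  have [lI lC] := lineY l; elim: n => [|n [IHI IHC]].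
    by rewrite !expr0; split; [exact: integral1 | exists 0; rewrite ?mulr0 ?addr0 //; apply: integral0].
  by rewrite !exprS; split; [exact: integral_mul | exact: congvM].
have [w wE] : {w : L -> KK & forall l, int (w l) /\ theta_line l ^+ j = Y ^+ j + vp * w l}.
  by apply: (@boolp.choice _ _ (fun l w => int w /\ theta_line l ^+ j = Y ^+ j + vp * w)) => l; have [_ [w wI wE]] := lineX l j; exists w.
exists (vp^-1 * \sum_l theta_line l ^+ j); last by rewrite mulrA divff ?mul1r.
apply: (@SY_integrally_closed _ iota Y Y_tr S f) => //.
  rewrite -[_ \in _]/(_ \in F) rpredM ?rpredV ?F_iota //.
  exact: theta_line_rational.
under eq_bigr => l _ do rewrite (wE l).2.
rewrite big_split /= sumr_const cardL -mulr_sumr mulrDr mulKf //.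
apply: integral_add; last first.
  by apply: (big_ind int) => [|? ?|l _]; [exact: integral0 | exact: integral_add | have [] := wE l].
have -> : Y ^+ j *+ p.+1 = vp ^+ (d + d) * ((p.+1./2)%:R * Y ^+ j).
  by rewrite vp2 mulrA -natrM mulr_natl; congr (_ *+ _); move: p_odd; clear; lia.
have : (0 < d + d)%N.
  have : (1 < p ^ 2)%N by rewrite -(exp1n 2) ltn_exp2r ?prime_gt1.
  by have := d2; case: (d + d)%N => //=; case: (p ^ 2)%N => [|[]].
case: (d + d)%N => // k _; rewrite exprS -mulrA mulKf //.
apply: integral_mul; first exact: int_exp.
by apply: integral_mul; [exact: integral_nat | exact: int_exp].
Qed.
End ThetaFamily.

(** * Theta series *)

Section ThetaSeries.
Variable K : fieldType.
Local Notation R := (fps K).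

Definition zbox (N : nat) : seq int := [seq i%:Z - N%:Z | i <- iota 0 (2 * N).+1].

Lemma zbox_uniq N : uniq (zbox N).
Proof. by rewrite map_inj_uniq ?iota_uniq // => i j /addIr []. Qed.

Lemma mem_zbox N x : (x \in zbox N) = (`|x| <= N)%N.
Proof.
apply/mapP/idP => [[i]|le]; first by rewrite mem_iota => /andP[_ lt] ->; lia.
exists (absz (x + N%:Z)); first by rewrite mem_iota; lia.
by lia.
Qed.

Lemma sum_uniq_eq (I : eqType) (s1 s2 : seq I) (P : pred I) (F : I -> K) :
  uniq s1 -> uniq s2 -> (forall x, P x -> (x \in s1) = (x \in s2)) ->
  \sum_(x <- s1 | P x) F x = \sum_(x <- s2 | P x) F x.
Proof.
move=> u1 u2 s12; rewrite -big_filter -[RHS]big_filter; apply: perm_big.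
apply: uniq_perm; rewrite ?filter_uniq // => x; rewrite !mem_filter.
by case: (boolP (P x)) => //= /s12.
Qed.

(** The series of f(x) q^(c x^2) over all integers x: for c > 0, the box used at exponent N contains
    every solution of c x^2 = N. *)
Definition theta (c : nat) (f : int -> K) : R :=
  Fps (fun N => \sum_(x <- zbox N | (c * `|x| ^ 2 == N)%N) f x).

Definition zbox2 N := [seq (x, y) | x <- zbox N, y <- zbox N].

Definition theta2 (c : nat) (f : int -> int -> K) : R :=
  Fps (fun N => \sum_(u <- zbox2 N | (c * (`|u.1| ^ 2 + `|u.2| ^ 2) == N)%N) f u.1 u.2).


Lemma zbox2_uniq N : uniq (zbox2 N).
Proof. by apply: allpairs_uniq; rewrite ?zbox_uniq // => -[? ?] [? ?]. Qed.

Lemma mem_zbox2 N u : (u \in zbox2 N) = (`|u.1| <= N)%N && (`|u.2| <= N)%N.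
Proof.
case: u => x y; apply/allpairsP/andP => /= [[[x' y'] /= [xN yN [-> ->]]]|[xN yN]].
  by rewrite -!mem_zbox.
by exists (x, y); rewrite !mem_zbox.
Qed.

Lemma theta_coef c f N M : (0 < c)%N -> (N <= M)%N ->
  fcoef (theta c f) N = \sum_(x <- zbox M | (c * `|x| ^ 2 == N)%N) f x.
Proof.
move=> c0 leNM; apply: sum_uniq_eq; rewrite ?zbox_uniq // => x /eqP xN.
have le : (`|x| <= N)%N.
  rewrite -xN; apply: leq_trans (leq_pmull _ c0).
  by case: (`|x|)%N => // n; rewrite -mulnn leq_pmulr.
by rewrite !mem_zbox le (leq_trans le).
Qed.

Lemma thetaM c f g : (0 < c)%N ->
  theta c f * theta c g = theta2 c (fun x y => f x * g y).
Proof.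
move=> c0; apply: fpsP => N; rewrite fcoefM [RHS]/= [RHS]big_mkcond big_allpairs_dep [RHS]/=.
transitivity (\sum_(i < N.+1) \sum_(x <- zbox N) \sum_(y <- zbox N)
    if (c * `|x| ^ 2 == i)%N && (c * `|y| ^ 2 == N - i)%N then f x * g y else 0).
  apply: eq_bigr => i _; rewrite (@theta_coef c f i N) // -1?ltnS //.
  rewrite (@theta_coef c g (N - i) N) ?leq_subr // big_distrlr /=.
  rewrite big_mkcond; apply: eq_bigr => x _.
  case: ifP => _; last by rewrite big1.
  by rewrite big_mkcond.
rewrite exchange_big; apply: eq_bigr => x _; rewrite exchange_big.
apply: eq_bigr => y _ /=.
case: eqP => [H|H]; last first.
  rewrite big1 // => i _; case: ifP => // /andP[/eqP h1 /eqP h2]; case: H.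
  by rewrite mulnDr h1 h2 subnKC // -ltnS.
have lt : (c * `|x| ^ 2 < N.+1)%N by rewrite ltnS -H leq_mul2l leq_addr orbT.
rewrite (bigD1 (Ordinal lt)) //= eqxx /= -{1}H mulnDr addKn eqxx big1 ?addr0 // => i.
by rewrite -val_eqE /= eq_sym => /negPf ->.
Qed.

Definition oddz (x : int) := odd `|x|%N.

(** The map (x, y) -> (x + y, x - y) is a bijection onto pairs of equal parity, and it doubles the
    sum of squares. This is the source of all the addition formulas. *)
Lemma theta2_rot f : (forall x y, oddz x != oddz y -> f x y = 0) ->
  theta2 2 f = theta2 4 (fun x y => f (x + y) (x - y)).
Proof.
move=> f0; apply: fpsP => N /=.
rewrite (bigID (fun u => oddz u.1 == oddz u.2)) /= [X in _ + X]big1 ?addr0; last first.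
  by move=> u /andP[_ /f0].
pose rot (u : int * int) := (u.1 + u.2, u.1 - u.2).
rewrite -[RHS]big_filter -(big_map rot xpredT (fun u => f u.1 u.2)) -big_filter.
apply: perm_big; apply: uniq_perm; first by rewrite filter_uniq ?zbox2_uniq.
  rewrite map_inj_uniq ?filter_uniq ?zbox2_uniq // => -[x y] [x' y'] [].
  by move=> h1 h2; congr pair; lia.
have abs2 (x : int) : ((`|x| ^ 2)%N%:Z = x ^+ 2) by rewrite -abszX; lia.
have le2 (x : int) : (`|x| <= `|x| ^ 2)%N.
  by case: (`|x|)%N => // n; rewrite -mulnn leq_pmulr.
move=> [x y]; rewrite mem_filter mem_zbox2 [X in X && _]/= [X in _ && X]/=.
apply/idP/mapP.
  move=> /andP[/andP[/eqP xyN odd_xy] _].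
  pose u := ((x + y) %/ 2)%Z; pose v := ((x - y) %/ 2)%Z.
  have xE : x = u + v by move: odd_xy; rewrite /oddz /u /v; lia.
  have yE : y = u - v by move: odd_xy; rewrite /oddz /u /v; lia.
  exists (u, v); last by rewrite /rot /= -xE -yE.
  have uvN : (4 * (`|u| ^ 2 + `|v| ^ 2) = N)%N.
    have : ((2 * (`|x| ^ 2 + `|y| ^ 2))%N%:Z = N%:Z) by rewrite xyN.
    rewrite PoszM PoszD !abs2 xE yE => H; apply/eqP; rewrite -eqz_nat PoszM PoszD !abs2 -H.
    by apply/eqP; ring.
  by rewrite mem_filter mem_zbox2 /= uvN eqxx /=; have := le2 u; have := le2 v; lia.
case=> -[u v]; rewrite mem_filter mem_zbox2 /= => /andP[/eqP uvN _] [-> ->].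
have xyN : (2 * (absz (u + v)%R ^ 2 + absz (u - v)%R ^ 2) = N)%N.
  apply/eqP; rewrite -eqz_nat PoszM PoszD !abs2 -uvN PoszM PoszD !abs2.
  by apply/eqP; ring.
rewrite xyN eqxx /=; have := le2 (u + v); have := le2 (u - v); rewrite /oddz; lia.
Qed.

Lemma theta2D c f g : theta2 c (fun x y => f x y + g x y) = theta2 c f + theta2 c g.
Proof. by apply: fpsP => N /=; rewrite big_split. Qed.

Lemma eq_theta2 c f g : (forall x y, f x y = g x y) -> theta2 c f = theta2 c g.
Proof. by move=> fg; apply: fpsP => N /=; apply: eq_bigr. Qed.

Lemma eq_theta c f g : f =1 g -> theta c f = theta c g.
Proof. by move=> fg; apply: fpsP => N /=; apply: eq_bigr. Qed.

Lemma thetaZ c a f : theta c (fun x => a * f x) = fpsC a * theta c f.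
Proof.
apply: fpsP => N; rewrite -monoC fcoef_monoM /= subn0 mulr_sumr.
by apply: eq_bigr.
Qed.

Lemma fcoef_theta c f (x : int) : (0 < c)%N -> x != 0 ->
  fcoef (theta c f) (c * `|x| ^ 2) = f x + f (- x).
Proof.
move=> c0 x0; rewrite (@theta_coef _ _ _ (c * `|x| ^ 2)) //.
rewrite (@sum_uniq_eq _ _ [:: x; - x]) ?zbox_uniq //=.
- by rewrite !big_cons big_nil abszN eqxx addr0.
- by rewrite inE andbT; lia.
move=> y; rewrite eqn_pmul2l // eqn_exp2r // => /eqP xy.
rewrite mem_zbox !inE xy; apply/idP/idP => _; first by move: xy; lia.
apply: leq_trans (leq_pmull _ c0).
by case: (`|x|)%N => // n; rewrite -mulnn leq_pmulr.
Qed.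

Lemma fcoef_theta0 c f : (0 < c)%N -> fcoef (theta c f) 0 = f 0.
Proof.
move=> c0; rewrite (@theta_coef _ _ _ 0) // (_ : zbox 0 = [:: 0]) //.
by rewrite big_cons big_nil /= muln0 eqxx addr0.
Qed.
End ThetaSeries.
#[global] Arguments zbox N : simpl never.
#[global] Arguments theta K c f : simpl never.
#[global] Opaque zbox.

(** * Theta series at torsion points *)

Section TorsionPoints.
Variables (p : nat) (w : algC).
Hypothesis p_prime : prime p.
Hypothesis p_odd : odd p.
Hypothesis w_prim : (4 * p).-primitive_root w.
Local Notation R := (fps algC).
Local Notation V := (int * int)%type.

Let w0 : w != 0.
Proof. by rewrite (prim_root_eq0 w_prim); have := prime_gt0 p_prime; lia. Qed.
Let p0 : (p%:Z != 0). Proof. by have := prime_gt0 p_prime; lia. Qed.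

Let w2p : w ^+ (2 * p) = -1.
Proof.
have : (w ^+ (2 * p)) ^+ 2 == 1 ^+ 2.
  rewrite expr1n -exprM (_ : 2 * p * 2 = 4 * p)%N; last by lia.
  by rewrite (prim_expr_order w_prim).
rewrite eqf_sqr => /orP[|/eqP //].
rewrite -(prim_order_dvd w_prim) => /dvdn_leq H; exfalso.
by move: H; have := prime_gt0 p_prime; lia.
Qed.

Lemma exprz_w2p (n : int) : w ^ ((2 * p)%N%:Z * n) = if oddz n then -1 else 1.
Proof.
rewrite -exprz_exp -exprnP w2p.
case: n => n; rewrite /oddz ?NegzE ?abszN /=.
  by rewrite -exprnP -signr_odd; case: (odd n).
rewrite -invr_expz -exprnP -signr_odd /=.
by case: (odd n); rewrite /= ?expr0 ?expr1 ?invrN1 ?invr1.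
Qed.

(* The phases extend periodically, with period [(4p, p)] up to constants, in the
   two characteristics [P.1] and [P.2]: these are the p-torsion points. *)
Definition phase (P : V) (x : int) : algC :=
  if (p %| x - 2 * P.2)%Z then w ^ (P.1 * ((x - 2 * P.2) %/ p)%Z) else 0.

Lemma phaseE k b n : phase (k, b) (p%:Z * n + 2 * b) = w ^ (k * n).
Proof.
rewrite /phase /= addrK dvdz_mulr ?dvdzz //; congr (w ^ (_ * _)).
by rewrite mulrC mulzK.
Qed.

Lemma phase0 k b x : ~~ (p %| x - 2 * b)%Z -> phase (k, b) x = 0.
Proof. by rewrite /phase => /negPf /= ->. Qed.

Variant phase_spec k b x : algC -> Type :=
  | PhaseIn n of x = p%:Z * n + 2 * b : phase_spec k b x (w ^ (k * n))
  | PhaseOut of ~~ (p %| x - 2 * b)%Z : phase_spec k b x 0.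

Lemma phaseP k b x : phase_spec k b x (phase (k, b) x).
Proof.
case: (boolP (p %| x - 2 * b)%Z) => [|px]; last by rewrite phase0 //; constructor.
move=> px; have -> : x = p%:Z * ((x - 2 * b) %/ p)%Z + 2 * b.
  by rewrite mulrC divzK // subrK.
by rewrite phaseE; constructor.
Qed.

Let dvdz2 (x : int) : (p %| 2 * x)%Z = (p %| x)%Z.
Proof.
by rewrite Gauss_dvdzr // coprimezE /= coprime_sym coprime2n.
Qed.

Let dvdz_pD n y : (p %| p%:Z * n + y)%Z = (p %| y)%Z.
Proof. have pn : (p %| p%:Z * n)%Z by rewrite dvdz_mulr ?dvdzz.
by rewrite (rpredDl y pn). Qed.

Lemma phaseM k b k' b' x y :
  phase (k + k', b + b') (x + y) * phase (k - k', b - b') (x - y) =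
  phase (2 * k, b) x * phase (2 * k', b') y.
Proof.
case: (phaseP (2 * k) b x) => [n ->|px].
  case: (phaseP (2 * k') b' y) => [n' ->|py].
    rewrite (_ : p%:Z * n + 2 * b + (p%:Z * n' + 2 * b') = p%:Z * (n + n') + 2 * (b + b')); last by ring.
    rewrite (_ : p%:Z * n + 2 * b - (p%:Z * n' + 2 * b') = p%:Z * (n - n') + 2 * (b - b')); last by ring.
    by rewrite !phaseE -!expfzDr //; congr (w ^ _); ring.
  rewrite mulr0 (@phase0 (k + k')) ?mul0r //.
  rewrite (_ : _ - _ = p%:Z * n + (y - 2 * b')); last by ring.
  by rewrite dvdz_pD.
rewrite mul0r; case: (phaseP (k + k') (b + b')) => [n E|_]; last by rewrite mul0r.
rewrite phase0 ?mulr0 // (_ : x - y - 2 * (b - b') = p%:Z * (- n) + 2 * (x - 2 * b)) ?dvdz_pD ?dvdz2 //.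
have -> : p%:Z * - n = - (x + y - 2 * (b + b')) by rewrite E; ring.
by ring.
Qed.

Definition parity (s : bool) (f : int -> algC) x := if oddz x == s then f x else 0.
Definition tE P : R := theta 2 (parity false (phase P)).
Definition tO P : R := theta 2 (parity true (phase P)).
(** The exponent 4 comes from [theta2_rot] and the doubled first coordinate from [phaseM]. *)
Definition te (P : V) : R := theta 4 (parity false (phase (2 * P.1, P.2))).
Definition to (P : V) : R := theta 4 (parity true (phase (2 * P.1, P.2))).

Let oddzD x y : oddz (x + y) = oddz x (+) oddz y.
Proof. rewrite /oddz; lia. Qed.
Let oddzB x y : oddz (x - y) = oddz x (+) oddz y.
Proof. rewrite /oddz; lia. Qed.

(** After the rotation, x + y and x - y are both even exactly when x and y have equal parity: both
    even gives the [te] term, both odd the [to] term. *)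
Lemma tEE P Q : tE (P + Q) * tE (P - Q) = te P * te Q + to P * to Q.
Proof.
case: P Q => [k b] [k' b']; rewrite !thetaM // theta2_rot; last first.
  move=> x y; rewrite /parity.
  by case: (oddz x); case: (oddz y) => //=; rewrite ?mul0r ?mulr0.
rewrite -theta2D; apply: eq_theta2 => x y; rewrite /parity oddzD oddzB.
by case: (oddz x); case: (oddz y) => /=; rewrite ?mul0r ?mulr0 ?add0r ?addr0 // phaseM.
Qed.

Lemma tOO P Q : tO (P + Q) * tO (P - Q) = te P * to Q + to P * te Q.
Proof.
case: P Q => [k b] [k' b']; rewrite !thetaM // theta2_rot; last first.
  move=> x y; rewrite /parity.
  by case: (oddz x); case: (oddz y) => //=; rewrite ?mul0r ?mulr0.
rewrite -theta2D; apply: eq_theta2 => x y; rewrite /parity oddzD oddzB.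
by case: (oddz x); case: (oddz y) => /=; rewrite ?mul0r ?mulr0 ?add0r ?addr0 // phaseM.
Qed.

(** A point of order 4: w^p is a primitive fourth root of unity. In [te] and [to], where first
    coordinates are doubled, the shift amounts to the sign (-1)^n. *)
Definition K0 : V := (p%:Z, 0).

Let odd_pn n b : oddz (p%:Z * n + 2 * b) = oddz n.
Proof.
rewrite oddzD {2}/oddz abszM oddM /= addbF /oddz abszM oddM /=.
by rewrite p_odd.
Qed.

Lemma te_K0 P : te (P - K0) = te P.
Proof.
case: P => k b; apply: eq_theta => x; rewrite /parity; case: eqP => // ox.
rewrite /= subr0; case: (phaseP (2 * k) b) => [n xE|px]; last by rewrite phase0.
rewrite xE phaseE (_ : 2 * (k - p%:Z) * n = 2 * k * n + (2 * p)%N%:Z * - n).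
  by rewrite expfzDr // exprz_w2p /oddz abszN -/(oddz n) -(odd_pn n b) -xE ox mulr1.
by rewrite PoszM; ring.
Qed.

Lemma to_K0 P : to (P - K0) = - to P.
Proof.
have -> : - to P = fpsC (-1) * to P by rewrite rmorphN1 mulN1r.
case: P => k b; rewrite -thetaZ; apply: eq_theta => x; rewrite /parity.
case: eqP => [ox|]; last by rewrite mulr0.
rewrite /= subr0; case: (phaseP (2 * k) b) => [n xE|px]; last by rewrite phase0 ?mulr0.
rewrite xE phaseE (_ : 2 * (k - p%:Z) * n = 2 * k * n + (2 * p)%N%:Z * - n).
  by rewrite expfzDr // exprz_w2p /oddz abszN -/(oddz n) -(odd_pn n b) -xE ox mulrC.
by rewrite PoszM; ring.
Qed.

Let dvdz_pN x : (p %| - x)%Z = (p %| x)%Z. Proof. exact: rpredN. Qed.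

(** One coefficient suffices. If p divides b, the constant term is a power of w; otherwise x = 2b
    contributes 1 while its mirror -2b lies outside the support. *)
Lemma tE_neq0 P : tE P != 0.
Proof.
case: P => k b; case: (boolP (p %| b)%Z) => pb.
  apply/eqP => /(congr1 (fun g => fcoef g 0)); rewrite fcoef_theta0 // fcoef0 /parity /=.
  case: (phaseP k b 0) => [n _|]; first by move/eqP; rewrite expfz_eq0 (negPf w0) andbF.
  by rewrite sub0r dvdz_pN dvdz2 pb.
have b0 : b != 0 by apply: contraNneq pb => ->; rewrite dvdz0.
apply/eqP => /(congr1 (fun g => fcoef g (2 * `|2 * b| ^ 2))).
rewrite fcoef_theta ?mulf_neq0 // fcoef0 /parity.
have -> : oddz (2 * b) = false by rewrite /oddz abszM oddM.
have -> : oddz (- (2 * b)) = false by rewrite /oddz abszN abszM oddM.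
rewrite /= -[X in phase _ X]add0r -[X in phase _ (X + _)](mulr0 p%:Z) phaseE.
rewrite mulr0 expr0z phase0 ?addr0; first by move/eqP; rewrite oner_eq0.
rewrite (_ : _ - _ = - (2 * (2 * b))); last by ring.
by rewrite dvdz_pN !dvdz2.
Qed.

Lemma tO_neq0 k b : ~~ (p %| b)%Z -> tO (k, b) != 0.
Proof.
move=> pb; pose x := p%:Z * 1 + 2 * b.
have ox : oddz x by rewrite odd_pn.
have x0 : x != 0 by apply: contraTneq ox => ->.
apply/eqP => /(congr1 (fun g => fcoef g (2 * `|x| ^ 2))).
rewrite fcoef_theta // fcoef0 /parity {2}/oddz abszN -/(oddz x) ox /= phaseE.
rewrite phase0 ?addr0; first by move/eqP; rewrite expfz_eq0 (negPf w0) andbF.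
rewrite (_ : _ - _ = p%:Z * -1 + - (2 * (2 * b))); last by rewrite /x; ring.
by rewrite dvdz_pD dvdz_pN !dvdz2.
Qed.

(** The terms x = p and x = -p contribute two powers of w with exponents differing by 2k; they
    cancel only if w^(2k) = -1. *)
Lemma tO_neq0_dvd k b : (p %| b)%Z -> ~~ ((2 * p)%N %| k - p%:Z)%Z -> tO (k, b) != 0.
Proof.
move=> /divzK; rewrite mulrC; set c := (b %/ p)%Z => bE pk.
apply/eqP => /(congr1 (fun g => fcoef g (2 * `|p%:Z| ^ 2))).
rewrite fcoef_theta // fcoef0 /parity {2}/oddz abszN -/(oddz p%:Z).
have -> : oddz p%:Z by [].
rewrite /= (_ : p%:Z = p%:Z * (1 - 2 * c) + 2 * b) ?phaseE; last by rewrite -bE; ring.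
rewrite (_ : - (_ + _) = p%:Z * (- 1 - 2 * c) + 2 * b) ?phaseE; last by rewrite -bE; ring.
rewrite (_ : k * (1 - 2 * c) = k * (- 1 - 2 * c) + k * 2); last by ring.
rewrite expfzDr // -{2}[w ^ _]mulr1 -mulrDr => /eqP; rewrite mulf_eq0 expfz_eq0 (negPf w0) andbF /=.
rewrite addr_eq0 -w2p => /eqP wk.
have : w ^ (k * 2 - (2 * p)%N%:Z) = 1.
  by rewrite expfzDr // wk exprnP -expfzDr // subrr expr0z.
move: pk; rewrite PoszM => pk.
have -> : k * 2 - 2 * p%:Z = 2 * (k - p%:Z) by ring.
move=> H; case/negP: pk; move: H; move: (k - p%:Z) => m.
have gen (n : nat) : w ^+ (2 * n) = 1 -> (2 * p %| n)%N.
  move/eqP; rewrite -(prim_order_dvd w_prim) (_ : 4 * p = 2 * (2 * p))%N; last by lia.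
  by rewrite dvdn_pmul2l.
rewrite dvdzE abszM /=; case: m => m H; first by apply: gen; exact: H.
rewrite NegzE abszN; apply: gen; apply: invr_inj; rewrite invr1 -H NegzE mulrN -invr_expz.
by rewrite -exprnP.
Qed.

Lemma phase_period k b a c x :
  phase (k + 4 * a * p%:Z, b + c * p%:Z) x = w ^ (- (2 * k * c)) * phase (k, b) x.
Proof.
case: (phaseP k b x) => [n ->|px]; last first.
  rewrite mulr0 phase0 // (_ : _ - _ = p%:Z * (- 2 * c) + (x - 2 * b)); last by ring.
  by rewrite dvdz_pD.
rewrite (_ : p%:Z * n + 2 * b = p%:Z * (n - 2 * c) + 2 * (b + c * p%:Z)); last by ring.
rewrite phaseE (_ : (k + 4 * a * p%:Z) * (n - 2 * c) = - (2 * k * c) + (k * n + (2 * p)%N%:Z * (2 * (a * (n - 2 * c))))); last first.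
  by rewrite PoszM; ring.
rewrite !expfzDr // exprz_w2p (_ : oddz _ = false) ?mulr1 //.
by rewrite /oddz abszM oddM.
Qed.

Lemma tE_period k b a c : tE (k + 4 * a * p%:Z, b + c * p%:Z) =
  fpsC (w ^ (- (2 * k * c))) * tE (k, b).
Proof.
rewrite -thetaZ; apply: eq_theta => x; rewrite /parity phase_period.
by case: eqP; rewrite ?mulr0.
Qed.

Lemma tO_period k b a c : tO (k + 4 * a * p%:Z, b + c * p%:Z) =
  fpsC (w ^ (- (2 * k * c))) * tO (k, b).
Proof.
rewrite -thetaZ; apply: eq_theta => x; rewrite /parity phase_period.
by case: eqP; rewrite ?mulr0.
Qed.

Let wpoddN n : oddz n -> w ^ (- (p%:Z * n)) = - w ^ (p%:Z * n).
Proof.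
move=> on; rewrite (_ : - _ = p%:Z * n + (2 * p)%N%:Z * - n); last by rewrite PoszM; ring.
by rewrite expfzDr // exprz_w2p /oddz abszN -/(oddz n) on mulrN1.
Qed.

Lemma theta_odd_eq0 (c : nat) (f : int -> algC) : (forall x, f (- x) = - f x) -> theta c f = 0.
Proof.
move=> fN; apply: fpsP => N; change (fcoef (theta c f) N) with (\sum_(x <- zbox N | (c * `|x| ^ 2 == N)%N) f x).
set S := \sum_(x <- _ | _) _; rewrite fcoef0.
have : S = - S.
  rewrite {1}/S -sumrN.
  transitivity (\sum_(x <- zbox N | (c * `|x| ^ 2 == N)%N) f (- x)); last first.
    by apply: eq_bigr => x _; rewrite fN.
  rewrite -[LHS]big_filter -[RHS]big_filter -[RHS](big_map -%R xpredT f).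
    apply: perm_big; apply: uniq_perm; rewrite ?filter_uniq ?zbox_uniq //.
      by rewrite map_inj_uniq ?filter_uniq ?zbox_uniq //; apply: oppr_inj.
    move=> x; apply/idP/mapP => [|[y] yN ->].
      rewrite mem_filter mem_zbox => xN; exists (- x); rewrite ?opprK //.
      by rewrite mem_filter mem_zbox abszN.
    by move: yN; rewrite !mem_filter !mem_zbox abszN.
by move/eqP; rewrite -addr_eq0 -mulr2n mulrn_eq0 /= => /eqP.
Qed.

(** Up to a period this is the point -K0, where the summand is an odd function of x. *)
Lemma tO_torsion a b : tO (p%:Z * (4 * a) - p%:Z, p%:Z * b) = 0.
Proof.
rewrite (_ : (_, _) = (- p%:Z + 4 * a * p%:Z, 0 + b * p%:Z)); last by congr pair; ring.
rewrite tO_period [X in _ * X](_ : _ = 0) ?mulr0 //.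
apply: theta_odd_eq0 => x; rewrite /parity {1}/oddz abszN -/(oddz x).
case: eqP => [ox|_]; last by rewrite oppr0.
case: (phaseP (- p%:Z) 0 x) => [n xE|px]; last first.
  by rewrite phase0 ?oppr0 //; move: px; rewrite !mulr0 !subr0 dvdz_pN.
have on : oddz n by rewrite -(odd_pn n 0) -xE.
rewrite xE (_ : - (_ + _) = p%:Z * - n + 2 * 0); last by ring.
rewrite phaseE (_ : - p%:Z * - n = p%:Z * n); last by ring.
by rewrite mulNr wpoddN // opprK.
Qed.

Let sp := odd p./2.

(** The phase at n is w^((p^2 - p) n), which is the power (p-1)/2 * n of w^(2p) = -1: trivial for
    even n, the sign (-1)^((p-1)/2) for odd n. *)
Lemma theta_base a b :
  (tE (p%:Z * (p%:Z + 4 * a) - p%:Z, p%:Z * b) = tE (0, 0) * fpsC (w ^ (- (2 * (p%:Z * p%:Z - p%:Z) * b)))) *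
  (tO (p%:Z * (p%:Z + 4 * a) - p%:Z, p%:Z * b) =
    (-1) ^+ sp * tO (0, 0) * fpsC (w ^ (- (2 * (p%:Z * p%:Z - p%:Z) * b)))).
Proof.
rewrite (_ : (_, _) = ((p%:Z * p%:Z - p%:Z) + 4 * a * p%:Z, 0 + b * p%:Z)); last by congr pair; ring.
rewrite tE_period tO_period ![_ * fpsC _]mulrC.
have kE : p%:Z * p%:Z - p%:Z = (2 * p)%N%:Z * (p./2)%:Z.
  by rewrite [p in p%:Z * _](_ : p = (2 * p./2).+1)%N; [rewrite !PoszM; lia | move: p_odd; clear; lia].
split; congr (_ * _).
  apply: eq_theta => x; rewrite /parity; case: eqP => // ox.
  case: (phaseP (p%:Z * p%:Z - p%:Z) 0 x) => [n xE|px]; last by rewrite phase0.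
  have on : oddz n = false by rewrite -(odd_pn n 0) -xE.
  rewrite xE phaseE mul0r expr0z kE -mulrA exprz_w2p.
  by rewrite /oddz abszM oddM -/(oddz n) on andbF.
have spE : ((-1) ^+ sp : R) = fpsC ((-1 : algC) ^+ sp) by rewrite rmorphXn rmorphN1.
rewrite spE.
rewrite -thetaZ; apply: eq_theta => x; rewrite /parity; case: eqP => [ox|]; last by rewrite mulr0.
case: (phaseP (p%:Z * p%:Z - p%:Z) 0 x) => [n xE|px]; last by rewrite phase0 ?mulr0.
have on : oddz n by rewrite -(odd_pn n 0) -xE.
rewrite xE phaseE mul0r expr0z mulr1 kE -mulrA exprz_w2p.
by rewrite /oddz abszM oddM -/(oddz n) on andbT /sp; case: (odd _).
Qed.
End TorsionPoints.

(** * The Jacobi triple product *)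

Section GaussBinomial.
Variables (A : comNzRingType).
Implicit Types Q u v : A.

(** Gaussian binomials through their Pascal rule, which avoids any division. *)
Fixpoint gb Q n k : A :=
  match n, k with
  | _, 0 => 1
  | 0, _.+1 => 0
  | n'.+1, k'.+1 => gb Q n' k' + Q ^+ k'.+1 * gb Q n' k'.+1
  end.

Lemma gb0 Q n : gb Q n 0 = 1. Proof. by case: n. Qed.
Lemma gbS Q n k : gb Q n.+1 k.+1 = gb Q n k + Q ^+ k.+1 * gb Q n k.+1.
Proof. by []. Qed.
Lemma gb_small Q n k : (n < k)%N -> gb Q n k = 0.
Proof.
elim: n k => [|n IHn] [|k] //= lt; rewrite !IHn //; first by rewrite mulr0 addr0.
exact: ltnW.
Qed.
Lemma gb_diag Q n : gb Q n n = 1.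
Proof. by elim: n => //= n IHn; rewrite IHn gb_small // mulr0 addr0. Qed.

Lemma gbSr Q n k : (k <= n)%N -> gb Q n.+1 k.+1 = gb Q n k.+1 + Q ^+ (n - k) * gb Q n k.
Proof.
elim: n k => [|n IHn] [|k] // lekn.
- by rewrite gbS /= subnn expr0; ring.
- by rewrite [LHS]gbS [in LHS]IHn // [in RHS]gbS !gb0 !subn0 !exprS; ring.
rewrite ltnS in lekn; have [ltkn|] := ltnP k n; last first.
  move=> lenk; have -> : k = n by apply/eqP; rewrite eqn_leq lekn.
  by rewrite gb_diag gb_small // subnn expr0 mul1r gb_diag add0r.
rewrite [LHS]gbS [in LHS]IHn // [in LHS]IHn // subSS.
rewrite [X in _ = X + _]gbS [X in _ = _ + _ * X]gbS.
have -> : Q ^+ (n - k) = Q ^+ (n - k.+1) * Q by rewrite -exprSr; congr (_ ^+ _); lia.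
by rewrite !exprS; ring.
Qed.

(** The two Pascal rules compared: consecutive binomials differ only by multiples of high powers of
    Q. *)
Lemma gb_diff Q n k : (k <= n)%N ->
  gb Q n k.+1 + Q ^+ (n - k) * gb Q n k = gb Q n k + Q ^+ k.+1 * gb Q n k.+1.
Proof. by move=> lekn; rewrite -gbSr // gbS. Qed.

#[local] Arguments gb : simpl never.

(** The term u^(k(k+1)/2) v^(k(k-1)/2) of the triple product; both exponents are nonnegative for
    every integer k. *)
Definition tri u v (k : int) : A :=
  match k with
  | Posz n => u ^+ 'C(n.+1, 2) * v ^+ 'C(n, 2)
  | Negz n => u ^+ 'C(n.+1, 2) * v ^+ 'C(n.+2, 2)
  end.

Let binS2 n : 'C(n.+1, 2) = ('C(n, 2) + n)%N. Proof. by rewrite binS bin1. Qed.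

Lemma triS u v (k : int) M : (k <= M%:Z) ->
  tri u v k * ((u * v) ^+ M * u) = tri u v (k + 1) * (u * v) ^+ (absz (M%:Z - k)).
Proof.
case: k => n leM.
  have -> : n%:Z + 1 = n.+1%:Z by lia.
  have -> : absz (M%:Z - n%:Z) = (M - n)%N by lia.
  have -> : (u * v) ^+ M = (u * v) ^+ (M - n) * (u * v) ^+ n.
    by rewrite -exprD; congr (_ ^+ _); lia.
  by rewrite /tri !binS2 !exprD !exprMn !exprS; ring.
have -> : absz (M%:Z - Negz n) = (M + n.+1)%N by lia.
case: n leM => [|n] _.
  have -> : Negz 0 + 1 = 0 by lia.
  by rewrite /tri /= !exprD !exprMn !expr1 ?expr0; ring.
have -> : Negz n.+1 + 1 = Negz n by lia.
by rewrite /tri !binS2 !exprD !exprMn !exprS; ring.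
Qed.

Lemma triN u v (k : int) N : (- N%:Z <= k) ->
  tri u v k * ((u * v) ^+ N * v) = tri u v (k - 1) * (u * v) ^+ (absz (N%:Z + k)).
Proof.
case: k => [[|n]|n] leN.
- have -> : 0%:Z - 1 = Negz 0 by lia.
  by rewrite addr0 /tri /= !exprMn !expr1 ?expr0; ring.
- have -> : n.+1%:Z - 1 = n%:Z by lia.
  have -> : absz (N%:Z + n.+1%:Z) = (N + n.+1)%N by lia.
  by rewrite /tri !binS2 !exprD !exprMn !exprS; ring.
have -> : Negz n - 1 = Negz n.+1 by lia.
have -> : absz (N%:Z + Negz n) = (N - n.+1)%N by lia.
have -> : (u * v) ^+ N = (u * v) ^+ (N - n.+1) * (u * v) ^+ n.+1.
  by rewrite -exprD; congr (_ ^+ _); lia.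
by rewrite /tri !binS2 !exprD !exprMn !exprS; ring.
Qed.

Lemma tri0 u v : tri u v 0 = 1.
Proof. by rewrite /tri /= !expr0 mulr1. Qed.

(** The q-binomial theorem in symmetric form. The induction on N uses the first Pascal rule, the one
    on M the second. *)
Lemma finite_JTP u v M N :
  (\prod_(m < M) (1 + (u * v) ^+ m * u)) * (\prod_(m < N) (1 + (u * v) ^+ m * v)) =
  \sum_(j < (M + N).+1) gb (u * v) (M + N) j * tri u v (j%:Z - N%:Z).
Proof.
elim: M => [|M IHM].
  rewrite big_ord0 mul1r; elim: N => [|N IHN].
    by rewrite big_ord0 big_ord_recl big_ord0 addr0 gb0 mul1r tri0.
  rewrite big_ord_recr /= IHN !add0n mulrDr mulr1 mulr_suml addrC.
  have E (j : 'I_N.+1) : gb (u * v) N j * tri u v (j%:Z - N%:Z) * ((u * v) ^+ N * v) =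
      (u * v) ^+ j * gb (u * v) N j * tri u v (j%:Z - N.+1%:Z).
    rewrite -mulrA triN; last by lia.
    have -> : absz (N%:Z + (j%:Z - N%:Z)) = j by lia.
    have -> : j%:Z - N%:Z - 1 = j%:Z - N.+1%:Z by lia.
    by ring.
  rewrite [X in X + _](eq_bigr _ (fun j _ => E j)) [RHS]big_ord_recl /= gb0 mul1r.
  rewrite [X in X + _]big_ord_recl /= gb0 ?expr0 !mul1r -addrA; congr (_ + _).
  rewrite [RHS](eq_bigr (fun j : 'I_N.+1 =>
     gb (u * v) N j * tri u v (j%:Z - N%:Z) +
     (u * v) ^+ j.+1 * gb (u * v) N j.+1 * tri u v (j.+1%:Z - N.+1%:Z))); last first.
    move=> j _; rewrite /bump /= add1n.
    have -> : j.+1%:Z - N.+1%:Z = j%:Z - N%:Z by lia.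
    by rewrite mulrDl.
  rewrite big_split /= addrC; congr (_ + _).
  by rewrite [RHS]big_ord_recr /= gb_small // mulr0 mul0r addr0.
rewrite big_ord_recr /= mulrAC IHM mulrDr mulr1 mulr_suml addSn.
have E (j : 'I_(M + N).+1) : gb (u * v) (M + N)%N j * tri u v (j%:Z - N%:Z) * ((u * v) ^+ M * u) =
    (u * v) ^+ (M + N - j)%N * gb (u * v) (M + N) j * tri u v (j.+1%:Z - N%:Z).
  have := ltn_ord j => ltj.
  rewrite -mulrA triS; last by lia.
  have -> : absz (M%:Z - (j%:Z - N%:Z) : int)%R = (M + N - j)%N by lia.
  have -> : j%:Z - N%:Z + 1 = j.+1%:Z - N%:Z by lia.
  by ring.
rewrite [X in _ + X](eq_bigr _ (fun j _ => E j)) [RHS]big_ord_recl /= gb0 mul1r.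
rewrite [X in X + _]big_ord_recl /= gb0 mul1r -addrA; congr (_ + _).
rewrite [RHS](eq_bigr (fun j : 'I_(M + N).+1 =>
   gb (u * v) (M + N) j.+1 * tri u v (j.+1%:Z - N%:Z) +
   (u * v) ^+ (M + N - j) * gb (u * v) (M + N) j * tri u v (j.+1%:Z - N%:Z))); last first.
  move=> j _; have lej : (j <= M + N)%N by rewrite -ltnS.
  by rewrite /bump /= add1n gbSr // mulrDl.
rewrite big_split /=; congr (_ + _).
by rewrite [RHS]big_ord_recr /= gb_small // mul0r addr0.
Qed.
End GaussBinomial.

Section TripleProductSeries.
Variable K : fieldType.
Local Notation R := (fps K).

Lemma eqtrunc_monoM D e c (f g : R) :
  eqtrunc D f g -> eqtrunc (D + e) (mono c e * f) (mono c e * g).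
Proof.
move=> fg i lti; rewrite !fcoef_monoM; case: leqP => // le.
by rewrite fg //; lia.
Qed.

(** Moving away from the central binomial one step at a time by [gb_diff], each step costing one
    order of precision. *)
Lemma eqtrunc_gb q e M k : (0 < e)%N -> (k <= M)%N ->
  eqtrunc (M - k).+1 (gb (mono q e : R) (M + M) (M + k)) (gb (mono q e) (M + M) M) /\
  eqtrunc (M - k).+1 (gb (mono q e : R) (M + M) (M - k)) (gb (mono q e) (M + M) M).
Proof.
move=> e0; set Q : R := mono q e.
have step j D : (j <= M + M)%N -> (D <= M + M - j)%N -> (D <= j.+1)%N ->
    eqtrunc D (gb Q (M + M) j.+1) (gb Q (M + M) j).
  move=> lej D1 D2; have Qm m f : (D <= m)%N -> eqtrunc D (Q ^+ m * f) 0.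
    by move=> Dm; rewrite monoX; apply: eqtrunc_mono0; apply: leq_trans Dm (leq_pmull _ _).
  have /(congr1 (fun f => fcoef f)) := gb_diff Q lej => H i lti.
  have := congr1 (fun g => g i) H; rewrite !fcoefD.
  by rewrite (Qm _ _ D1) // (Qm _ _ D2) // !fcoef0 !addr0.
elim: k => [|k IHk] lek; first by rewrite addn0 subn0.
have [IH1 IH2] := IHk (ltnW lek); split.
  rewrite addnS; apply: eqtrunc_trans (eqtruncW _ IH1); last by lia.
  by apply: step; lia.
apply: eqtrunc_trans (eqtruncW _ IH2); last by lia.
have -> : (M - k = (M - k.+1).+1)%N by lia.
by apply: eqtrunc_sym; apply: step; lia.
Qed.

Lemma tri_mono c d a b l : (0 < a + b)%N -> exists x e,
  tri (mono c a : R) (mono d b) l = mono x e /\ (`|l| <= e.+1)%N.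
Proof.
move=> ab; have binS2 n : 'C(n.+1, 2) = ('C(n, 2) + n)%N by rewrite binS bin1.
have bin_le n : (n <= ('C(n, 2)).+1)%N.
  by elim: n => // n IHn; rewrite binS2; case: n IHn => // n; lia.
case: l => n; rewrite /tri !monoX monoM; do 2!eexists; split; try by [].
  rewrite /= binS2; have := bin_le n; move: 'C(n, 2) => m; nia.
have -> : `|Negz n|%N = n.+1 by [].
rewrite (binS2 n.+1); have := bin_le n.+1; move: 'C(n.+1, 2) => m; nia.
Qed.

(** The central binomial is kept as a factor instead of being evaluated in the limit: it is the same
    for [tE] and [tO], whose quotient alone matters. *)
Lemma JTP_trunc c d a b M : (0 < a + b)%N ->
  let u : R := mono c a in let v := mono d b in
  eqtrunc M ((\prod_(m < M) (1 + (u * v) ^+ m * u)) * (\prod_(m < M) (1 + (u * v) ^+ m * v)))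
    (gb (u * v) (M + M) M * \sum_(j < (M + M).+1) tri u v (j%:Z - M%:Z)).
Proof.
move=> ab u v; rewrite finite_JTP mulr_sumr; apply: eqtrunc_sum => j _.
have [x [e [-> le]]] := @tri_mono c d a b (j%:Z - M%:Z) ab.
rewrite /u /v monoM mulrC [X in eqtrunc _ _ X]mulrC.
have [k [lek jE]] : exists k, (k <= M)%N /\ (nat_of_ord j = M + k \/ nat_of_ord j = M - k)%N.
  have := ltn_ord j; case: (leqP M j) => h1 h2.
    by exists (j - M)%N; lia.
  by exists (M - j)%N; lia.
have [G1 G2] := @eqtrunc_gb (c * d) (a + b) M k ab lek.
(* At distance k from the centre about k orders are lost on the binomial, but the term itself has
   order e >= k - 1. *)
apply: (@eqtruncW _ ((M - k).+1 + e)); first by lia.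
by apply: eqtrunc_monoM; case: jE => ->.
Qed.

Lemma theta_trunc c f N (s : seq int) : (0 < c)%N -> uniq s ->
  (forall x, f x != 0 -> (c * `|x| ^ 2 < N)%N -> x \in s) ->
  eqtrunc N (theta c f : R) (\sum_(x <- s) mono (f x) (c * `|x| ^ 2)).
Proof.
move=> c0 us fs n ltn; rewrite (@theta_coef _ c f n N) ?(ltnW ltn) // fcoef_sum /=.
rewrite -[RHS]big_mkcond /=.
have drop0 (r : seq int) : \sum_(x <- r | (c * `|x| ^ 2 == n)%N) f x =
    \sum_(x <- r | (c * `|x| ^ 2 == n)%N && (f x != 0)) f x.
  by rewrite big_mkcondr; apply: eq_bigr => x _; case: (eqVneq (f x) 0).
rewrite drop0 [RHS](eq_bigl (fun x => (c * `|x| ^ 2 == n)%N)) => [|x]; last by rewrite eq_sym.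
rewrite [RHS]drop0; apply: sum_uniq_eq => // [|x /andP[/eqP xn fx]]; first exact: zbox_uniq.
rewrite fs ?xn // mem_zbox; apply: leq_trans (ltnW ltn); rewrite -xn.
apply: leq_trans (leq_pmull _ c0).
by case: (`|x|)%N => // m; rewrite -mulnn leq_pmulr.
Qed.

Lemma tri_monoV c a b l : c != 0 -> exists e,
  tri (mono c a : R) (mono c^-1 b) l = mono (c ^ l) e /\
  2 * e%:Z = a%:Z * (l * (l + 1)) + b%:Z * (l * (l - 1)).
Proof.
move=> c0.
have bin2Z n : 2 * ('C(n.+1, 2))%:Z = n%:Z * (n%:Z + 1).
  elim: n => [|n IHn]; first by [].
  by rewrite binS bin1 PoszD mulrDr IHn; lia.
have cE m n : c ^+ m * c^-1 ^+ n = c ^ (m%:Z - n%:Z).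
  by rewrite expfzDr // exprVn -exprnN.
case: l => n; rewrite /tri !monoX monoM cE; eexists; split.
- congr (mono (c ^ _) _); rewrite binS bin1 PoszD; lia.
- rewrite PoszD !PoszM mulrDr !mulrA ![2 * _]mulrC -!mulrA bin2Z.
  case: n => [|n]; first by rewrite bin0n; lia.
  by rewrite bin2Z; lia.
- congr (mono (c ^ _) _); rewrite (binS n.+1) bin1 PoszD; lia.
rewrite PoszD !PoszM mulrDr !mulrA ![2 * _]mulrC -!mulrA !bin2Z; lia.
Qed.
End TripleProductSeries.

(** * Product formulas for the theta quotients *)

Section ThetaProducts.
Variables (p : nat) (w : algC).
Hypothesis p_prime : prime p.
Hypothesis p_odd : odd p.
Hypothesis w_prim : (4 * p).-primitive_root w.
Local Notation R := (fps algC).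
Local Notation V := (int * int)%type.

Let p_gt0 : (0 < p)%N. Proof. exact: prime_gt0. Qed.
Let w0 : w != 0.
Proof. by rewrite (prim_root_eq0 w_prim) -lt0n muln_gt0. Qed.

Definition rQ : R := mono 1 (16 * p ^ 2).
Definition EP c s M : R :=
  (\prod_(m < M) (1 + rQ ^+ m * mono c (8 * p ^ 2 + 16 * p * s))) *
  (\prod_(m < M) (1 + rQ ^+ m * mono c^-1 (8 * p ^ 2 - 16 * p * s))).
Definition OP c s M : R :=
  (\prod_(m < M) (1 + rQ ^+ m * mono c (16 * p * s))) *
  (\prod_(m < M) (1 + rQ ^+ m * mono c^-1 (16 * p ^ 2 - 16 * p * s))).

Let absz_sqr (x : int) : ((`|x| ^ 2)%N%:Z = x ^+ 2).
Proof. by rewrite -abszX; lia. Qed.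
Let absz_le2 (x : int) : (`|x| <= 2 * `|x| ^ 2)%N.
Proof. by case: (`|x|)%N => // m; rewrite -mulnn; nia. Qed.

Lemma tE_trunc k (s M : nat) : (2 * s < p)%N ->
  eqtrunc M (gb rQ (M + M) M * tE p w (k, s%:Z)) (mono 1 (8 * s ^ 2) * EP (w ^ (2 * k)) s M).
Proof.
move=> sp; set c := w ^ (2 * k).
have c0 : c != 0 by rewrite expfz_neq0.
have le16 : (16 * p * s <= 8 * p ^ 2)%N by rewrite -mulnn; nia.
have ab : (0 < (8 * p ^ 2 + 16 * p * s) + (8 * p ^ 2 - 16 * p * s))%N.
  by rewrite -mulnn; nia.
have uv : mono c (8 * p ^ 2 + 16 * p * s) * mono c^-1 (8 * p ^ 2 - 16 * p * s) = rQ.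
  by rewrite monoM divff //; congr mono; lia.
have := @JTP_trunc _ c c^-1 _ _ M ab; rewrite /= uv -/(EP c s M) => J.
apply: eqtrunc_sym; apply: (eqtrunc_trans (eqtruncM (@eqtrunc_refl _ M _) J)).
rewrite mulrCA; apply: eqtruncM; first by [].
(* The even integers in the support of the phase, as n = 2l in p n + 2s. *)
pose g (j : nat) : int := 2 * (p%:Z * (j%:Z - M%:Z) + s%:Z).
have g_inj : injective g by rewrite /g => i j; nia.
have T := @theta_trunc algC 2 (parity false (phase p w (k, s%:Z))) M
  [seq g j | j <- iota 0 (M + M).+1] isT.
apply: eqtrunc_sym; apply: (eqtrunc_trans (T _ _)).
- by rewrite map_inj_uniq ?iota_uniq.
- move=> x; rewrite /parity; case: (boolP (oddz x == false)) => [/eqP ox|_]; last by rewrite eqxx.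
  case: (phaseP p_prime p_odd w_prim k s%:Z x) => [n xE _|_]; last by rewrite eqxx.
  have on : oddz n = false.
    by move: ox; rewrite xE /oddz => h; move: h p_odd; nia.
  have nE : n = 2 * (n %/ 2)%Z by move: on; rewrite /oddz; lia.
  move: (n %/ 2)%Z nE => l nE xM; have := absz_le2 x => xle.
  have xE' : x = 2 * (p%:Z * l + s%:Z) by rewrite xE nE; ring.
  have lx : (`|l| <= `|x|)%N by move: xE' sp p_gt0; clear; case: l => l; nia.
  apply/mapP; exists (absz (l + M%:Z)); first by rewrite mem_iota; lia.
  by rewrite /g xE'; congr (2 * (_ * _ + _)); lia.
rewrite big_map mulr_sumr -[X in eqtrunc _ X]/(\sum_(j <- iota 0 (M + M).+1) _).
rewrite -(big_mkord xpredT (fun j => mono 1 (8 * s ^ 2) * tri (mono c (8 * p ^ 2 + 16 * p * s) : R)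
  (mono c^-1 (8 * p ^ 2 - 16 * p * s)) (j%:Z - M%:Z))).
rewrite /index_iota subn0.
apply: eqtrunc_sum => j _.
have [e [-> eE]] := @tri_monoV algC c (8 * p ^ 2 + 16 * p * s) (8 * p ^ 2 - 16 * p * s) (j%:Z - M%:Z) c0.
rewrite monoM mul1r /parity (_ : oddz (g j) = false); last by rewrite /g /oddz; lia.
rewrite /= (_ : g j = p%:Z * (2 * (j%:Z - M%:Z)) + 2 * s%:Z); last by rewrite /g; ring.
rewrite phaseE // (_ : (2 * `|_| ^ 2)%N = (8 * s ^ 2 + e)%N).
  rewrite /c exprz_exp (_ : k * _ = 2 * k * (j%:Z - M%:Z)); last by ring.
  by [].
set X : int := p%:Z * (2 * (j%:Z - M%:Z)) + 2 * s%:Z.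
have H : 2 * ((2 * `|X| ^ 2)%N%:Z) = 2 * (8 * s ^ 2)%N%:Z + 2 * e%:Z.
  rewrite (PoszM 2 (absz X ^ 2)%N) absz_sqr eE -subzn // !PoszD !PoszM /X.
  by ring.
by move: (2 * _ ^ 2)%N (8 * _ ^ 2)%N H; clear; lia.
Qed.

Lemma tO_trunc k (s M : nat) : (2 * s < p)%N ->
  eqtrunc M (gb rQ (M + M) M * tO p w (k, s%:Z))
    (mono (w ^ (- k)) (2 * (p - 2 * s) ^ 2) * OP (w ^ (2 * k)) s M).
Proof.
move=> sp; set c := w ^ (2 * k).
have c0 : c != 0 by rewrite expfz_neq0.
have le16 : (16 * p * s <= 16 * p ^ 2)%N by rewrite -mulnn; nia.
have ab : (0 < (16 * p * s) + (16 * p ^ 2 - 16 * p * s))%N.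
  by rewrite subnKC // muln_gt0 expn_gt0 p_gt0.
have uv : mono c (16 * p * s) * mono c^-1 (16 * p ^ 2 - 16 * p * s) = rQ.
  by rewrite monoM divff //; congr mono; lia.
have := @JTP_trunc _ c c^-1 _ _ M ab; rewrite /= uv -/(OP c s M) => J.
apply: eqtrunc_sym; apply: (eqtrunc_trans (eqtruncM (@eqtrunc_refl _ M _) J)).
rewrite mulrCA; apply: eqtruncM; first by [].
(* The odd integers of the support, as n = 2l - 1; l = 0 yields the leading monomial, with x = 2s -
   p and phase w^(-k). *)
pose g (j : nat) : int := p%:Z * (2 * (j%:Z - M%:Z) - 1) + 2 * s%:Z.
have g_inj : injective g by rewrite /g => i j; nia.
have T := @theta_trunc algC 2 (parity true (phase p w (k, s%:Z))) M
  [seq g j | j <- iota 0 (M + M).+1] isT.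
apply: eqtrunc_sym; apply: (eqtrunc_trans (T _ _)).
- by rewrite map_inj_uniq ?iota_uniq.
- move=> x; rewrite /parity; case: (boolP (oddz x == true)) => [/eqP ox|_]; last by rewrite eqxx.
  case: (phaseP p_prime p_odd w_prim k s%:Z x) => [n xE _|_]; last by rewrite eqxx.
  have on : oddz n.
    by move: ox; rewrite xE /oddz => h; move: h p_odd; nia.
  have nE : n = 2 * ((n + 1) %/ 2)%Z - 1 by move: on; rewrite /oddz; lia.
  move: ((n + 1) %/ 2)%Z nE => l nE xM; have := absz_le2 x => xle.
  have lx : (`|l| <= `|x|)%N.
    rewrite xE nE; move: sp p_gt0; clear; case: l => l; nia.
  apply/mapP; exists (absz (l + M%:Z)); first by rewrite mem_iota; lia.
  by rewrite /g xE nE; congr (_ * (2 * _ - 1) + _); lia.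
rewrite big_map mulr_sumr -[X in eqtrunc _ X]/(\sum_(j <- iota 0 (M + M).+1) _).
rewrite -(big_mkord xpredT (fun j => mono (w ^ (- k)) (2 * (p - 2 * s) ^ 2) * tri (mono c (16 * p * s) : R)
  (mono c^-1 (16 * p ^ 2 - 16 * p * s)) (j%:Z - M%:Z))).
rewrite /index_iota subn0.
apply: eqtrunc_sum => j _.
have [e [-> eE]] := @tri_monoV algC c (16 * p * s) (16 * p ^ 2 - 16 * p * s) (j%:Z - M%:Z) c0.
rewrite monoM /parity (_ : oddz (g j) = true); last by move: p_odd; rewrite /g /oddz; nia.
rewrite /= phaseE // (_ : (2 * `|_| ^ 2)%N = (2 * (p - 2 * s) ^ 2 + e)%N).
  rewrite /c exprz_exp -expfzDr // (_ : k * _ = - k + 2 * k * (j%:Z - M%:Z)); last by ring.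
  by [].
set X : int := g j.
have H : 2 * ((2 * `|X| ^ 2)%N%:Z) = 2 * (2 * (p - 2 * s) ^ 2)%N%:Z + 2 * e%:Z.
  rewrite (PoszM 2 (absz X ^ 2)%N) absz_sqr eE -subzn // !PoszM -subzn ?(ltnW sp) // !PoszM /X /g.
  by ring.
by move: (2 * _ ^ 2)%N (2 * (_ - _) ^ 2)%N H; clear; lia.
Qed.

(** Cross-multiplication: both sides agree with the central binomial times [tO] times [tE]. *)
Lemma theta_quotient k (s M : nat) : (2 * s < p)%N ->
  eqtrunc M (tO p w (k, s%:Z) * (mono 1 (8 * s ^ 2) * EP (w ^ (2 * k)) s M))
    (tE p w (k, s%:Z) * (mono (w ^ (- k)) (2 * (p - 2 * s) ^ 2) * OP (w ^ (2 * k)) s M)).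
Proof.
move=> sp; have HE := @tE_trunc k s M sp; have HO := @tO_trunc k s M sp.
have H1 := eqtruncM (@eqtrunc_refl _ M (tO p w (k, s%:Z))) (eqtrunc_sym HE).
have H2 := eqtruncM (@eqtrunc_refl _ M (tE p w (k, s%:Z))) HO.
apply: (eqtrunc_trans H1); apply: eqtrunc_trans H2.
by rewrite mulrCA [X in eqtrunc _ _ X]mulrCA [tO _ _ _ * _]mulrC.
Qed.
End ThetaProducts.

(** * The generating function of ped *)

Lemma big_even_odd (A : Type) (idx : A) (op : Monoid.law idx) (F : nat -> A) N :
  \big[op/idx]_(i < N.*2) F i = \big[op/idx]_(j < N) op (F j.*2) (F j.*2.+1).
Proof.
elim: N => [|N IHN]; first by rewrite !big_ord0.
by rewrite doubleS !big_ord_recr /= IHN Monoid.mulmA.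
Qed.

Lemma ped0 : ped 0 = 1%N.
Proof.
rewrite /ped (_ : [set f | _] = setT); first by rewrite cardsT card_ffun !card_ord.
apply/setP => f; rewrite !inE /ped_partition big_ord0 eqxx /=.
by apply/forallP; case.
Qed.

Section PedSeries.
Variable K : fieldType.
Local Notation R := (fps K).

Definition pedP : R := Fps (fun m => (ped m)%:R).

Definition part_factor N i : R :=
  \sum_(k < N.+1) if odd i.+1 || (k <= 1)%N then mono 1 (k * i.+1) else 0.

Lemma prod_mono (I : Type) (r : seq I) (P : pred I) (x : I -> K) (e : I -> nat) :
  \prod_(i <- r | P i) mono (x i) (e i) =
  mono (\prod_(i <- r | P i) x i) (\sum_(i <- r | P i) e i).
Proof.
elim: r => [|i r IHr]; first by rewrite !big_nil mono1.
by rewrite !big_cons; case: (P i); rewrite // IHr monoM.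
Qed.

(** Expanding the product chooses a multiplicity for each part, that is a function as counted by
    [ped]; forbidden multiplicities contribute zero. *)
Lemma fcoef_ped m : fcoef (\prod_(i < m) part_factor m i) m = (ped m)%:R.
Proof.
rewrite /part_factor bigA_distr_bigA /= fcoef_sum /ped -sum1_card natr_sum.
rewrite [RHS](eq_bigl (fun f => ped_partition f)); last by move=> f; rewrite inE.
rewrite [RHS]big_mkcond; apply: eq_bigr => f _; rewrite /ped_partition.
case: forallP => [cond|ncond]; last first.
  rewrite andbF; have /existsP[i Hi] : [exists i : 'I_m, ~~ (odd i.+1 || (f i <= 1)%N)].
    by rewrite -negb_forall; apply/negP => /forallP.
  by rewrite [X in fcoef X _](_ : _ = 0) // (bigD1 i) //= (negPf Hi) mul0r.
rewrite andbT (eq_bigr (fun i : 'I_m => mono 1 (f i * i.+1) : R)); last first.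
  by move=> i _; rewrite cond.
by rewrite prod_mono big1_eq /= eq_sym.
Qed.

Lemma part_factor_trunc m N i : (m <= N)%N ->
  eqtrunc m.+1 (part_factor N i) (part_factor m i).
Proof.
move=> lemN n ltn; rewrite /part_factor !fcoef_sum.
pose F k := fcoef (if odd i.+1 || (k <= 1)%N then mono 1 (k * i.+1) else 0 : R) n.
rewrite -(big_mkord xpredT F) -[RHS](big_mkord xpredT F).
rewrite (@big_cat_nat _ _ _ m.+1) //= -[RHS]addr0; congr (_ + _).
rewrite big_nat big1 // => k /andP[ltmk _].
rewrite /F; case: ifP => // _ /=; rewrite ifN // neq_ltn; apply/orP; left.
by apply: leq_trans ltn _; apply: leq_trans ltmk _; rewrite leq_pmulr.
Qed.

Lemma part_factor_big m i : (m <= i)%N -> eqtrunc m.+1 (part_factor m i) 1.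
Proof.
move=> lemi n ltn; rewrite /part_factor fcoef_sum big_ord_recl /= orbT mono1.
rewrite ?mul0n big1 ?addr0 // => k _; case: ifP => // _ /=.
rewrite ifN // neq_ltn /bump /=; apply/orP; left; apply: leq_trans ltn _.
by rewrite mulSn; lia.
Qed.

(** [ped n] bounds parts and multiplicities by n. Raising both bounds to N adds only terms of degree
    above n. *)
Lemma pedP_trunc N : eqtrunc N pedP (\prod_(i < N) part_factor N i).
Proof.
move=> n ltn; rewrite -[LHS]fcoef_ped.
pose F m i := part_factor m i.
rewrite -(big_mkord xpredT (F n)) -[in RHS](big_mkord xpredT (F N)).
rewrite [in RHS](@big_cat_nat _ _ _ n) ?(ltnW ltn) //=.
suff H : eqtrunc n.+1 (\prod_(0 <= i < n) F n i)
    ((\prod_(0 <= i < n) F N i) * (\prod_(n <= i < N) F N i)) by apply: H.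
rewrite -[X in eqtrunc _ X _]mulr1; apply: eqtruncM.
  by apply: eqtrunc_prod => i _; apply/eqtrunc_sym/part_factor_trunc/ltnW.
rewrite [X in eqtrunc _ _ X]big_nat.
rewrite [X in eqtrunc _ X _](_ : 1 = \prod_(n <= i < N | (n <= i < N)%N) 1); last by rewrite big1.
apply: eqtrunc_prod => i /andP[leni _]; apply: eqtrunc_sym.
apply: (@eqtrunc_trans _ _ (part_factor n i)); last exact: part_factor_big.
exact/part_factor_trunc/ltnW.
Qed.

(** The even part 2j + 2 contributes 1 + q^(2j+2); the factor of the odd part 2j + 1 is a truncated
    geometric series, which telescopes against 1 - q^(2j+1). *)
Lemma pedP_product N :
  eqtrunc N (pedP * \prod_(j < N) (1 - mono 1 j.*2.+1))
    (\prod_(j < N) (1 + mono 1 j.*2.+2)).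
Proof.
have T : eqtrunc N pedP (\prod_(i < N.*2) part_factor N.*2 i).
  by apply: eqtruncW (@pedP_trunc N.*2); rewrite -addnn leq_addr.
apply: (eqtrunc_trans (eqtruncM T (@eqtrunc_refl _ N _))).
rewrite (big_even_odd _ (part_factor N.*2)) -big_split /=; apply: eqtrunc_prod => j _.
have -> : part_factor N.*2 j.*2.+1 = 1 + mono 1 j.*2.+2.
  rewrite /part_factor; have -> : N.*2 = (N.-1).*2.+2.
    by rewrite -doubleS prednK //; apply: leq_ltn_trans (ltn_ord j).
  rewrite 2!big_ord_recl /= !orbT ?mul0n mono1 big1 ?addr0 ?mul1n // => k _.
  by rewrite /= odd_double.
have G : part_factor N.*2 j.*2 * (1 - mono 1 j.*2.+1) = 1 - mono 1 (j.*2.+1 * N.*2.+1).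
  rewrite /part_factor (eq_bigr (fun k : 'I__ => mono 1 j.*2.+1 ^+ k : R)); last first.
    by move=> k _; rewrite /= odd_double /= monoX expr1n mulnC.
  by rewrite -(expr1n _ N.*2.+1) -monoX mulrC -opprB mulNr -subrX1 opprB expr1n.
rewrite mulrAC G -[X in eqtrunc _ _ X]mul1r; apply: eqtruncM => //.
move=> n ltn; rewrite fcoefB /= ifN ?subr0 //; nia.
Qed.

(** Substituting -q^8 turns 1 - q^(2j+1) into 1 + q^(16j+8), so that every factor has a plus sign,
    as in the triple products. *)
Definition pedX : R := mono 1 1 * fsubst (-1) 8 pedP.

Lemma pedX_coef m : fcoef pedX (8 * m).+1 = (-1) ^+ m * (ped m)%:R.
Proof. by rewrite fcoef_monoM /= subn1 /= dvdn_mulr // mulKn // mul1r mulrC. Qed.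

Lemma pedX_coef0 n : (n %% 8 != 1)%N -> fcoef pedX n = 0.
Proof.
move=> n8; rewrite fcoef_monoM; case: ltnP => // n0; rewrite mul1r /=.
rewrite ifN //; apply: contra n8; lia.
Qed.

Lemma pedX_product M :
  eqtrunc M (pedX * \prod_(m < M) (1 + mono 1 (16 * m + 8)))
    (mono 1 1 * \prod_(m < M) (1 + mono 1 (16 * m.+1))).
Proof.
have T := @eqtrunc_fsubst _ M (-1) 8 _ _ isT (@pedP_product M).
rewrite -mulrA; apply: eqtruncM => //.
move: T; rewrite fsubstM // !fsubst_prod //.
congr (eqtrunc _ (_ * _) _); apply: eq_bigr => m _.
  rewrite raddfB /= fsubst1 // fsubst_mono // mul1r exprS -mul2n exprM sqrrN expr1n expr1n mulr1.
  apply: fpsP => i; rewrite fcoefB fcoefD /= (_ : 8 * (2 * m).+1 = 16 * m + 8)%N; last by lia.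
  by case: ifP; rewrite ?opprK ?subr0 ?addr0.
rewrite raddfD /= fsubst1 // fsubst_mono // mul1r -doubleS -mul2n exprM sqrrN expr1n expr1n.
by congr (1 + mono _ _); lia.
Qed.
End PedSeries.

(** * Evaluation of the products over lines *)

Lemma pedX_fsubst_product (K : fieldType) (c : K) k M : (0 < k)%N ->
  eqtrunc M (fsubst c k (pedX K) * \prod_(m < M) (1 + mono c k ^+ (16 * m + 8)))
    (mono c k * \prod_(m < M) (1 + mono c k ^+ (16 * m.+1))).
Proof.
move=> k0; have := @eqtrunc_fsubst _ M c k _ _ k0 (@pedX_product K M).
rewrite !fsubstM // !fsubst_prod // fsubst_mono // mul1r expr1 muln1.
congr (eqtrunc _ (_ * _) (_ * _)); apply: eq_bigr => m _;
  by rewrite raddfD /= fsubst1 // fsubst_mono // monoX mul1r.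
Qed.

Section Tiling.
Variables (A : comNzRingType) (F : nat -> A) (h : nat).

Lemma prod_mul_ord p M :
  \prod_(n < M * p) F n = \prod_(m < M) \prod_(n < p) F (p * m + n)%N.
Proof.
elim: M => [|M IHM]; first by rewrite mul0n !big_ord0.
rewrite big_ord_recr /= -IHM mulSn addnC big_split_ord /=; congr (_ * _).
by apply: eq_bigr => n _; rewrite mulnC.
Qed.

Lemma prod_centered :
  \prod_(n < h.*2.+1) F n = F h * \prod_(s < h) (F (h + s.+1)%N * F (h - s.+1)%N).
Proof.
have -> : h.*2.+1 = (h + h.+1)%N by lia.
rewrite big_split_ord big_ord_recl /= addn0 big_split /=.
rewrite (reindex_inj rev_ord_inj) mulrCA; congr (_ * _); rewrite mulrC.
by congr (_ * _); apply: eq_bigr.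
Qed.

Lemma prod_folded :
  \prod_(n < h.*2.+1) F n.+1 =
  F h.*2.+1 * \prod_(s < h) (F s.+1 * F (h.*2.+1 - s.+1)%N).
Proof.
have -> : h.*2.+1 = (h + h.+1)%N by lia.
rewrite big_split_ord big_ord_recr /= big_split /= mulrA [LHS]mulrC addnS.
congr (_ * (_ * _)); rewrite (reindex_inj rev_ord_inj); apply: eq_bigr => s _.
by congr F => /=; have := ltn_ord s; lia.
Qed.
End Tiling.

(** The factorisation of T^p - 1 evaluated at T = -y, with z^s and z^(p-s) paired. *)
Lemma prod_cyclotomic p (z : algC) (y : fps algC) : odd p -> p.-primitive_root z ->
  (1 + y) * \prod_(s < p./2) ((1 + y * fpsC (z ^+ s.+1)) * (1 + y * fpsC (z ^+ s.+1)^-1)) =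
  1 + y ^+ p.
Proof.
move=> p_odd z_prim; have z0 : z != 0.
  by rewrite (prim_root_eq0 z_prim) -lt0n; case: (p) p_odd.
have pE : p = p./2.*2.+1 by rewrite -[LHS]odd_double_half p_odd.
have := congr1 (fun P => (map_poly (@fpsC algC) P).[- y]) (factor_Xn_sub_1 z_prim).
rewrite rmorph_prod horner_prod rmorphB /= map_polyXn rmorph1 hornerD hornerN.
rewrite hornerXn hornerC exprNn -signr_odd p_odd expr1 mulN1r -opprD.
move/(congr1 -%R); rewrite opprK addrC => <-.
pose F n := y + fpsC (z ^+ n).
rewrite (eq_bigr (fun i => - F i)) => [|i _]; last first.
  by rewrite rmorphB /= map_polyX map_polyC /= hornerXsubC opprD.
rewrite big_mkord prodrN card_ord -signr_odd p_odd expr1 mulN1r opprK.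
have -> : \prod_(i < p) F i = \prod_(i < p) F i.+1.
  have p0 : (0 < p)%N by case: (p) p_odd.
  rewrite -(prednK p0) big_ord_recl [RHS]big_ord_recr /= mulrC; congr (_ * _).
  by rewrite prednK // /F (prim_expr_order z_prim).
rewrite [X in \prod_(i < X) F i.+1]pE prod_folded -pE /F (prim_expr_order z_prim) rmorph1 addrC.
congr (_ * _); apply: eq_bigr => s _.
have -> : z ^+ (p - s.+1) = (z ^+ s.+1)^-1.
  rewrite -[LHS](mulfK (expf_neq0 s.+1 z0)) -exprD subnK ?(prim_expr_order z_prim) ?mul1r //.
  by have := ltn_ord s; move: (nat_of_ord s) => m; move: p_odd; clear; lia.
have H : fpsC (z ^+ s.+1) * fpsC (z ^+ s.+1)^-1 = 1 :> fps algC.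
  by rewrite -rmorphM /= divff ?expf_neq0 ?rmorph1.
move: (fpsC (z ^+ _)) (fpsC _^-1) H => a b ab.
have -> : (y + a) * (y + b) = y ^+ 2 + y * (a + b) + a * b by ring.
have -> : (1 + y * a) * (1 + y * b) = 1 + y * (a + b) + y ^+ 2 * (a * b) by ring.
by rewrite ab mulr1 addrAC [RHS]addrAC [y ^+ 2 + 1]addrC.
Qed.

Section ThetaAtTorsion.
Variables (p : nat) (w : algC).
Hypothesis p_prime : prime p.
Hypothesis p_odd : odd p.
Hypothesis w_prim : (4 * p).-primitive_root w.
Local Notation R := (fps algC).

Let h := p./2.
Let pE : p = h.*2.+1. Proof. by rewrite -[LHS]odd_double_half p_odd. Qed.
Let p_gt0 : (0 < p)%N. Proof. exact: prime_gt0. Qed.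
Let w0 : w != 0.
Proof. by rewrite (prim_root_eq0 w_prim) -lt0n muln_gt0. Qed.

Definition Xq : R := fsubst 1 (p ^ 2) (pedX algC).
Let D M : R := \prod_(m < M) (1 + mono 1 (p ^ 2) ^+ (16 * m + 8)).
Let N M : R := \prod_(m < M) (1 + mono 1 (p ^ 2) ^+ (16 * m.+1)).

Let Xq_product M : eqtrunc M (Xq * D M) (mono 1 (p ^ 2) * N M).
Proof. by apply: pedX_fsubst_product; rewrite expn_gt0 p_gt0. Qed.

Let fcoef_prod1 M (F : nat -> R) : (forall m, fcoef (F m) 0 = 0) ->
  fcoef (\prod_(m < M) (1 + F m)) 0 != 0.
Proof.
move=> F0; rewrite fcoef_prod0 big1 ?oner_neq0 // => m _.
by rewrite fcoefD F0 addr0.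
Qed.

Let monoX0 (c : algC) k e : (0 < k)%N -> (0 < e)%N -> fcoef (mono c k ^+ e) 0 = 0.
Proof. by move=> k0 e0; rewrite monoX /= ifN // eq_sym -lt0n muln_gt0 k0. Qed.

Let p2_gt0 : (0 < p ^ 2)%N. Proof. by rewrite expn_gt0 p_gt0. Qed.
Let D0 M : fcoef (D M) 0 != 0.
Proof.
by apply: (@fcoef_prod1 M (fun m => mono 1 (p ^ 2) ^+ (16 * m + 8))) => m; apply: monoX0; rewrite ?addn_gt0 ?orbT.
Qed.

Let rQE m c k : rQ p ^+ m * mono c k = mono c (16 * p ^ 2 * m + k).
Proof. by rewrite /rQ monoX expr1n monoM mul1r. Qed.

(** The factor m = 0 is the constant 1 + c, and the extra factor at the far end is 1 up to order
    M. *)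
Let prod_drop M (c : algC) :
  eqtrunc M (\prod_(m < M) (1 + rQ p ^+ m * mono c 0))
    ((1 + fpsC c) ^+ (0 < M)%N * \prod_(m < M) (1 + rQ p ^+ m.+1 * mono c 0)).
Proof.
case: M => [|M]; first by move=> i; rewrite ltn0.
rewrite big_ord_recl [in X in eqtrunc _ _ X]big_ord_recr /= expr0 mul1r expr1 monoC.
apply: eqtruncM; first by []; rewrite -[X in eqtrunc _ X]mulr1.
apply: eqtruncM; first by [].
rewrite -[X in eqtrunc _ X]addr0; apply: eqtruncD; first by [].
apply: eqtrunc_sym; rewrite /rQ monoX expr1n.
by apply: eqtrunc_mono0; nia.
Qed.

(** The 2 is the constant factor 1 + 1 isolated by [prod_drop]; it is what Y = sqrt(2) X absorbs. *)
Theorem theta_zero : tO p w (0, 0) = 2 * Xq ^+ 2 * tE p w (0, 0).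
Proof.
apply: eqtruncP => M; have := @theta_quotient p w p_prime p_odd w_prim 0 0 M p_gt0.
rewrite mulr0 oppr0 expr0z muln0 exp0n // muln0 mono1 mul1r subn0 => T.
have EE : EP p 1 0 M = D M ^+ 2.
  rewrite /EP invr1 muln0 addn0 subn0 -expr2; congr (_ ^+ 2).
  by apply: eq_bigr => m _; rewrite rQE monoX expr1n; congr (1 + mono _ _); lia.
have OE : eqtrunc M (OP p 1 0 M) (2 * N M ^+ 2).
  rewrite /OP invr1 muln0 subn0.
  have N1 : \prod_(m < M) (1 + rQ p ^+ m.+1 * mono 1 0) = N M.
    by apply: eq_bigr => m _; rewrite rQE monoX expr1n; congr (1 + mono _ _); lia.
  have N2 : \prod_(m < M) (1 + rQ p ^+ m * mono 1 (16 * p ^ 2)) = N M.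
    by apply: eq_bigr => m _; rewrite rQE monoX expr1n; congr (1 + mono _ _); lia.
  rewrite N2 expr2 mulrA; apply: eqtruncM; last by [].
  apply: (eqtrunc_trans (@prod_drop M 1)); rewrite N1.
  by case: (M) => [|m]; [move=> i; rewrite ltn0 | rewrite expr1 rmorph1].
apply: (@eqtrunc_cancel _ _ _ _ (D M ^+ 2)).
  by rewrite expr2 fcoefM big_ord1 mulf_neq0.
move: T; rewrite EE => T; apply: (eqtrunc_trans T).
apply: (eqtrunc_trans (eqtruncM (@eqtrunc_refl _ _ _) (eqtruncM (@eqtrunc_refl _ _ _) OE))).
have -> : 2 * Xq ^+ 2 * tE p w (0, 0) * D M ^+ 2 = tE p w (0, 0) * (2 * ((Xq * D M) * (Xq * D M))) by ring.
apply: eqtruncM; first by []; rewrite mulrCA; apply: eqtruncM; first by [].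
apply: eqtrunc_sym; apply: (eqtrunc_trans (eqtruncM (@Xq_product M) (@Xq_product M))).
by rewrite mulrACA -!expr2 monoX expr1n mulnC.
Qed.

Let pedX_product_p c M :
  eqtrunc M (fsubst c p (pedX algC) * \prod_(n < M * p) (1 + mono c p ^+ (16 * n + 8)))
    (mono c p * \prod_(n < M * p) (1 + mono c p ^+ (16 * n.+1))).
Proof.
apply: eqtruncW (@pedX_fsubst_product _ c p (M * p) p_gt0); exact: leq_pmulr.
Qed.

Let sum_s : (\sum_(s < h) 8 * s.+1 = p ^ 2 - 1)%N.
Proof.
rewrite pE; elim: h => [|m IHm]; first by rewrite big_ord0.
by rewrite big_ord_recr /= IHm -!mulnn; lia.
Qed.

(** Balances the exponents of the leading monomials of the triple products along a line. *)
Let sum_sqr : (p ^ 2 + \sum_(s < h) 2 * (p - 2 * s.+1) ^ 2 =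
  p + \sum_(s < h) 8 * s.+1 ^ 2)%N.
Proof.
have H : (\sum_(s < h) 2 * (p - 2 * s.+1) ^ 2 + p * \sum_(s < h) 8 * s.+1 =
    h * (2 * p ^ 2) + \sum_(s < h) 8 * s.+1 ^ 2)%N.
  have -> : (h * (2 * p ^ 2) = \sum_(s < h) 2 * p ^ 2)%N by rewrite sum_nat_const card_ord.
  rewrite big_distrr -[LHS]big_split -[RHS]big_split /=.
  apply: eq_bigr => s _; have : (2 * s.+1 <= p)%N by rewrite pE; have := ltn_ord s; lia.
  by move: (s.+1) => m; rewrite -!mulnn; nia.
move: H; rewrite sum_s; set A := (\sum_(s < h) _)%N; set B := (\sum_(s < h) _)%N.
by rewrite -mulnn pE; nia.
Qed.

Let prod_centered_p (F : nat -> R) :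
  \prod_(n < p) F n = F h * \prod_(s < h) (F (h + s.+1)%N * F (h - s.+1)%N).
Proof. by rewrite -prod_centered -pE. Qed.

Let prod_folded_p (F : nat -> R) :
  \prod_(n < p) F n.+1 = F p * \prod_(s < h) (F s.+1 * F (p - s.+1)%N).
Proof. by have := prod_folded F h; rewrite -pE. Qed.

(* With [tau = c q^(1/p)], the factors of the triple products for the multiples
   of the base point fill the gaps between those of [Xq], giving all the factors
   [1 + tau^(16n + 8)], respectively [1 + tau^(16n)]. *)
Theorem theta_line_finite (beta : nat) (c := w ^+ (4 * beta)) :
  (\prod_(s < p./2) tO p w (32 * beta%:Z * s.+1%:Z, s.+1%:Z)) * Xq =
  fsubst c p (pedX algC) *
  \prod_(s < p./2) tE p w (32 * beta%:Z * s.+1%:Z, s.+1%:Z).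
Proof.
have cp : c ^+ p = 1.
  by rewrite /c -exprM mulnAC exprM (prim_expr_order w_prim) expr1n.
have c0 : c != 0 by rewrite expf_neq0.
pose m1 : R := \prod_(s < h) mono 1 (8 * s.+1 ^ 2).
have m10 : m1 != 0 by apply/prodf_neq0 => s _; rewrite mono_eq0 oner_neq0.
apply: (mulIf m10); apply: eqtruncP => M.
pose k (s : nat) : int := 32 * beta%:Z * s.+1%:Z.
pose m2 : R := \prod_(s < h) mono (w ^ (- k s)) (2 * (p - 2 * s.+1) ^ 2).
pose EPs := \prod_(s < h) EP p (w ^ (2 * k s)) s.+1 M.
pose OPs := \prod_(s < h) OP p (w ^ (2 * k s)) s.+1 M.
have T : eqtrunc M ((\prod_(s < h) tO p w (k s, s.+1%:Z)) * (m1 * EPs))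
    ((\prod_(s < h) tE p w (k s, s.+1%:Z)) * (m2 * OPs)).
  rewrite /m1 /m2 /EPs /OPs -!big_split /=; apply: eqtrunc_prod => s _.
  apply: theta_quotient => //; rewrite pE; have := ltn_ord s; lia.
have wk s : w ^ (2 * k s) = c ^+ (16 * s.+1).
  by rewrite /c -exprM exprnP; congr (w ^ _); rewrite /k; lia.
have cV m n : (p %| m + n)%N -> (c ^+ m)^-1 = c ^+ n.
  move=> /dvdnP[i mn]; apply: (mulfI (expf_neq0 m c0)).
  by rewrite divff ?expf_neq0 // -exprD mn mulnC exprM cp expr1n.
have cE m n i : (m = n + p * i)%N -> c ^+ m = c ^+ n.
  by move=> ->; rewrite exprD [_ ^+ (p * _)]exprM cp expr1n mulr1.
have ED : EPs * D M = \prod_(n < M * p) (1 + mono c p ^+ (16 * n + 8)).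
  rewrite (prod_mul_ord (fun n => 1 + mono c p ^+ (16 * n + 8))) mulrC.
  have -> : EPs = \prod_(s < h) \prod_(m < M) ((1 + rQ p ^+ m * mono (w ^ (2 * k s)) (8 * p ^ 2 + 16 * p * s.+1)) *
      (1 + rQ p ^+ m * mono (w ^ (2 * k s))^-1 (8 * p ^ 2 - 16 * p * s.+1))).
    by apply: eq_bigr => s _; rewrite big_split.
  rewrite exchange_big -big_split /=; apply: eq_bigr => m _.
  rewrite (prod_centered_p (fun n => 1 + mono c p ^+ (16 * (p * m + n) + 8))).
  congr (_ * _).
    rewrite !monoX expr1n (cE _ 0%N (16 * m + 8)%N) ?expr0; last by rewrite pE; nia.
    by congr (1 + mono _ _); rewrite -mulnn pE; nia.
  apply: eq_bigr => s _; rewrite !rQE !monoX wk; have := ltn_ord s => lts.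
  congr ((1 + mono _ _) * (1 + mono _ _)).
  - by apply/esym/(cE _ _ (16 * m + 8)%N); rewrite pE; nia.
  - by rewrite -mulnn pE; nia.
  - apply: cV; rewrite (_ : _ + _ = p * (16 * m + 8))%N ?dvdn_mulr //.
    by rewrite pE; nia.
  - by rewrite -mulnn pE; nia.
have ON : OPs * N M = \prod_(n < M * p) (1 + mono c p ^+ (16 * n.+1)).
  rewrite (prod_mul_ord (fun n => 1 + mono c p ^+ (16 * n.+1))) mulrC.
  have -> : OPs = \prod_(s < h) \prod_(m < M) ((1 + rQ p ^+ m * mono (w ^ (2 * k s)) (16 * p * s.+1)) *
      (1 + rQ p ^+ m * mono (w ^ (2 * k s))^-1 (16 * p ^ 2 - 16 * p * s.+1))).
    by apply: eq_bigr => s _; rewrite big_split.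
  rewrite exchange_big -big_split /=; apply: eq_bigr => m _.
  under [RHS]eq_bigr => n _ do rewrite -addnS.
  rewrite (prod_folded_p (fun n => 1 + mono c p ^+ (16 * (p * m + n)))).
  congr (_ * _).
    rewrite !monoX expr1n (cE _ 0%N (16 * m.+1)%N) ?expr0; last by nia.
    by congr (1 + mono _ _); rewrite -mulnn; nia.
  apply: eq_bigr => s _; rewrite !rQE !monoX wk; have := ltn_ord s => lts.
  have sp : (s.+1 <= p)%N by rewrite pE; lia.
  congr ((1 + mono _ _) * (1 + mono _ _)).
  - by apply/esym/(cE _ _ (16 * m)%N); nia.
  - by rewrite -mulnn; nia.
  - apply: cV; rewrite (_ : _ + _ = p * (16 * m + 16))%N ?dvdn_mulr //.
    by nia.
  - by rewrite -mulnn; nia.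
(* Exponents agree by [sum_sqr]. The constants multiply to c^(-(p^2 - 1)), which is c because c^p =
   1. *)
have MM : mono 1 (p ^ 2) * m2 = mono c p * m1.
  rewrite /m1 /m2 !prod_mono !monoM big1_eq mulr1 mul1r sum_sqr; congr mono.
  transitivity (\prod_(s < h) (c ^+ (8 * s.+1))^-1).
    apply: eq_bigr => s _; rewrite /c -exprM exprnP invr_expz; congr (w ^ _).
    by rewrite /k; lia.
  rewrite prodfV -expr_sum sum_s (cV _ 1%N) ?expr1 //.
  by rewrite subnK // -mulnn dvdn_mulr.
have DT0 : fcoef (EPs * D M) 0 != 0.
  rewrite ED; apply: (@fcoef_prod1 _ (fun m => mono c p ^+ (16 * m + 8))) => m.
  by apply: monoX0; rewrite ?addn_gt0 ?orbT.
apply: (eqtrunc_cancel DT0).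
have H1 := eqtruncM T (@Xq_product M).
rewrite -/h; set To := \prod_(s < h) _ in H1 *; set Te := \prod_(s < h) tE _ _ _ in H1 *.
rewrite (_ : To * Xq * m1 * (EPs * D M) = To * (m1 * EPs) * (Xq * D M)); last by ring.
apply: (eqtrunc_trans H1).
rewrite (_ : Te * _ * _ = Te * (mono 1 (p ^ 2) * m2) * (OPs * N M)); last by ring.
rewrite MM ON ED (_ : Te * _ * _ = (Te * m1) * (mono c p * \prod_(n < M * p) (1 + mono c p ^+ (16 * n.+1)))); last by ring.
apply: (eqtrunc_trans (eqtruncM (@eqtrunc_refl _ _ _) (eqtrunc_sym (@pedX_product_p c M)))).
by set U := \prod_(n < _) _; rewrite (_ : Te * m1 * _ = fsubst c p (pedX algC) * Te * m1 * U); last by ring.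
Qed.

(** By Gauss's lemma this is the Legendre symbol of 2 modulo p; the argument relies only on its
    square being 1. *)
Definition theta_sign : algC := \prod_(s < p./2) ((w ^+ 4) ^+ s.+1 + ((w ^+ 4) ^+ s.+1)^-1).

Let z := w ^+ 4.
Let z_prim : p.-primitive_root z.
Proof.
have p4 : (p %| 4 * p)%N by rewrite dvdn_mull.
by have := dvdn_prim_root w_prim p4; rewrite mulnK.
Qed.
Let z0 n : z ^+ n != 0. Proof. by rewrite !expf_neq0. Qed.
Let z2_prim : p.-primitive_root (z ^+ 2).
Proof. by rewrite prim_root_exp_coprime // coprime2n. Qed.

(** [prod_cyclotomic] at y = 1 and z^2, since (1 + z^(2s)) (1 + z^(-2s)) = (z^s + z^(-s))^2. *)
Lemma theta_sign2 : theta_sign ^+ 2 = 1.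
Proof.
have := @prod_cyclotomic p (z ^+ 2) 1 p_odd z2_prim; rewrite expr1n -[RHS]mulr1.
have two : (1 + 1 : R) != 0.
  by rewrite -(rmorph1 (@fpsC algC)) -rmorphD /= -monoC mono_eq0 (pnatr_eq0 _ 2).
move/(mulfI two) => H; have <- : fcoef (1 : R) 0 = 1 by [].
rewrite -H fcoef_prod0 -prodrXl; apply: eq_bigr => s _.
rewrite fcoefM big_ord1 !mul1r !fcoefD /= -/z [(z ^+ 2) ^+ _]exprAC.
by move: (z ^+ _) (@z0 s.+1) => a a0; field.
Qed.

(** On this line the triple products differ only by p-th roots of unity, so [prod_cyclotomic] merges
    them with the product of [Xq] into its image under y -> y^p. The constants left over by
    [prod_drop] make up [theta_sign]. *)
Theorem theta_line_infinite :
  (\prod_(s < p./2) tO p w (4 * s.+1%:Z, 0)) * Xq =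
  fpsC theta_sign * fsubst 1 (p ^ 3) (pedX algC) *
  \prod_(s < p./2) tE p w (4 * s.+1%:Z, 0).
Proof.
apply: eqtruncP => M.
have p3 : (0 < p ^ 3)%N by rewrite expn_gt0 p_gt0.
pose k (s : nat) : int := 4 * s.+1%:Z.
pose EPs := \prod_(s < h) EP p (w ^ (2 * k s)) 0 M.
pose OPs := \prod_(s < h) OP p (w ^ (2 * k s)) 0 M.
pose m2 : R := \prod_(s < h) mono (w ^ (- k s)) (2 * p ^ 2).
have T : eqtrunc M ((\prod_(s < h) tO p w (k s, 0)) * EPs)
    ((\prod_(s < h) tE p w (k s, 0)) * (m2 * OPs)).
  rewrite /m2 /EPs /OPs -!big_split /=; apply: eqtrunc_prod => s _.
  have := @theta_quotient p w p_prime p_odd w_prim (k s) 0 M p_gt0.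
  by rewrite exp0n // muln0 mono1 mul1r subn0.
have wk s : w ^ (2 * k s) = (z ^+ 2) ^+ s.+1.
  by rewrite /z -!exprM exprnP; congr (w ^ _); rewrite /k; lia.
pose DT : R := \prod_(m < M) (1 + mono 1 (p ^ 3) ^+ (16 * m + 8)).
pose NT : R := \prod_(m < M) (1 + mono 1 (p ^ 3) ^+ (16 * m.+1)).
have ED : EPs * D M = DT.
  have -> : EPs = \prod_(s < h) \prod_(m < M)
     ((1 + mono 1 (p ^ 2) ^+ (16 * m + 8) * fpsC ((z ^+ 2) ^+ s.+1)) *
      (1 + mono 1 (p ^ 2) ^+ (16 * m + 8) * fpsC ((z ^+ 2) ^+ s.+1)^-1)).
    rewrite /EPs; apply: eq_bigr => s _; rewrite /EP muln0 addn0 subn0 big_split /=.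
    by congr (_ * _); apply: eq_bigr => m _;
      rewrite rQE wk -monoC monoX expr1n monoM mul1r; congr (1 + mono _ _); lia.
  rewrite exchange_big mulrC -big_split /=; apply: eq_bigr => m _.
  rewrite prod_cyclotomic // !monoX !expr1n; congr (1 + mono _ _).
  by rewrite !expnS; nia.
have ON : eqtrunc M (OPs * N M) (fpsC (\prod_(s < h) (1 + (z ^+ 2) ^+ s.+1)) * NT).
  have NTE : NT = (\prod_(s < h) \prod_(m < M)
     ((1 + mono 1 (p ^ 2) ^+ (16 * m.+1) * fpsC ((z ^+ 2) ^+ s.+1)) *
      (1 + mono 1 (p ^ 2) ^+ (16 * m.+1) * fpsC ((z ^+ 2) ^+ s.+1)^-1))) * N M.
    rewrite exchange_big mulrC -big_split /=; apply: eq_bigr => m _.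
    rewrite prod_cyclotomic // !monoX !expr1n; congr (1 + mono _ _).
    by rewrite !expnS; nia.
  rewrite NTE mulrA; apply: eqtruncM; last by [].
  rewrite rmorph_prod /= -big_split /=; apply: eqtrunc_prod => s _.
  rewrite /OP muln0 subn0 big_split /= mulrA wk; apply: eqtruncM; last first.
    move=> i _; congr (fcoef _ i); apply: eq_bigr => m _.
    by rewrite rQE -monoC monoX expr1n monoM mul1r; congr (1 + mono _ _); lia.
  apply: (eqtrunc_trans (@prod_drop M _)).
  case: (M) => [|m]; first by move=> i; rewrite ltn0.
  rewrite expr1 rmorphD rmorph1 /=; apply: eqtruncM; first by [].
  move=> i _; congr (fcoef _ i); apply: eq_bigr => j _.
  by rewrite rQE -monoC monoX expr1n monoM mul1r; congr (1 + mono _ _); lia.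
have MM : mono 1 (p ^ 2) * m2 * fpsC (\prod_(s < h) (1 + (z ^+ 2) ^+ s.+1)) =
    mono 1 (p ^ 3) * fpsC theta_sign.
  rewrite /m2 prod_mono !monoM !mul1r !addn0 -big_split; congr mono.
    rewrite /theta_sign; apply: eq_bigr => s _ /=.
    rewrite -/z (_ : w ^ (- k s) = (z ^+ s.+1)^-1); last first.
      by rewrite /z -exprM exprnP invr_expz; congr (w ^ _); rewrite /k; lia.
    by rewrite [(z ^+ 2) ^+ _]exprAC; move: (z ^+ _) (@z0 s.+1) => a a0; field.
  by rewrite sum_nat_const card_ord !expnS expn0 !muln1 pE; nia.
have DT0 : fcoef (EPs * D M) 0 != 0.
  rewrite ED; apply: (@fcoef_prod1 _ (fun m => mono 1 (p ^ 3) ^+ (16 * m + 8))) => m.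
  by apply: monoX0; rewrite ?addn_gt0 ?orbT.
apply: (eqtrunc_cancel DT0).
have H1 := eqtruncM T (@Xq_product M).
rewrite -/h; set To := \prod_(s < h) _ in H1 *; set Te := \prod_(s < h) tE _ _ _ in H1 *.
rewrite (_ : To * Xq * (EPs * D M) = To * EPs * (Xq * D M)); last by ring.
apply: (eqtrunc_trans H1).
rewrite (_ : Te * _ * _ = Te * (mono 1 (p ^ 2) * m2) * (OPs * N M)); last by ring.
apply: (eqtrunc_trans (eqtruncM (@eqtrunc_refl _ _ _) ON)).
rewrite (_ : Te * _ * _ = Te * (mono 1 (p ^ 2) * m2 * fpsC (\prod_(s < h) (1 + (z ^+ 2) ^+ s.+1))) * NT); last by ring.
rewrite MM (_ : Te * _ * _ = Te * fpsC theta_sign * (mono 1 (p ^ 3) * NT)); last by ring.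
apply: (eqtrunc_trans (eqtruncM (@eqtrunc_refl _ _ _) (eqtrunc_sym (@pedX_fsubst_product _ 1 (p ^ 3) M p3)))).
by rewrite -/DT ED (_ : Te * _ * (_ * DT) = fpsC theta_sign * fsubst 1 (p ^ 3) (pedX algC) * Te * DT); last by ring.
Qed.
End ThetaAtTorsion.

(** * Integrality of the sums over lines *)

(** Constant terms show that P(0) = 0; one factor f is cancelled, and so on. *)
Lemma fps_transcendental (K : fieldType) (f : fps K) (P : {poly K}) :
  f != 0 -> fcoef f 0 = 0 -> (map_poly (@fpsC K) P).[f] = 0 -> P = 0.
Proof.
move=> f_neq0 f0; elim/poly_ind: P => // P c IHP.
rewrite rmorphD rmorphM /= map_polyX map_polyC /= hornerMXaddC => Pf.
have c0 : c = 0.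
  have := congr1 (fun g => fcoef g 0) Pf.
  by rewrite fcoefD fcoefM big_ord1 f0 mulr0 add0r.
move: Pf; rewrite c0 rmorph0 !addr0 => /eqP.
by rewrite mulf_eq0 (negPf f_neq0) orbF => /eqP/IHP ->; rewrite mul0r.
Qed.

Lemma sum_option (A : nmodType) (T : finType) (F : option T -> A) :
  \sum_x F x = F None + \sum_b F (Some b).
Proof.
rewrite (bigD1 None) //=; congr (_ + _); rewrite (reindex_omap Some id) /=.
  by apply: eq_bigl => b; rewrite eqxx.
by case.
Qed.

Lemma sqr_pred_gt0 p : prime p -> (0 < (p ^ 2).-1)%N.
Proof.
move=> p_prime; have : (1 < p ^ 2)%N by rewrite -(exp1n 2) ltn_exp2r ?prime_gt1.
by move: (p ^ 2)%N; clear; lia.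
Qed.

Section TorsionInstance.
Variables (p : nat) (w : algC).
Hypothesis p_prime : prime p.
Hypothesis p_odd : odd p.
Hypothesis w_prim : (4 * p).-primitive_root w.
Local Notation R := (fps algC).
Local Notation KK := {fraction R}.
Local Notation V := (int * int)%type.

Let p_gt0 : (0 < p)%N. Proof. exact: prime_gt0. Qed.
Let w0 : w != 0.
Proof. by rewrite (prim_root_eq0 w_prim) -lt0n muln_gt0. Qed.

Definition ffrac : {rmorphism R -> KK} := @tofrac R.
Definition fiota : {rmorphism algC -> KK} := ffrac \o @fpsC algC.
Definition sqrt2 : algC := sqrtC 2.
Let sqrt22 : sqrt2 ^+ 2 = 2. Proof. exact: sqrtCK. Qed.
Let sqrt2_neq0 : sqrt2 != 0. Proof. by rewrite sqrtC_eq0 pnatr_eq0. Qed.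

Let ffrac_eq0 f : (ffrac f == 0) = (f == 0). Proof. exact: tofrac_eq0. Qed.
Let ffrac_inj : injective ffrac.
Proof.
by move=> f g /eqP; rewrite -subr_eq0 -rmorphB ffrac_eq0 subr_eq0 => /eqP.
Qed.

Let Xp : R := Xq p.
Let Yp : R := fpsC sqrt2 * Xp.
Let Y := ffrac Yp.

Let pedX1 : fcoef (pedX algC) 1 = 1.
Proof. by have := @pedX_coef algC 0; rewrite muln0 expr0 mul1r => ->; rewrite ped0. Qed.
Let Xp_neq0 : Xp != 0.
Proof.
apply/eqP => /(congr1 (fun f => fcoef f (p ^ 2))) /eqP.
rewrite -[fcoef Xp _]/(if (p ^ 2 %| p ^ 2)%N then _ else _) dvdnn divnn expn_gt0 p_gt0.
by rewrite pedX1 mul1r expr1 oner_eq0.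
Qed.

Let Yp_neq0 : Yp != 0.
Proof. by rewrite /Yp -monoC mulf_eq0 negb_or mono_eq0 sqrt2_neq0; exact: Xp_neq0. Qed.

Let Y_tr P : (map_poly fiota P).[Y] = 0 -> P = 0.
Proof.
rewrite map_poly_comp /= horner_map => /eqP; rewrite ffrac_eq0 => /eqP.
apply: fps_transcendental; first exact: Yp_neq0.
have Xp0 : fcoef Xp 0 = 0.
  by rewrite -[LHS]/(if (p ^ 2 %| 0)%N then _ else _) dvdn0 div0n pedX_coef0 // mul0r.
by rewrite fcoefM big_ord1 Xp0 mulr0.
Qed.

Let E P := ffrac (tE p w P).
Let O P := ffrac (tO p w P).
Let e P := ffrac (te p w P).
Let o P := ffrac (to p w P).

(** Generators of the p + 1 lines. First coordinates are multiples of 4 because the first period is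
    4p; 32 b runs over all classes modulo p, and 32 is chosen so that w^(2 * 32 b) is the 16th power
    of w^(4b), as the exponents 16 n of the products of X demand. *)
Let g (l : option 'I_p) : V := if l is Some b then (32 * (b : nat)%:Z, 1) else (4, 0).
Let h := p./2.

Let pair_mulrn (x y : int) n : (x, y) *+ n = (x *+ n, y *+ n) :> V.
Proof. by elim: n => // n IHn; rewrite !mulrS IHn. Qed.

Let gE l n : g l *+ n =
  (if l is Some b then 32 * (b : nat)%:Z * n%:Z else 4 * n%:Z, if l is Some _ then n%:Z else 0).
Proof.
have zM (x : int) m : x *+ m = x * m%:Z by rewrite pmulrn mulrzz.
by case: l => [b|]; rewrite /g pair_mulrn !zM ?mul1r ?mul0r.
Qed.

Let K := K0 p.
Let tt (t : option 'I_p * 'I_h) := g t.1 *+ t.2.+1.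
Let sg := odd p./2.

Let two_h (m : 'I_h) : (m.+1 * 2 < p)%N.
Proof. by have := ltn_ord m; rewrite /h; move: (nat_of_ord m) p_odd; clear; lia. Qed.

Let Y2E : O 0 / E 0 = Y ^+ 2.
Proof.
rewrite /O /E; have -> : (0 : V) = (0, 0) by [].
rewrite (theta_zero p_prime p_odd w_prim) !rmorphM /= mulfK ?ffrac_eq0 ?tE_neq0 //.
by rewrite -!rmorphM -rmorphXn /Yp exprMn -rmorphXn /= sqrt22 rmorph_nat.
Qed.

Let O_base a b P : P = (p%:Z * (p%:Z + 4 * a) - p%:Z, p%:Z * b) ->
  O P / E P = (-1) ^+ sg * Y ^+ 2.
Proof.
move=> ->; have [EE OE] := theta_base p_prime p_odd w_prim a b.
rewrite -Y2E /O /E EE OE !rmorphM rmorphXn rmorphN1 /=.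
have c0 : ffrac (fpsC (w ^ (- (2 * (p%:Z * p%:Z - p%:Z) * b)))) != 0.
  by rewrite ffrac_eq0 -monoC mono_eq0 expfz_eq0 (negPf w0) andbF.
by rewrite -mulf_div divff // mulr1 mulrA.
Qed.

Let ndvdz (x : int) : x != 0 -> (`|x| < p)%N -> ~~ (p %| x)%Z.
Proof.
by move=> x0 ltx; rewrite dvdzE /= gtnNdvd // absz_gt0.
Qed.

Let O_dvd (x : int) : ~~ (p %| x)%Z -> O (4 * x - p%:Z, 0) != 0.
Proof.
move=> px; rewrite ffrac_eq0 tO_neq0_dvd ?dvdz0 //; apply: contra px.
case/dvdzP => q xE; have : (p %| 4 * x)%Z.
  by apply/dvdzP; exists (2 * q + 2); move: xE; rewrite PoszM; lia.
by rewrite Gauss_dvdzr // coprimezE (@coprimeXr 2 p 2) // coprimen2.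
Qed.

Let O_ndvd k b : ~~ (p %| b)%Z -> O (k, b) != 0.
Proof. by move=> pb; rewrite ffrac_eq0 tO_neq0. Qed.

Let subK k b : (k, b) - K = (k - p%:Z, b).
Proof. by congr pair; rewrite subr0. Qed.

Let O_tt t : O (tt t) != 0.
Proof.
case: t => -[b|] m; rewrite /tt gE /=; have := two_h m; move: (nat_of_ord m) => n lt.
  by apply/O_ndvd/ndvdz => //=; move: lt; clear; lia.
rewrite ffrac_eq0 tO_neq0_dvd ?dvdz0 //; apply/negP => /dvdzP[q].
by rewrite PoszM mulrCA; move: (q * p%:Z) p_odd => r; clear; lia.
Qed.

Let O_ttK t : O (tt t - K) != 0.
Proof.
case: t => -[b|] m; rewrite /tt gE subK /=; have := two_h m; move: (nat_of_ord m) => n lt.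
  by apply/O_ndvd/ndvdz => //=; move: lt; clear; lia.
by apply/O_dvd/ndvdz => //=; move: lt; clear; lia.
Qed.

Let O_ttD t u : t != u -> O (tt t + tt u - K) != 0.
Proof.
move=> _; case: t u => -[b|] m [[b'|] m']; rewrite /tt !gE /=;
  have := two_h m; have := two_h m'; move: (nat_of_ord m) (nat_of_ord m') => n n' lt lt'.
- by rewrite subK; apply/O_ndvd/ndvdz => /=; move: lt lt'; clear; lia.
- by rewrite subK; apply/O_ndvd/ndvdz => /=; move: lt lt'; clear; lia.
- by rewrite subK; apply/O_ndvd/ndvdz => /=; move: lt lt'; clear; lia.
rewrite (_ : (_, _) - K = (4 * (n.+1%:Z + n'.+1%:Z) - p%:Z, 0)); last by rewrite subK; congr pair => /=; clear; lia.
by apply/O_dvd/ndvdz => /=; move: lt lt'; clear; lia.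
Qed.

Let O_ttB t u : t != u -> O (tt t - tt u - K) != 0.
Proof.
case: t u => -[b|] m [[b'|] m'] tu; rewrite /tt !gE /=;
  have := two_h m; have := two_h m' => lt' lt.
- have [mE|mN] := eqVneq m m'; last first.
    rewrite subK; apply/O_ndvd/ndvdz => /=; last by move: lt lt'; clear; lia.
    by apply: contra mN => /eqP H; apply/eqP/val_inj => /=; move: H; clear; lia.
  have bN : b != b' by apply: contraNneq tu => ->; rewrite mE.
  rewrite (_ : (_, _) - K = (4 * (8 * m.+1%:Z * ((b : nat)%:Z - (b' : nat)%:Z)) - p%:Z, 0)); last first.
    by rewrite mE subK; congr pair => /=; ring.
  apply: O_dvd; rewrite -mulrA Gauss_dvdzr; last first.
    by rewrite coprimezE (@coprimeXr 3 p 2) // coprimen2.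
  rewrite dvdzE abszM Euclid_dvdM // negb_or -!dvdzE.
  rewrite !ndvdz //=; have := ltn_ord b; have := ltn_ord b'; [|clear; lia|move: lt; clear; lia].
  by rewrite subr_eq0 => _ _; apply: contra bN => /eqP[H]; apply/eqP/val_inj.
- by rewrite subK; apply/O_ndvd/ndvdz => /=; move: lt lt'; clear; lia.
- by rewrite subK; apply/O_ndvd/ndvdz => /=; move: lt lt'; clear; lia.
rewrite (_ : (_, _) - K = (4 * (m.+1%:Z - m'.+1%:Z) - p%:Z, 0)); last by rewrite subK; congr pair => /=; clear; lia.
apply/O_dvd/ndvdz => /=; last by move: lt lt'; clear; lia.
apply: contra tu => /eqP H; rewrite xpair_eqE eqxx /=; apply/eqP/val_inj => /=; move: H; clear; lia.
Qed.

Let O_ttp t : O (tt t *+ p - K) = 0.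
Proof.
case: t => -[b|] m; rewrite /tt -mulrnA gE subK /O; apply/eqP; rewrite ffrac_eq0; apply/eqP => /=.
  rewrite -[RHS](tO_torsion p_prime p_odd w_prim (8 * (b : nat)%:Z * m.+1%:Z) m.+1%:Z).
  by congr (tO _ _ (_, _)); rewrite mulnC PoszM; ring.
rewrite -[RHS](tO_torsion p_prime p_odd w_prim m.+1%:Z 0) mulr0.
by congr (tO _ _ (_, _)); rewrite mulnC PoszM; ring.
Qed.

Let KpE : K *+ p = (p%:Z * p%:Z, 0).
Proof. by rewrite pair_mulrn mul0rn pmulrn mulrzz. Qed.

Let W_Ktp t : O ((K + tt t) *+ p - K) / E ((K + tt t) *+ p - K) = (-1) ^+ sg * Y ^+ 2.
Proof.
rewrite mulrnDl /tt -mulrnA gE KpE.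
case: t => -[b|] m /=.
  apply: (O_base (a := 8 * (b : nat)%:Z * m.+1%:Z) (b := m.+1%:Z)).
  by congr pair => /=; rewrite ?subr0 ?add0r mulnC PoszM; ring.
apply: (O_base (a := m.+1%:Z) (b := 0)).
by congr pair => /=; rewrite ?mulr0 ?subr0 // mulnC PoszM; ring.
Qed.

Let W_Kp : O (K *+ p - K) / E (K *+ p - K) = (-1) ^+ sg * Y ^+ 2.
Proof.
apply: (O_base (a := 0) (b := 0)); rewrite KpE; congr pair => /=; by rewrite ?mulr0 ?addr0 ?subr0.
Qed.

Let W_per x l : O (x + g l *+ p) / E (x + g l *+ p) = O x / E x.
Proof.
case: x => k b; pose a := if l is Some b' then 8 * (b' : nat)%:Z else 1.
pose c : int := if l is Some _ then 1 else 0.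
have -> : (k, b) + g l *+ p = (k + 4 * a * p%:Z, b + c * p%:Z).
  rewrite gE /a /c; case: (l) => [b'|]; congr pair => /=; ring.
rewrite /O /E tO_period // tE_period // !rmorphM /=.
rewrite -mulf_div divff ?mul1r // ffrac_eq0 -monoC mono_eq0 expfz_eq0 (negPf w0) andbF //.
Qed.

Lemma theta_lines_integral j : exists P k, P \is a polyOver Aint /\
  (\sum_l theta_line Y E O p g l ^+ j) * Y ^+ k = fiota ((p ^ 2).-1.-root 2) * (map_poly fiota P).[Y].
Proof.
have Y0 : Y != 0 by rewrite ffrac_eq0.
pose S := SYcomring Y_tr; pose f := SYembed Y_tr.
have p2 := sqr_pred_gt0 p_prime.
have H : exists2 w, w \in SY fiota Y & \sum_l theta_line Y E O p g l ^+ j = fiota ((p ^ 2).-1.-root 2) * w.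
  apply: (@theta_line_integral KK fiota Y Y_tr V E O e o K _ _ _ _ _ Y2E p _ g sg p_prime p_odd
    _ O_tt O_ttK O_ttD O_ttB O_ttp W_Ktp W_Kp W_per ((p ^ 2).-1.-root 2) _ S f (@SYembed_in _ _ _ Y_tr) (@SYembedP _ _ _ Y_tr)).
  - by move=> x y; rewrite -!rmorphM -rmorphD tEE.
  - by move=> x y; rewrite -!rmorphM -rmorphD tOO.
  - by move=> x; rewrite /e te_K0.
  - by move=> x; rewrite /o to_K0 // rmorphN.
  - by move=> x; rewrite ffrac_eq0 tE_neq0.
  - by rewrite card_option card_ord.
  - by rewrite rootCK.
  by apply: (Aint_expr_inv p2); rewrite rootCK // rpred_nat.
have [x /asboolP[P [k [PA xE]]] sE] := H.
by exists P, k; split=> //; rewrite sE xE mulrA divfK ?expf_neq0.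
Qed.

Let line_series l (G : R) :
  (\prod_(s < p./2) tO p w (g l *+ s.+1)) * Xp = G * \prod_(s < p./2) tE p w (g l *+ s.+1) ->
  theta_line Y E O p g l = ffrac (fpsC sqrt2 * G).
Proof.
move=> H; rewrite /theta_line prodf_div /O /E -!rmorph_prod /Y /Yp !rmorphM /=.
have E0 : ffrac (\prod_(s < p./2) tE p w (g l *+ s.+1)) != 0.
  by rewrite ffrac_eq0; apply/prodf_neq0 => s _; rewrite tE_neq0.
apply: (mulIf E0); rewrite -!mulrA mulVf // mulr1; congr (_ * _).
by rewrite mulrC -(rmorphM ffrac) -(rmorphM ffrac) H.
Qed.

(** Back from the fraction field to series: each line product is sqrt(2) times the series given by
    the two product theorems. *)
Lemma theta_lines_series j : exists P k, P \is a polyOver Aint /\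
  ((fpsC sqrt2 * (fpsC (theta_sign p w) * fsubst 1 (p ^ 3) (pedX algC))) ^+ j +
    \sum_(b < p) (fpsC sqrt2 * fsubst (w ^+ (4 * b)) p (pedX algC)) ^+ j) * Yp ^+ k =
  fpsC ((p ^ 2).-1.-root 2) * (map_poly (@fpsC algC) P).[Yp].
Proof.
have [P [k [PA H]]] := theta_lines_integral j; exists P, k; split=> //.
apply: ffrac_inj; rewrite [RHS](rmorphM ffrac) -horner_map -map_poly_comp /= -[RHS]H.
rewrite (rmorphM ffrac) (rmorphXn ffrac) (rmorphD ffrac) sum_option (rmorph_sum ffrac) /=.
congr (_ * _); congr (_ + _).
  rewrite (rmorphXn ffrac) (@line_series None (fpsC (theta_sign p w) * fsubst 1 (p ^ 3) (pedX algC))) //.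
  transitivity ((\prod_(s < p./2) tO p w (4 * s.+1%:Z, 0)) * Xq p).
    by congr (_ * _); apply: eq_bigr => s _; rewrite gE.
  rewrite (theta_line_infinite p_prime p_odd w_prim).
  by congr (_ * _); apply: eq_bigr => s _; rewrite gE.
apply: eq_bigr => b _; rewrite (rmorphXn ffrac) (@line_series (Some b) (fsubst (w ^+ (4 * b)) p (pedX algC))) //.
transitivity ((\prod_(s < p./2) tO p w (32 * (b : nat)%:Z * s.+1%:Z, s.+1%:Z)) * Xq p).
  by congr (_ * _); apply: eq_bigr => s _; rewrite gE.
rewrite (theta_line_finite p_prime p_odd w_prim).
by congr (_ * _); apply: eq_bigr => s _; rewrite gE.
Qed.
End TorsionInstance.

(** * The Hecke operator *)

Lemma fpsC_mono (K : fieldType) c (f : fps K) n : fcoef (fpsC c * f) n = c * fcoef f n.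
Proof. by rewrite -monoC fcoef_monoM subn0. Qed.

Lemma fsubst_fpsC (K : fieldType) c k (d : K) : (0 < k)%N -> fsubst c k (fpsC d) = fpsC d.
Proof. by move=> k0; rewrite -monoC fsubst_mono // expr0 mulr1 muln0. Qed.

Lemma fsubst_horner (K : fieldType) c k (P : {poly K}) f : (0 < k)%N ->
  fsubst c k (map_poly (@fpsC K) P).[f] = (map_poly (@fpsC K) P).[fsubst c k f].
Proof.
move=> k0; elim/poly_ind: P => [|P d IHP]; first by rewrite rmorph0 !horner0 raddf0.
rewrite rmorphD rmorphM /= map_polyX map_polyC /= !hornerMXaddC.
by rewrite raddfD /= fsubstM // IHP fsubst_fpsC.
Qed.

Lemma fsubst_inj (K : fieldType) k : (0 < k)%N -> injective (@fsubst K 1 k).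
Proof.
move=> k0 f g fg; apply: fpsP => n; have := congr1 (fun h => fcoef h (k * n)) fg.
by rewrite /= dvdn_mulr // mulKn // expr1n !mulr1.
Qed.

Section Hecke.
Variables (p : nat) (eps : algC).
Hypothesis p_gt0 : (0 < p)%N.
Local Notation R := (fps algC).

Definition hecke (f : R) : R :=
  Fps (fun n => p%:R * fcoef f (p * n) + if (p %| n)%N then eps * fcoef f (n %/ p) else 0).

Lemma fcoef_hecke f n : fcoef (hecke f) n =
  p%:R * fcoef f (p * n) + if (p %| n)%N then eps * fcoef f (n %/ p) else 0.
Proof. by []. Qed.

Fact hecke_zmod : zmod_morphism hecke.
Proof.
move=> f g; apply: fpsP => n; rewrite /hecke fcoefB /= mulrBr.
by case: ifP => _; rewrite ?mulrBr; ring.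
Qed.
HB.instance Definition _ := GRing.isZmodMorphism.Build R R hecke hecke_zmod.

Lemma heckeZ c f : hecke (fpsC c * f) = fpsC c * hecke f.
Proof.
apply: fpsP => n; rewrite fpsC_mono !fcoef_hecke !fpsC_mono mulrDr.
by case: ifP => _; rewrite ?mulr0; congr (_ + _); rewrite mulrCA.
Qed.

(** Summing over the p-th roots of unity keeps the exponents divisible by p, whence p U_p, here
    after q -> q^(p^2). *)
Lemma hecke_sum z f : p.-primitive_root z ->
  fpsC eps * fsubst 1 (p ^ 3) f + \sum_(b < p) fsubst (z ^+ b) p f =
  fsubst 1 (p ^ 2) (hecke f).
Proof.
move=> z_prim; apply: fpsP => n; rewrite fcoefD fcoef_sum fpsC_mono.
have [/dvdnP[m ->]|pn] := boolP (p %| n)%N; last first.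
  rewrite big1 => [|b _]; last by rewrite /= (negPf pn).
  have p3 : (p ^ 3 %| n)%N = false.
    by apply: contraNF pn; apply: dvdn_trans; rewrite expnS dvdn_mulr.
  have p2 : (p ^ 2 %| n)%N = false.
    by apply: contraNF pn; apply: dvdn_trans; rewrite expnS dvdn_mulr.
  by rewrite /= p3 p2 mulr0 addr0.
have -> : \sum_(b < p) fcoef (fsubst (z ^+ b) p f) (m * p) =
    if (p %| m)%N then p%:R * fcoef f m else 0.
  under eq_bigr => b _ do rewrite /= dvdn_mull // mulnK // -exprM.
  rewrite -mulr_sumr mulrC; under eq_bigr => b _ do rewrite mulnC exprM.
  case: ifPn => pm.
    have zm : z ^+ m = 1 by apply/eqP; rewrite -(prim_order_dvd z_prim).
    under eq_bigr => b _ do rewrite zm expr1n.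
    by rewrite sumr_const card_ord.
  have : (z ^+ m - 1) * \sum_(b < p) (z ^+ m) ^+ b = 0.
    by rewrite -subrX1 exprAC (prim_expr_order z_prim) expr1n subrr.
  move/eqP; rewrite mulf_eq0 subr_eq0 -(prim_order_dvd z_prim) (negPf pm) /=.
  by move/eqP ->; rewrite mul0r.
have cE k g : fcoef (fsubst 1 k g) (m * p) = if (k %| m * p)%N then fcoef g (m * p %/ k) else 0.
  by rewrite /=; case: ifP => // _; rewrite expr1n mulr1.
rewrite !cE fcoef_hecke (expnSr p 2) (expnSr p 1) expn1 !dvdn_pmul2r // !divnMr //.
case: (boolP (p %| m)%N) => pm; last first.
  by rewrite ifN ?mulr0 ?addr0 //; apply: contra pm; apply: dvdn_trans; rewrite dvdn_mulr.
have {pm} [l ->] := dvdnP pm.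
rewrite mulnK // [(l * p)%N]mulnC [(p * _ %| _)%N]dvdn_pmul2l // divnMl // addrC.
by congr (_ + _); case: ifP; rewrite ?mulr0.
Qed.
End Hecke.

Section HeckePowers.
Local Notation R := (fps algC).
Local Notation X := (pedX algC).
Local Notation "P ^F" := (map_poly (@fpsC algC) P) (at level 2, format "P ^F").

(** One [eps] serves all odd j, because an odd power of [theta_sign] is [theta_sign] itself; this is
    why only odd powers of X are considered. *)
Lemma hecke_sqrt2 p : prime p -> odd p -> exists2 eps : algC, eps = 1 \/ eps = -1 &
  forall j, odd j -> exists P k, P \is a polyOver Aint /\
    fpsC sqrt2 ^+ j * hecke p eps (X ^+ j) * (fpsC sqrt2 * X) ^+ k =
    fpsC ((p ^ 2).-1.-root 2) * P^F.[fpsC sqrt2 * X].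
Proof.
move=> p_prime p_odd; have p_gt0 := prime_gt0 p_prime.
have [w w_prim] : {w : algC | (4 * p).-primitive_root w}.
  by apply: C_prim_root_exists; rewrite muln_gt0.
have p2_gt0 : (0 < p ^ 2)%N by rewrite expn_gt0 p_gt0.
have p3_gt0 : (0 < p ^ 3)%N by rewrite expn_gt0 p_gt0.
have sgn2 := theta_sign2 p_prime p_odd w_prim.
exists (theta_sign p w).
  by have /eqP := sgn2; rewrite sqrf_eq1 => /orP[]/eqP; [left|right].
move=> j j_odd; have [P [k [PA H]]] := theta_lines_series p_prime p_odd w_prim j.
exists P, k; split=> //; apply: (fsubst_inj p2_gt0).
have Yq : fsubst 1 (p ^ 2) (fpsC sqrt2 * X) = fpsC sqrt2 * Xq p.
  by rewrite fsubstM // fsubst_fpsC.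
rewrite !fsubstM // fsubst_horner // !fsubstX // !fsubst_fpsC // Yq -H; congr (_ * _).
have zp : p.-primitive_root (w ^+ 4).
  have p4 : (p %| 4 * p)%N by rewrite dvdn_mull.
  by have := dvdn_prim_root w_prim p4; rewrite mulnK.
rewrite -(hecke_sum _ p_gt0 _ zp) mulrDr; congr (_ + _).
  rewrite [RHS]exprMn [Z in _ = _ * Z]exprMn -fsubstX //; congr (_ * (_ * _)).
  rewrite -rmorphXn; congr (fpsC _); rewrite -[j]odd_double_half j_odd exprD expr1.
  by rewrite -mul2n exprM sgn2 expr1n mulr1.
rewrite mulr_sumr; apply: eq_bigr => b _.
by rewrite [RHS]exprMn exprM fsubstX.
Qed.

Definition fint (f : R) := forall n, fcoef f n \in Num.int.

Lemma fintM f g : fint f -> fint g -> fint (f * g).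
Proof. by move=> fi gi n; rewrite fcoefM rpred_sum // => i _; rewrite rpredM. Qed.

Lemma fintX f n : fint f -> fint (f ^+ n).
Proof.
move=> fi; elim: n => [|n IHn]; last by rewrite exprS; apply: fintM.
by move=> m; rewrite expr0 fcoef1.
Qed.

Lemma fint_pedX : fint X.
Proof.
move=> n; have [n8|/pedX_coef0 ->] := boolP (n %% 8 == 1)%N; last exact: rpred0.
rewrite (divn_eq n 8) (eqP n8) mulnC addn1 pedX_coef.
by rewrite rpredM ?rpred_sign ?rpred_nat.
Qed.

Lemma fint_hecke p eps f : eps = 1 \/ eps = -1 -> fint f -> fint (hecke p eps f).
Proof.
move=> e1 fi n; rewrite fcoef_hecke; apply: rpredD; first by apply: rpredM; [exact: rpred_nat | exact: fi].
case: (p %| n)%N; last exact: rpred0.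
by apply: rpredM; [case: e1 => ->; [exact: rpred1 | exact: rpredN1] | exact: fi].
Qed.

Lemma fcoef_pedX_expr i : fcoef (X ^+ i) i = 1 /\ forall n, (n < i)%N -> fcoef (X ^+ i) n = 0.
Proof.
have X1 : fcoef X 1 = 1 by have := @pedX_coef algC 0; rewrite ped0 muln0 expr0 mulr1.
have X0 n : (n < 1)%N -> fcoef X n = 0 by case: n => // _; rewrite pedX_coef0.
elim: i => [|i [IH1 IH0]]; first by rewrite expr0.
rewrite exprS -add1n; split; first by rewrite fcoefM_low // X1 IH1 mulr1.
move=> n ltn; rewrite fcoefM big1 // => l _.
have [l0|l0] := leqP 1 l; last by rewrite X0 ?mul0r.
by rewrite IH0 ?mulr0 //; have := ltn_ord l; lia.
Qed.

Lemma hecke_odd p eps f : odd p -> (forall n, ~~ odd n -> fcoef f n = 0) ->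
  forall n, ~~ odd n -> fcoef (hecke p eps f) n = 0.
Proof.
move=> p_odd f0 n n_even; rewrite fcoef_hecke f0 ?oddM ?p_odd // mulr0 add0r.
case: ifP => // /dvdnP[m nE]; rewrite f0 ?mulr0 // nE mulnK ?odd_gt0 //.
by move: n_even; rewrite nE oddM p_odd andbT.
Qed.

Lemma pedX_expr_parity i n : odd n != odd i -> fcoef (X ^+ i) n = 0.
Proof.
elim: i n => [|i IHi] n oN; first by rewrite expr0 fcoef1; case: n oN.
rewrite exprS fcoefM big1 // => l _.
have [l8|] := boolP (l %% 8 == 1)%N; last by move/pedX_coef0->; rewrite mul0r.
rewrite IHi ?mulr0 // oddB; last by rewrite -ltnS.
have -> : odd l by rewrite (divn_eq l 8) (eqP l8) addn1 /= oddM andbF.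
by move: oN => /=; case: (odd n); case: (odd i).
Qed.

(** X^i = q^i + ..., so passing from the numbers c(i) to the coefficients of the series is
    unitriangular. *)
Lemma pedX_expansion_coef (c : nat -> algC) N n : (n < N)%N ->
  fcoef (\sum_(i < N) fpsC (c i) * X ^+ i) n =
  c n + \sum_(i < n) c i * fcoef (X ^+ i) n.
Proof.
move=> ltnN; rewrite fcoef_sum.
under eq_bigr => i _ do rewrite fpsC_mono.
rewrite -(big_mkord xpredT (fun i => c i * fcoef (X ^+ i) n)) (@big_cat_nat _ _ _ n.+1) //=.
rewrite [Z in _ + Z = _]big_nat [Z in _ + Z = _]big1 => [|i /andP[ltni _]]; last first.
  by have [_ ->] := fcoef_pedX_expr i; rewrite ?mulr0.
by rewrite big_nat_recr //= big_mkord (fcoef_pedX_expr n).1 mulr1 addr0 addrC.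
Qed.

(** P^d = r^d / 2 is rational and an algebraic integer, so r^d is an even integer, and then so is
    r. *)
Lemma int_half (r P v : algC) d : (0 < d)%N -> v ^+ d = 2 -> P \in Aint ->
  r = v * P -> r \in Crat -> r / 2 \in Num.int.
Proof.
move=> d0 vd PA rE rQ; have vA : v \in Aint.
  by apply: (Aint_expr_inv d0); rewrite vd; apply: rpred_nat.
have /intrP[m mE] : r \in Num.int by apply: Cint_rat_Aint => //; rewrite rE rpredM.
have /intrP[t tE] : P ^+ d \in Num.int.
  apply: Cint_rat_Aint; last by rewrite rpredX.
  have -> : P ^+ d = r ^+ d / 2 by rewrite rE exprMn vd mulrC mulKf ?pnatr_eq0.
  by rewrite rpred_div ?rpredX // rpred_nat.
have : m ^+ d = 2 * t.
  by apply/eqP; rewrite -(eqr_int algC) rmorphXn rmorphM /= -mE -tE rE exprMn vd.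
move=> mt; have : (2 %| m)%Z.
  have : (2 %| m ^+ d)%Z by rewrite mt dvdz_mulr.
  by rewrite !dvdzE abszX Euclid_dvdX // => /andP[].
case/dvdzP => q qE; by rewrite mE qE rmorphM /= mulfK ?pnatr_eq0.
Qed.

Lemma hecke_pow p : prime p -> odd p -> exists2 eps : algC, eps = 1 \/ eps = -1 &
  forall j, exists2 Q : {poly algC}, forall i, Q`_i \in Num.int &
    fpsC (2 ^+ j) * hecke p eps (X ^+ j.*2.+1) = fpsC 2 * X * Q^F.[fpsC 2 * X ^+ 2].
Proof.
move=> p_prime p_odd; have [eps e1 H] := hecke_sqrt2 p_prime p_odd; exists eps => // j.
have [|P [k [PA {}H]]] := H j.*2.+1; first by rewrite /= odd_double.
set F := hecke p eps _ in H *; set v := _.-root _ in H; set s := sqrt2 in H.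
have d0 := sqr_pred_gt0 p_prime.
have vd : v ^+ (p ^ 2).-1 = 2 by rewrite rootCK.
have s2 : s ^+ 2 = 2 by exact: sqrtCK.
have s0 : s != 0 by rewrite sqrtC_eq0 pnatr_eq0.
pose c i := v * P`_i * s ^+ i / s ^+ (j.*2.+1 + k).
pose M := size P.
have FX : F * X ^+ k = \sum_(i < k + M.*2) fpsC (c i) * X ^+ i.
  have t0 : fpsC (s ^+ (j.*2.+1 + k)) != 0 by rewrite -monoC mono_eq0 expf_neq0.
  apply: (mulfI t0); rewrite exprD rmorphM !rmorphXn /=.
  have -> : fpsC s ^+ j.*2.+1 * fpsC s ^+ k * (F * X ^+ k) =
      fpsC s ^+ j.*2.+1 * F * (fpsC s * X) ^+ k by rewrite [(_ * X) ^+ k]exprMn; ring.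
  rewrite H (@horner_coef_wide _ (k + M.*2)); last first.
    by apply: leq_trans (size_poly _ _) _; rewrite -/M; lia.
  rewrite !mulr_sumr; apply: eq_bigr => i _.
  rewrite coef_map /= [(_ * X) ^+ i]exprMn -!rmorphXn /= -rmorphM /= -exprD !mulrA -!rmorphM /=.
  by congr (fpsC _ * _); rewrite /c [RHS]mulrC divfK ?expf_neq0.
have FXi : fint (F * X ^+ k).
  by apply: fintM; [apply: fint_hecke => // | ]; apply/fintX/fint_pedX.
(* By triangularity, c(n) is a coefficient of the integral series F X^k minus an integral
   combination of the earlier c(i). *)
have ci n : c n \in Num.int.
  elim/ltn_ind: n => n IHn; have [ltn|len] := ltnP n (k + M.*2)%N; last first.
    rewrite /c nth_default ?mulr0 ?mul0r ?rpred0 //.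
    by apply: leq_trans len; rewrite -/M; lia.
  have := pedX_expansion_coef c ltn; rewrite -FX => /(canLR (addrK _)) <-.
  apply: rpredB; first exact: FXi.
  by apply: rpred_sum => i _; apply: rpredM; [exact: IHn | exact/fintX/fint_pedX].
(* F X^k has no term below q^k, so the same triangularity removes the negative powers of X from the
   expansion of F. *)
have c0 n : (n < k)%N -> c n = 0.
  elim/ltn_ind: n => n IHn ltnk; have ltn : (n < k + M.*2)%N by lia.
  have := pedX_expansion_coef c ltn; rewrite -FX big1 ?addr0 => [<-|i _]; last first.
    by rewrite IHn ?mul0r //; apply: ltn_trans ltnk.
  rewrite fcoefM big1 // => i _; rewrite (fcoef_pedX_expr k).2 ?mulr0 //.
  by apply: leq_ltn_trans ltnk; rewrite leq_subr.
have FE : F = \sum_(i < M.*2) fpsC (c (k + i)%N) * X ^+ i.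
  have X0 : X ^+ k != 0.
    apply/eqP => H0; have := (fcoef_pedX_expr k).1; rewrite H0 fcoef0 => /esym/eqP.
    by rewrite oner_eq0.
  apply: (mulIf X0); rewrite FX big_split_ord /= big1 ?add0r => [|i _]; last first.
    by rewrite c0 ?rmorph0 ?mul0r.
  by rewrite mulr_suml; apply: eq_bigr => i _; rewrite -mulrA -exprD [(i + k)%N]addnC.
have {}FE : F = \sum_(i < M) fpsC (c (k + i.*2.+1)%N) * X ^+ i.*2.+1.
  apply: fpsP => n; have [n_odd|n_even] := boolP (odd n).
    rewrite FE (big_even_odd _ (fun i => fpsC (c (k + i)%N) * X ^+ i)) big_split.
    rewrite fcoefD [Z in Z + _]fcoef_sum big1 ?add0r // => i _.
    by rewrite fpsC_mono pedX_expr_parity ?mulr0 // odd_double n_odd.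
  rewrite hecke_odd // => [|m m_even]; last first.
    by rewrite pedX_expr_parity //= odd_double (negPf m_even).
  rewrite fcoef_sum big1 // => i _.
  by rewrite fpsC_mono pedX_expr_parity ?mulr0 //= odd_double (negPf n_even).
(* For these indices the powers of sqrt(2) in c combine to 2^i / 2^j. As c is integral, v P_(k+2i+1)
   is rational, and [int_half] provides the extra factor 2. *)
pose e i := v * P`_(k + i.*2.+1) / 2.
have ce i : 2 ^+ j * c (k + i.*2.+1)%N = 2 ^+ i * (2 * e i).
  have sE n : s ^+ n.*2.+1 = s * 2 ^+ n by rewrite exprS -mul2n exprM s2.
  rewrite /c /e exprD sE exprD sE.
  by field; rewrite s0 !expf_neq0 ?pnatr_eq0.
have ei i : e i \in Num.int.
  apply: (int_half d0 vd (_ : P`_(k + i.*2.+1) \in Aint)) => //; first exact: (polyOverP PA).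
  have -> : v * P`_(k + i.*2.+1) = 2 ^+ j * c (k + i.*2.+1)%N / 2 ^+ i.
    by rewrite ce [RHS]mulrC mulKf ?expf_neq0 ?pnatr_eq0 // /e [RHS]mulrC divfK ?pnatr_eq0.
  have /intrP[m ->] := ci (k + i.*2.+1)%N.
  by apply: rpred_div; [apply: rpredM; [apply: rpredX|apply: rpred_int]|apply: rpredX]; apply: rpred_nat.
exists (\poly_(i < M) e i) => [i|]; first by rewrite coef_poly; case: ifP => // _; apply: rpred0.
rewrite FE mulr_sumr (@horner_coef_wide _ M); last first.
  by apply: leq_trans (size_poly _ _) _; apply: size_poly.
rewrite mulr_sumr; apply: eq_bigr => i _.
rewrite coef_map coef_poly ltn_ord /= mulrA -rmorphM ce !rmorphM rmorphXn /=.
by rewrite [(_ * X ^+ 2) ^+ i]exprMn -exprM mul2n exprS; ring.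
Qed.

(** 2^r times the integral combinations of the 2^i X^(2i+1). *)
Definition even_class r (f : R) := exists2 Q : {poly algC}, forall i, Q`_i \in Num.int &
  f = fpsC (2 ^+ r) * (X * Q^F.[fpsC 2 * X ^+ 2]).

Lemma horner_map_sum (I : Type) (r : seq I) (Q : I -> {poly algC}) (c : I -> algC) (f : R) :
  (\sum_(i <- r) c i *: Q i)^F.[f] = \sum_(i <- r) fpsC (c i) * (Q i)^F.[f].
Proof.
rewrite rmorph_sum horner_sum; apply: eq_bigr => i _.
by rewrite /= map_polyZ hornerZ.
Qed.

Lemma even_class_hecke p : prime p -> odd p -> exists eps, forall r f,
  even_class r f -> even_class r.+1 (hecke p eps f).
Proof.
move=> p_prime p_odd; have [eps _ H] := hecke_pow p_prime p_odd; exists eps => r _ [Q QZ ->].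
have [T TP] := @boolp.choice _ _ (fun j (T : {poly algC}) => (forall i, T`_i \in Num.int) /\
  fpsC (2 ^+ j) * hecke p eps (X ^+ j.*2.+1) = fpsC 2 * X * T^F.[fpsC 2 * X ^+ 2])
  (fun j => let: ex_intro2 T TZ TE := H j in ex_intro _ T (conj TZ TE)).
exists (\sum_(j <- index_iota 0 (size Q)) Q`_j *: T j).
  by move=> i; rewrite coef_sum rpred_sum // => j _; rewrite coefZ rpredM //; apply: (TP j).1.
rewrite (@horner_coef_wide _ (size Q)); last exact: size_poly.
rewrite heckeZ mulr_sumr raddf_sum horner_map_sum big_mkord !mulr_sumr.
apply: eq_bigr => j _; rewrite coef_map /=.
have -> : X * (fpsC Q`_j * (fpsC 2 * X ^+ 2) ^+ j) = fpsC (Q`_j * 2 ^+ j) * X ^+ j.*2.+1.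
  by rewrite [(_ * X ^+ 2) ^+ j]exprMn -exprM mul2n rmorphM rmorphXn /= exprS; ring.
rewrite heckeZ (rmorphM (@fpsC algC)) -[fpsC Q`_j * _ * _]mulrA (TP j).2.
by rewrite [2 ^+ r.+1]exprS (rmorphM (@fpsC algC)) /=; ring.
Qed.

Lemma even_class_coef r f n : even_class r f ->
  exists2 z, z \in Num.int & fcoef f n = 2 ^+ r * z.
Proof.
case=> Q QZ ->; exists (fcoef (X * Q^F.[fpsC 2 * X ^+ 2]) n); last by rewrite fpsC_mono.
suff H : fint (X * Q^F.[fpsC 2 * X ^+ 2]) by exact: H.
have CZ c : c \in Num.int -> fint (fpsC c) by move=> cZ [|m] //; apply: rpred0.
apply: fintM; first exact: fint_pedX; rewrite (@horner_coef_wide _ (size Q)); last exact: size_poly.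
move=> m; rewrite fcoef_sum; apply: rpred_sum => i _; rewrite coef_map.
apply: fintM; first exact: CZ.
by apply/fintX/fintM; [apply: CZ | apply/fintX/fint_pedX].
Qed.

(** For q prime to N, the V_q part does not reach the coefficient at N, and U_q moves it to qN,
    which is still prime to the remaining, distinct primes. *)
Lemma hecke_iter (ps : seq nat) : all prime ps -> all odd ps -> uniq ps ->
  exists2 f, even_class (size ps) f & forall N, all (coprime N) ps ->
    fcoef f N = (\prod_(q <- ps) q)%:R * fcoef X (N * \prod_(q <- ps) q).
Proof.
elim: ps => [_ _ _|q ps IHps /= /andP[q_prime ps_prime] /andP[q_odd ps_odd] /andP[q_ps ps_uniq]].
  exists X => [|N _]; last by rewrite big_nil mul1r muln1.
  by exists 1 => [i|]; [rewrite coef1 | rewrite expr0 !rmorph1 mul1r -polyC1 hornerC mulr1].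
have [f fC fE] := IHps ps_prime ps_odd ps_uniq.
have [eps epsH] := even_class_hecke q_prime q_odd.
exists (hecke q eps f) => [|N /andP[Nq Nps]]; first exact: epsH.
rewrite fcoef_hecke ifN ?addr0; last by rewrite -prime_coprime // coprime_sym.
rewrite big_cons fE; first by rewrite natrM mulrA mulnA [(N * q)%N]mulnC.
apply/allP => l lps; rewrite coprimeMl (allP Nps) // andbT.
rewrite prime_coprime // dvdn_prime2 //; last exact: (allP ps_prime).
by apply: contraNneq q_ps => ->.
Qed.

(** The product of the primes is odd, so it cancels against the power of 2. *)
Lemma dvd_ped (ps : seq nat) N m : all prime ps -> all odd ps -> uniq ps ->
  all (coprime N) ps -> (8 * m).+1 = (N * \prod_(q <- ps) q)%N ->
  (2 ^ size ps %| ped m)%N.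
Proof.
move=> ps_prime ps_odd ps_uniq Nps mE.
have [f fC fE] := hecke_iter ps_prime ps_odd ps_uniq.
have [z /intrP[t ->]] := even_class_coef N fC.
rewrite fE // -mE pedX_coef => H.
have co : coprime (2 ^ size ps) (\prod_(q <- ps) q).
  rewrite coprimeXl // coprime2n; move: ps_odd; clear.
  by elim: ps => [|q ps IHps] /=; rewrite ?big_nil // big_cons oddM => /andP[-> /IHps].
have {H} : ((\prod_(q <- ps) q)%N%:Z * ((-1) ^+ m * (ped m)%:Z) = 2 ^+ size ps * t)%R.
  apply/eqP; rewrite -(eqr_int algC) !rmorphM /= !rmorphXn rmorphN1 /=; apply/eqP.
  exact: H.
move/(congr1 absz); rewrite !abszM absz_sign abszX mul1n => H.
by rewrite -(Gauss_dvdr _ co) [(_ * ped m)%N]H dvdn_mulr.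
Qed.

End HeckePowers.

Local Open Scope nat_scope.

Theorem theorem1p5 (n : nat) :
  exists u : nat, forall (v : nat) (p : 'I_(u + v) -> nat),
    1 <= v ->
    injective p ->
    (forall i, prime (p i)) ->
    (forall i, coprime (p i) 6) ->
    (forall i, coprime n (p i)) ->
    ped_rat ((3 * (\prod_(i < u + v) p i)%N%:R * n%:R - 1) / 8)%R
      = 0 %[mod 2 ^ v].
Proof.
exists 0%N => v p _ p_inj p_prime p6 np; rewrite mod0n /ped_rat.
case: ifP => [/natrP[m mE]|_]; last by rewrite mod0n.
rewrite mE natrK; apply/eqP.
pose ps := [seq p i | i <- enum 'I_v].
have prod_ps : \prod_(q <- ps) q = (\prod_(i < v) p i)%N.
  by rewrite big_map big_enum.
rewrite -[v in (2 ^ v)%N]card_ord cardE -(size_map p).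
(* Coprimality to 6 splits in two: each prime is odd, and it is prime to the factor 3 of N = 3n. *)
apply: (@dvd_ped ps (3 * n)).
- by apply/allP => _ /mapP[i _ ->].
- apply/allP => _ /mapP[i _ ->]; have := p6 i.
  by rewrite (_ : 6 = 2 * 3)%N // coprimeMr coprimen2 => /andP[].
- by rewrite map_inj_uniq ?enum_uniq.
- apply/allP => _ /mapP[i _ ->]; rewrite coprimeMl np andbT coprime_sym.
  by have := p6 i; rewrite (_ : 6 = 2 * 3)%N // coprimeMr => /andP[].
apply/eqP; rewrite -(eqr_nat rat) prod_ps -addn1 natrD !natrM -mE; apply/eqP.
by field.
Qed.
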